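(* Let $d\ge1$, $\eta>0$, and let $R$ be a positive random variable bounded above by a constant $\bar r$. Consider the naive acceptance-rejection algorithm (described in the context) for generating a perfect sample of the Gibbs hard-sphere model (torus or Euclidean) with reference intensity $\lambda$ and radii distributed as $R/\lambda^\eta$. The expected running time $C_{\mathsf{itr}}(\lambda)$ of one iteration satisfies, as $\lambda\to\infty$, $$C_{\mathsf{itr}}(\lambda)=\Theta\left(\lambda^{\min\{\eta d,2\}}\right).$$ Furthermore, the expected total running time $\mathcal T_{\mathsf{NAR}}$ of the algorithm satisfies $$\mathcal T_{\mathsf{NAR}}=\begin{cases}\Theta(\lambda^2), & \eta d\ge2,\\ \Theta\left(\lambda^{\eta d}\exp\left((\gamma m_1/2+o(1))\lambda^{2-\eta d}\right)\right), & 1<\eta d<2,\\ \Theta\left(\lambda^{\eta d}\exp\left(\delta\lambda\right)\right)\text{ for some }0<\delta\le1, & \eta d=1,\\ \Theta\left(\lambda^{\eta d}\exp\left((1+o(1))\lambda\right)\right), & 0<\eta d<1,\end{cases}$$ where $\gamma=\pi^{d/2}/\Gamma(d/2+1)$ and $m_1=\mathbb E[(R+\widehat R)^d]$ with $\widehat R$ an independent copy of $R$.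
   Context: Gibbs hard-sphere model: a homogeneous Poisson point process of intensity $\lambda$ of sphere centers on $[0,1]^d$, with i.i.d. radii distributed as $R/\lambda^\eta$ independent of the centers, conditioned on no two spheres overlapping (intersecting). In the torus model $[0,1]^d$ has periodic boundary and spheres are open balls modulo 1; in the Euclidean model they are ordinary open balls in $\mathbb R^d$. It is assumed that $2\bar r/\lambda^\eta<1$. Let $\mathcal P(\lambda)$ be the probability that no two spheres overlap in the unconditioned process. Naive acceptance-rejection algorithm: repeat independent iterations until acceptance. In one iteration, generate $N\sim\mathrm{Poisson}(\lambda)$, then generate one at a time spheres with independent uniform centers on $[0,1]^d$ and i.i.d. radii distributed as $R/\lambda^\eta$, checking each new sphere for overlap with the existing ones, and stop the iteration as soon as an overlap occurs or $N$ non-overlapping spheres have been generated; the iteration is accepted (and the configuration output) in the latter case (including $N=0$). So each iteration is accepted with probability $\mathcal P(\lambda)$ and $\mathcal T_{\mathsf{NAR}}=C_{\mathsf{itr}}(\lambda)/\mathcal P(\lambda)$. Cost model: running time is the number of elementary operations; overlap checks are sequential, so checking the $n$-th sphere against the $n-1$ existing ones costs an amount proportional to $n-1$; generating $N$ costs at most order $\log\lambda$. That is, with $N'$ the number of spheres generated in an unlimited sequence of such spheres up to the first overlap, independent of $N$, there are constants $c,c'>0$ with $c\,\mathbb E[\sum_{n=1}^{\min(N,N')}(n-1)]\le C_{\mathsf{itr}}(\lambda)\le c'(\log\lambda+\mathbb E[\sum_{n=1}^{\min(N,N')}(n-1)])$. $f=\Theta(g)$ means $f=O(g)$ and $g=O(f)$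 as $\lambda\to\infty$.
   Formalization: For ηd=1 the constant δ in exp(δλ) is replaced by δ(λ) in (0,1] converging to a constant δ in (0,1], i.e. exp((δ+o(1))λ); with a constant δ the claim fails in the Euclidean model for d≥2 (small constant R), due to a boundary term of order λ^(1-1/d). *)

(* Defs.v *)
From HB Require Import structures.
From mathcomp Require Import all_boot all_order all_algebra finmap.
From mathcomp Require Import all_classical all_reals all_analysis.

Set Implicit Arguments.
Unset Strict Implicit.
Unset Printing Implicit Defensive.

Import Order.TTheory GRing.Theory Num.Theory.
Import numFieldNormedType.Exports.

Local Open Scope classical_set_scope.
Local Open Scope ring_scope.

(* Lets the O-notation be used at +oo. *)
Canonical pinfty_filterType (R : numFieldType) : filter_on R :=
  FilterType (pinfty_nbhs R) _.

Definition is_Theta (R : realType) (f g : R -> R) : Prop :=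
  f =O_+oo g /\ g =O_+oo f.

Definition Gamma (R : realType) (x : R) : R :=
  \int[@lebesgue_measure R]_(t in `]0, +oo[) (t `^ (x - 1) * expR (- t)).

Definition unit_ball_volume (R : realType) (d : nat) : R :=
  pi `^ (d%:R / 2) / Gamma (d%:R / 2 + 1).

Definition mutually_independent disp (T : measurableType disp) (R : realType)
    (P : probability T R) (I : choiceType) (G : I -> set_system T) : Prop :=
  forall (J : {fset I}) (E : I -> set T), (forall i, i \in J -> G i (E i)) ->
    P (\bigcap_(i in [set` J]) E i) = (\prod_(i <- J) P (E i))%E.

Definition generated_events (T : Type) disp' (T' : measurableType disp')
    (X : T -> T') : set_system T :=
  [set X @^-1` A | A in measurable].

Definition same_law (T : Type) disp (T' : measurableType disp) (R : realType)
    (P : set T -> \bar R) (X Y : T -> T') : Prop :=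
  forall A, measurable A -> P (X @^-1` A) = P (Y @^-1` A).

Definition independent_copy disp (T : measurableType disp) (R : realType)
    (P : probability T R) (X Y : {RV P >-> R}) : Prop :=
  same_law P X Y /\
  mutually_independent P
    (fun b : bool => generated_events (if b then (X : T -> R) else Y)).

Inductive boundary := Torus | Euclidean.

Definition enorm (R : realType) (d : nat) (x : 'rV[R]_d) : R :=
  Num.sqrt (\sum_(i < d) x ord0 i ^+ 2).

(* On the torus a ball is represented by its periodic extension to R^d; two
   balls meet modulo 1 iff their periodic extensions meet. *)
Definition sphere (R : realType) (d : nat) (b : boundary)
    (c : 'rV[R]_d) (r : R) : set 'rV[R]_d :=
  match b with
  | Euclidean => [set y | enorm (y - c) < r]
  | Torus => [set y | exists k : 'rV[int]_d,
                        enorm (y - c - map_mx intr k) < r]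
  end.

Definition overlap (R : realType) (d : nat) (b : boundary)
    (s s' : 'rV[R]_d * R) : Prop :=
  sphere b s.1 s.2 `&` sphere b s'.1 s'.2 !=set0.

(* The marked Poisson process on the unit cube is its total number of points
   together with an infinite i.i.d. sequence of spheres, of which it uses the
   first [sample_count]; an iteration of the algorithm reads the same sequence.
   Spheres are numbered from 0. *)

Record sample disp (T : measurableType disp) (R : realType)
    (P : probability T R) (d : nat) := Sample {
  sample_count : {RV P >-> nat};
  sample_coord : nat -> 'I_d -> {RV P >-> R};
  sample_radius : nat -> {RV P >-> R} }.

Section sample_theory.
Context disp (T : measurableType disp) (R : realType) (P : probability T R)
        (d : nat).
Implicit Types (s : sample P d) (b : boundary) (lambda eta : R).

Definition sample_events s (k : unit + nat + nat * 'I_d) : set_system T :=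
  match k with
  | inl (inl _) => generated_events (sample_count s)
  | inl (inr n) => generated_events (sample_radius s n)
  | inr (n, i) => generated_events (sample_coord s n i)
  end.

(* A uniform point of the cube has i.i.d. uniform coordinates. *)
Definition sample_law (R0 : {RV P >-> R}) eta lambda s : Prop :=
  [/\ forall k : nat,
        P (sample_count s @^-1` [set k]) = (poisson_pmf lambda k)%:E,
      forall n i (A : set R), measurable A ->
        P (sample_coord s n i @^-1` A) = uniform_prob (@ltr01 R) A,
      forall n, same_law P (sample_radius s n)
                           (fun w => R0 w / lambda `^ eta)
    & mutually_independent P (sample_events s)].

Definition sample_sphere s (w : T) (n : nat) : 'rV[R]_d * R :=
  (\row_i sample_coord s n i w, sample_radius s n w).

Definition overlap_within b s (w : T) (n : nat) : Prop :=
  exists i j, (i < j < n)%N /\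
    overlap b (sample_sphere s w i) (sample_sphere s w j).

(* Number of spheres generated up to the first overlap; +oo if there is none. *)
Definition first_overlap b s (w : T) : \bar R :=
  ereal_inf [set n%:R%:E | n in overlap_within b s w].

Definition check_count b s (w : T) : R :=
  \sum_(1 <= n < (sample_count s w).+1 | (n%:R%:E <= first_overlap b s w)%E)
     n.-1%:R.

Definition mean_check_count b s : \bar R := \int[P]_w (check_count b s w)%:E.

Definition nonoverlap_prob b s : R :=
  fine (P [set w | ~ overlap_within b s w (sample_count s w)]).

(* Only large intensities are constrained: [ln lambda] is negative below 1. *)
Definition iteration_cost_model b (s : R -> sample P d) (Citr : R -> R) : Prop :=
  exists c c' : R, [/\ 0 < c, 0 < c' &
    \forall lambda \near +oo,
      (c%:E * mean_check_count b (s lambda) <= (Citr lambda)%:E /\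
       (Citr lambda)%:E
         <= c'%:E * ((ln lambda)%:E + mean_check_count b (s lambda)))%E].

Definition total_cost b (s : R -> sample P d) (Citr : R -> R) (lambda : R) : R :=
  Citr lambda / nonoverlap_prob b (s lambda).

End sample_theory.

(* Main.v *)
(* Write q n for the probability that n spheres with radii r R, r = lambda^-eta,
   do not overlap, and V / lambda^(eta d), V = gamma m1, for the mean volume that
   one sphere forbids to the centre of another. The acceptance probability is
   exp (-x) sum_n q n x^n / n! at x = lambda, and the mean number of checks is
   E sum_(m < N) m q m with N of Poisson law.

   Lower bounds: on the torus, negative correlation in the radius gives
   q (n+1) >= q n (1 - n V / lambda^(eta d)), hence P >= exp (- lambda^2 / (2 K))
   with K = floor (lambda^(eta d) / V).

   Upper bounds: covering the Euclidean cube by boxes makes the generating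
   function submultiplicative. With k^d boxes in each of which two spheres meet
   with the right probability, this gives the matching exponent for
   1 < eta d < 2. Allowing at most one sphere of radius at least a r per cell of
   side of order a r (the birthday problem) bounds sum_n n q n by a multiple of
   lambda^(eta d), and for eta d < 1 gives -ln P >= (p + o(1)) lambda, where
   p = P(R >= a) is as close to 1 as desired.

   For eta d = 1 the same subdivision makes -ln P superadditive under scaling, so
   -ln P / lambda tends to its supremum; the torus differs from the cube by a
   boundary layer only. *)

Require Import Defs.
From HB Require Import structures.
From mathcomp Require Import all_boot all_order all_algebra.
From mathcomp Require Import finmap ring lra zify.
From mathcomp Require Import all_classical all_reals all_analysis.
From mathcomp Require Import measurable_realfun.
Import Order.TTheory GRing.Theory Num.Theory.
Import numFieldNormedType.Exports.
Set Implicit Arguments.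
Unset Strict Implicit.
Unset Printing Implicit Defensive.
Local Open Scope classical_set_scope.
Local Open Scope ring_scope.

(** Distances on the torus are at most the Euclidean ones, so non-overlap is less likely there: a
    lower bound for the torus and an upper bound for the cube each serve both models. The obstacle
    in passing from [n] to [n + 1] spheres is that the volume forbidden by the old spheres depends
    on their radii, whose law is biased by the knowledge that they do not overlap. Negative
    correlation says that this bias can only lower the mean, so the unconditioned mean stays a valid
    bound.

    For 1 < eta d < 2 the boxes must meet two opposite demands: few spheres per box (k^d much larger
    than lambda) and radii small against the box (k much smaller than lambda^eta). Both can hold
    because 1/d < eta.

    The o(1) terms absorb -ln P exactly, so once its leading order is known each Theta concerns the
    cost of one iteration only. Radii are kept unscaled so that a single law [Q] of sequences of
    spheres serves every lambda; conditioning on part of the coordinates is done by resampling the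
    others with [mix]. *)

Definition image_measure d d' (T1 : measurableType d) (T2 : measurableType d')
    (R : realType) (m : {measure set T1 -> \bar R}) (f : T1 -> T2)
    (mf : measurable_fun setT f) : {measure set T2 -> \bar R} :=
  measure_function_pushforward__canonical__measure_function_Measure m mf.

(** * Product laws *)

Section config_space.
Context (R : realType) (I : choiceType).

Definition cylinder (J : {fset I}) (A : I -> set R) : set (I -> R) :=
  [set w | forall i, i \in J -> A i (w i)].

Definition cylinders : set (set (I -> R)) :=
  [set C | exists J A, (forall i, measurable (A i)) /\ C = cylinder J A].

(** An alias, so that the sigma-algebra generated by cylinders is attached to it and not to the bare
    function type. *)
Definition config : Type := I -> R.
Definition config_display : measure_display.
Proof. by []. Qed.
HB.instance Definition _ := Pointed.on config.
HB.instance Definition _ := @isMeasurable.Build config_display config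
  <<s cylinders >> (@sigma_algebra0 _ setT cylinders)
  (@sigma_algebraC _ cylinders) (@sigma_algebra_bigcup _ setT cylinders).

Lemma measurable_cylinder J A : (forall i, measurable (A i)) ->
  measurable (cylinder J A : set config).
Proof. by move=> mA; apply: sub_sigma_algebra; exists J, A. Qed.

Lemma measurable_coord i : measurable_fun setT (fun w : config => w i).
Proof.
move=> _ Y mY; rewrite setTI.
have -> : (fun w : config => w i) @^-1` Y = cylinder [fset i]%fset (fun=> Y).
  apply/seteqP; split=> w /=; rewrite /cylinder /=.
    by move=> Yw j; rewrite inE => /eqP ->.
  by move=> /(_ i); rewrite inE eqxx; apply.
exact: measurable_cylinder.
Qed.

Lemma measurable_config d (T : measurableType d) (f : T -> config) :
  (forall i, measurable_fun setT (fun t => f t i)) -> measurable_fun setT f.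
Proof.
move=> mf; apply: (measurability (cylinders : set (set config))) => // _ [_ [J [A [mA ->]]] <-].
rewrite setTI.
have -> : f @^-1` cylinder J A =
    \bigcap_(i in [set` J]) ((fun t => f t i) @^-1` A i).
  by apply/seteqP; split.
apply: fin_bigcap_measurable => [|i _]; first exact: finite_fset.
by rewrite -[X in measurable X]setTI; exact: mf.
Qed.

(** Cylinders are stable under intersection, so a finite measure is determined by its values on
    them. The identities between laws of configurations rest on this. *)
Lemma config_measure_unique (m1 m2 : {measure set config -> \bar R}) :
  (m1 setT < +oo)%E ->
  (forall J A, (forall i, measurable (A i)) ->
    m1 (cylinder J A) = m2 (cylinder J A)) ->
  forall B, measurable B -> m1 B = m2 B.
Proof.
move=> m1T m12 B mB.
have cT : cylinder fset0 (fun=> setT) = setT.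
  by apply/seteqP; split=> // w _ i.
apply: (measure_unique (cylinders : set (set config)) (fun=> setT)) => //.
- move=> _ _ [J [A [mA ->]]] [J' [A' [mA' ->]]].
  exists (J `|` J')%fset, (fun i => (if i \in J then A i else setT) `&`
                             (if i \in J' then A' i else setT)); split.
    by move=> i; apply: measurableI; case: ifP.
  apply/seteqP; split=> w /=.
    by move=> [h h'] i _; split; case: ifP => //; [exact: h|exact: h'].
  move=> h; split=> i iJ; have := h i; rewrite inE iJ ?orbT => /(_ isT) [];
    by [].
- by move=> _; exists fset0, (fun=> setT); split=> //; rewrite cT.
- by rewrite bigcup_const.
- by move=> _ [J [A [mA ->]]]; exact: m12.
Qed.

End config_space.
Arguments cylinder {R I} J A.

Section independent_config.
Context (R : realType) (I : choiceType).
Implicit Types mu : I -> set R -> \bar R.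

Definition product_law mu (Q : set (config R I) -> \bar R) :=
  forall J A, (forall i, measurable (A i)) ->
    Q (cylinder J A) = (\prod_(i <- J) mu i (A i))%E.

(* Resamples the coordinates outside [J]: integrating over [w'] conditions on [J]. *)
Definition mix (J : pred I) (w w' : config R I) : config R I :=
  fun i => if J i then w i else w' i.

Lemma measurable_mix J :
  measurable_fun setT (fun z : config R I * config R I => mix J z.1 z.2).
Proof.
apply: measurable_config => i; rewrite /mix; case: (J i).
  exact: (measurableT_comp (measurable_coord i) measurable_fst).
exact: (measurableT_comp (measurable_coord i) measurable_snd).
Qed.

Lemma measurable_mixr J w : measurable_fun setT (mix J w).
Proof.
apply: measurable_config => i; rewrite /mix; case: (J i) => //.
exact: measurable_coord.
Qed.

Context mu (Q : probability (config R I) R).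
Hypothesis Qmu : product_law mu Q.

(** Taking the coordinates in [J] from one copy and the others from an independent copy gives again
    the law [Q]. This stands in for Fubini on an infinite product. *)
Lemma integral_mix (J : pred I) (f : config R I -> \bar R) :
  measurable_fun setT f -> (forall w, 0 <= f w)%E ->
  (\int[Q]_w f w = \int[Q]_w \int[Q]_w' f (mix J w w'))%E.
Proof.
move=> mf f0.
pose h := fun z : config R I * config R I => mix J z.1 z.2.
have mh : measurable_fun setT h by exact: measurable_mix.
have QQ B : measurable B -> Q B = pushforward (Q \x Q)%E h B.
  apply: (config_measure_unique (m2 := image_measure (Q \x Q)%E mh)).
    by rewrite (le_lt_trans (probability_le1 Q measurableT))// ltry.
  move=> K A mA; apply: etrans (Qmu K mA) _.
  rewrite [RHS](_ : _ = (Q \x Q)%E (cylinder [fset i in K | J i]%fset A `*`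
      cylinder [fset i in K | ~~ J i]%fset A)); last first.
    congr (product_measure1 _ _ _); apply/seteqP; split=> -[w w'] /=.
      move=> hK; split=> i; rewrite /= !inE => /andP[iK].
        by move=> Ji; have := hK i iK; rewrite /h /mix /= Ji.
      by move=> /negbTE Ji; have := hK i iK; rewrite /h /mix /= Ji.
    move=> [h1 h2] i iK; rewrite /h /mix /=; case: ifPn => Ji.
      by apply: h1; rewrite !inE iK Ji.
    by apply: h2; rewrite !inE iK Ji.
  rewrite product_measure1E; try exact: measurable_cylinder.
  rewrite (big_fsetID _ J) /=.
  by congr (_ * _)%E; apply/esym; exact: Qmu.
transitivity (\int[pushforward (Q \x Q)%E h]_w f w)%E.
  by apply: eq_measure_integral => A mA _; exact: QQ.
rewrite (ge0_integral_pushforward mh)//.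
rewrite preimage_setT fubini_tonelli1//.
  exact: measurableT_comp.
by move=> x; exact: f0.
Qed.

Lemma measurable_reindex (p : I -> I) :
  measurable_fun setT (fun w : config R I => (fun i => w (p i)) : config R I).
Proof. by apply: measurable_config => i; exact: measurable_coord. Qed.

(** An injective relabelling that preserves marginals keeps the coordinates independent: a cylinder
    over [J] pulls back to one over the image of [J], read through the left inverse [g]. *)
Lemma law_reindex (p g : I -> I) B :
  cancel p g -> (forall i, mu (p i) = mu i) -> measurable B ->
  Q ((fun w : config R I => (fun i => w (p i)) : config R I) @^-1` B) = Q B.
Proof.
move=> pK mup mB; apply/esym.
have mp := measurable_reindex p.
apply: (config_measure_unique(m2 := image_measure Q mp)) => //.
  by rewrite (le_lt_trans (probability_le1 Q measurableT))// ltry.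
move=> J A mA; apply: etrans (Qmu J mA) _; rewrite /image_measure /= /pushforward.
rewrite (_ : _ @^-1` _ = cylinder [fset p i | i in J]%fset (A \o g)).
  apply: etrans (esym (Qmu [fset p i | i in J]%fset (A := A \o g) _)); last by move=> i; exact: mA.
  rewrite big_imfset/=; last by move=> i j _ _ /(can_inj pK).
  by apply: eq_bigr => i _; rewrite mup pK.
apply/seteqP; split=> w /=.
  by move=> h _ /imfsetP[i /= iJ ->]; rewrite /= pK; exact: h.
by move=> h i iJ; have := h (p i); rewrite /= pK; apply; rewrite in_imfset.
Qed.

End independent_config.

(** * Affine change of variable *)

Section lebesgue_affine.
Context (R : realType).
Local Notation mu := (@lebesgue_measure R).

Lemma measurable_affine (b s : R) :
  measurable_fun setT (fun x : measurableTypeR R => (b + s * x : measurableTypeR R)).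
Proof. by apply: measurable_funD => //; apply: measurable_funM. Qed.

(** The pushforward scaled by [s] gives half-open intervals their length, which characterises
    Lebesgue measure. *)
Lemma lebesgue_measure_affine (b s : R) (A : set R) : 0 < s -> measurable A ->
  (mu A = s%:E * mu ((fun x => b + s * x)%R @^-1` A))%E.
Proof.
move=> s0 mA.
pose f (x : measurableTypeR R) : measurableTypeR R := b + s * x.
have mf : measurable_fun setT f by exact: measurable_affine.
pose m := mscale (NngNum (ltW s0))
  (measure_function_pushforward__canonical__measure_function_Measure mu mf).
apply: (@lebesgue_measure_unique R m) => // _ [[u v]] _ <-.
transitivity (s%:E * mu (f @^-1` `]u, v]))%E; last by [].
have -> : f @^-1` `]u, v]%classic = `]((u - b) / s), ((v - b) / s)]%classic.
  apply/seteqP; split=> x /=; rewrite !in_itv/= /f ltr_pdivrMr// ler_pdivlMr//;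
  rewrite ltrBlDl lerBrDl mulrC//.
rewrite !lebesgue_measure_itv/= !lte_fin ltr_pM2r ?invr_gt0// ltrD2r.
case: ifPn => uv; last by rewrite mule0.
rewrite -!EFinD -EFinM; congr EFin; field; exact: lt0r_neq0.
Qed.

Lemma ge0_integral_affine (b s : R) (f : R -> \bar R) : 0 < s ->
  measurable_fun setT f -> (forall x, 0 <= f x)%E ->
  (\int[mu]_x f x = s%:E * \int[mu]_x f (b + s * x)%R)%E.
Proof.
move=> s0 mf f0.
pose g (x : measurableTypeR R) : measurableTypeR R := b + s * x.
have mg : measurable_fun setT g by exact: measurable_affine.
pose m := measure_function_pushforward__canonical__measure_function_Measure mu mg.
transitivity (\int[mscale (NngNum (ltW s0)) m]_x f x)%E.
  apply: eq_measure_integral => A mA _.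
  exact: (lebesgue_measure_affine b s0 mA).
rewrite ge0_integral_mscale//; congr (_ * _)%E.
by rewrite (ge0_integral_pushforward mg).
Qed.

End lebesgue_affine.

(** * Volume of the unit ball *)

Section ball_volume.
Context (R : realType).
Local Notation mu := (@lebesgue_measure R).

(* [ball_volume d t] is the volume of [|x|^2 < t] in dimension [d], slice by slice. *)
Fixpoint ball_volume (d : nat) (t : R) : \bar R :=
  if d is d'.+1 then (\int[mu]_x ball_volume d' (t - x ^+ 2)%R)%E
  else if 0 < t then 1%E else 0%E.

Lemma ball_volume_ge0 d t : (0 <= ball_volume d t)%E.
Proof.
elim: d t => [|d IHd] t /=; first by case: ifP.
by apply: integral_ge0 => x _; exact: IHd.
Qed.

Lemma measurable_ball_volume d : measurable_fun setT (ball_volume d).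
Proof.
elim: d => [|d IHd] /=.
  by apply: measurable_fun_ifT => //=; exact: measurable_fun_ltr.
have mF : measurable_fun setT
    (fun z : measurableTypeR R * measurableTypeR R =>
       ball_volume d (z.1 - z.2 ^+ 2)).
  apply: (measurableT_comp IHd); apply: measurable_funB => //.
  exact: measurable_funX.
exact: (measurable_fun_fubini_tonelli_F (m2 := mu) _ mF
          (fun z => ball_volume_ge0 d _)).
Qed.

Lemma measurable_ball_volumeB d t :
  measurable_fun setT (fun x : R => ball_volume d (t - x ^+ 2)).
Proof.
apply: (measurableT_comp (measurable_ball_volume d)).
by apply: measurable_funB => //; exact: measurable_funX.
Qed.

Lemma le_ball_volume d t u : t <= u -> (ball_volume d t <= ball_volume d u)%E.
Proof.
elim: d t u => [|d IHd] t u tu /=.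
  by case: ifPn => [t0|_]; [rewrite (lt_le_trans t0 tu)|case: ifP].
apply: ge0_le_integral => //.
- by move=> x _; exact: ball_volume_ge0.
- exact: measurable_ball_volumeB.
- exact: measurable_ball_volumeB.
- by move=> x _; apply: IHd; rewrite lerD2r.
Qed.

Lemma ball_volume_le0 d t : t <= 0 -> ball_volume d t = 0%E.
Proof.
elim: d t => [|d IHd] t t0 /=; first by rewrite ltNge t0.
rewrite (eq_integral (cst 0%E)) ?integral0// => x _.
by apply: IHd; rewrite subr_le0 (le_trans t0)// sqr_ge0.
Qed.

(** [t] is a squared radius: dilating lengths by [s] multiplies it by [s ^+ 2], and each of the [d]
    slicing integrals contributes one factor [s]. *)
Lemma ball_volume_scale d s t : 0 < s ->
  (ball_volume d (s ^+ 2 * t) = (s ^+ d)%:E * ball_volume d t)%E.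
Proof.
move=> s0; elim: d t => [|d IHd] t /=.
  by rewrite expr0 mul1e pmulr_rgt0// exprn_gt0.
rewrite (ge0_integral_affine 0 s0) //; last 2 first.
- exact: measurable_ball_volumeB.
- by move=> x; exact: ball_volume_ge0.
rewrite [s ^+ d.+1]exprS EFinM -muleA; congr (_ * _)%E.
rewrite -ge0_integralZl//; last 3 first.
- exact: measurable_ball_volumeB.
- by move=> x _; exact: ball_volume_ge0.
- by rewrite lee_fin exprn_ge0// ltW.
apply: eq_integral => x _; rewrite -IHd; congr (ball_volume d _).
by rewrite add0r exprMn mulrBr.
Qed.

Lemma ball_volume1_lty d : (ball_volume d 1 < +oo)%E.
Proof.
elim: d => [|d IHd] /=; first by rewrite ltr01 ltry.
(* Slices outside [[-1, 1]] are empty, and those inside are at most the unit ball one dimension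
   lower. *)
have -> : (\int[mu]_x ball_volume d (1 - x ^+ 2)%R =
    \int[mu]_(x in `[(-1)%R, 1%R]) ball_volume d (1 - x ^+ 2)%R)%E.
  rewrite [RHS]integral_mkcond; apply: eq_integral => x _.
  rewrite patchE; case: ifPn => //; rewrite notin_setE /= in_itv/= => xN.
  apply: ball_volume_le0; rewrite subr_le0 leNgt; apply/negP => x1; apply: xN.
  by rewrite -ler_norml -(@ler_pXn2r _ 2)// ?nnegrE// real_normK ?num_real// expr1n ltW.
apply: (@le_lt_trans _ _ (\int[mu]_(x in `[(-1)%R, 1%R]) (cst (ball_volume d 1)) x)%E).
  apply: ge0_le_integral => //.
  - by move=> x _; exact: ball_volume_ge0.
  - by apply: measurable_funTS; exact: measurable_ball_volumeB.
  - by move=> x _; apply: le_ball_volume; rewrite lerBlDl lerDr sqr_ge0.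
rewrite integral_cst//= lebesgue_measure_itv/= lte_fin ifT; last by lra.
rewrite -EFinD lte_mul_pinfty ?ge0_fin_numE ?ball_volume_ge0 ?ltry//.
Qed.

Lemma integral0y_expRN : (\int[mu]_(t in `]0%R, +oo[) (expR (- t))%:E = 1)%E.
Proof.
rewrite integral_itv_obnd_cbnd; last first.
  by apply/measurable_EFinP; apply: measurable_funTS; exact: measurableT_comp.
rewrite -(integral_exponential_pdf (@ltr01 R)) integral_mkcond.
apply: eq_integral => t _; rewrite /exponential_pdf !patchE.
by case: ifPn => //; rewrite mul1r mulN1r.
Qed.

(* By scaling, the left side is also [Gamma (d / 2 + 1)] times the volume of the
   unit ball. *)
Lemma integral_ball_volume_expR d :
  (\int[mu]_t (ball_volume d t * (expR (- t))%:E) = (Num.sqrt pi ^+ d)%:E)%E.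
Proof.
elim: d => [|d IHd].
  rewrite expr0 -integral0y_expRN [RHS]integral_mkcond; apply: eq_integral => t _.
  rewrite patchE /= mem_setE in_itv/= andbT; case: ifPn => _; first by rewrite mul1e.
  by rewrite mul0e.
have mexp : measurable_fun setT (fun t : R => (expR (- t))%:E).
  by apply/measurable_EFinP; exact: measurableT_comp.
pose F (z : measurableTypeR R * measurableTypeR R) :=
  (ball_volume d (z.1 - z.2 ^+ 2)%R * (expR (- z.1))%:E)%E.
have mF : measurable_fun setT F.
  apply: emeasurable_funM.
    apply: (measurableT_comp (measurable_ball_volume d)); apply: measurable_funB => //.
    exact: measurable_funX.
  exact: (measurableT_comp mexp).
have F0 z : (0 <= F z)%E.
  by apply: mule_ge0; rewrite ?lee_fin ?expR_ge0 ?ball_volume_ge0.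
transitivity (\int[mu]_t \int[mu]_x F (t, x))%E.
  apply: eq_integral => t _; rewrite /F /= muleC -ge0_integralZl//.
  - by apply: eq_integral => x _; rewrite muleC.
  - exact: measurable_ball_volumeB.
  - by move=> x _; exact: ball_volume_ge0.
rewrite (fubini_tonelli F mF F0).
transitivity (\int[mu]_x ((Num.sqrt pi ^+ d)%:E * (gauss_fun x)%:E))%E.
  apply: eq_integral => x _.
  (* Shifting [t] by [x ^+ 2] splits [expR (- t)] into the weight of dimension [d] and a Gaussian in
     [x], whose integral is [Num.sqrt pi]. *)
  rewrite (ge0_integral_affine (x ^+ 2) ltr01) ?mul1e; last 2 first.
  - exact: (measurableT_comp mF (measurable_pair2 _)).
  - by move=> t; exact: F0.
  rewrite -IHd muleC -ge0_integralZl//.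
  - apply: eq_integral => t _; rewrite /F /= mul1r addrAC subrr add0r /gauss_fun.
    by rewrite opprD expRD EFinM muleCA.
  - exact: emeasurable_funM (measurable_ball_volume d) _.
  - by move=> t _; apply: mule_ge0; rewrite ?lee_fin ?expR_ge0 ?ball_volume_ge0.
  - by rewrite lee_fin gauss_fun_ge0.
rewrite ge0_integralZl//.
- by rewrite integralT_gauss -EFinM exprSr.
- by apply/measurable_EFinP; exact: measurable_gauss_fun.
- by move=> x _; rewrite lee_fin gauss_fun_ge0.
Qed.

Lemma ball_volume_sqr d r : 0 < r ->
  ball_volume d (r ^+ 2) = ((r ^+ d)%:E * ball_volume d 1)%E.
Proof. by move=> r0; rewrite -ball_volume_scale// mulr1. Qed.

(** One integral is evaluated twice: as [Num.sqrt pi ^+ d], and, after scaling every ball to radius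
    1, as the volume times a Gamma integral. *)
Lemma ball_volume1 d : ball_volume d 1 = (unit_ball_volume R d)%:E.
Proof.
have := integral_ball_volume_expR d.
pose G := (\int[mu]_(t in `]0%R, +oo[)
            (t `^ (d%:R / 2 + 1 - 1) * expR (- t))%:E)%E.
have G0 : (0 <= G)%E.
  by apply: integral_ge0 => t _; rewrite lee_fin mulr_ge0 ?powR_ge0 ?expR_ge0.
have -> : (\int[mu]_t (ball_volume d t * (expR (- t))%:E) =
    ball_volume d 1 * G)%E.
  rewrite -ge0_integralZl//; last 3 first.
  - apply/measurable_EFinP; apply: measurable_funM.
      by apply: measurable_funTS; exact: measurable_powR.
    by apply: measurable_funTS; exact: measurableT_comp.
  - by move=> t _; rewrite lee_fin mulr_ge0 ?powR_ge0 ?expR_ge0.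
  - exact: ball_volume_ge0.
  rewrite [RHS]integral_mkcond; apply: eq_integral => t _.
  rewrite patchE mem_setE in_itv/= andbT; case: ltP => t0; last first.
    by rewrite ball_volume_le0// mul0e.
  rewrite -{1}(sqr_sqrtr (ltW t0)) ball_volume_sqr ?sqrtr_gt0//.
  rewrite addrK -powR12_sqrt ?(ltW t0)// -powR_mulrn ?powR_ge0// -powRrM.
  by rewrite [2^-1 * _]mulrC EFinM [in LHS]muleAC muleC muleA.
have := ball_volume1_lty d; have := ball_volume_ge0 d 1.
case: (ball_volume d 1) => [v| |]// v0 _.
have spi : 0 < Num.sqrt pi ^+ d :> R by rewrite exprn_gt0// sqrtr_gt0 pi_gt0.
have E : Gamma (d%:R / 2 + 1) = fine G by [].
(* [Gamma] is the [fine] of [G], so [G] must be shown finite: an infinite [G] would make the product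
   0 or infinite, while it equals the positive real [Num.sqrt pi ^+ d]. *)
move: G0 E; case: G => [g| |] //= g0 E; last first.
  move: v0; rewrite lee_fin le_eqVlt => /orP[/eqP <-|v0].
    by rewrite mul0e => -[] /eqP; rewrite eq_sym gt_eqF.
  by rewrite gt0_muley.
move=> -[] vg; congr EFin.
rewrite /unit_ball_volume E mulrC powRrM powRAC powR12_sqrt ?pi_ge0//.
rewrite powR_mulrn ?sqrtr_ge0// -vg mulrC mulfK//; apply/eqP => g00.
by move: spi; rewrite -vg g00 mulr0 ltxx.
Qed.

End ball_volume.

(** * Overlap as a distance condition *)

Section overlap_distance.
Context (R : realType) (d : nat).
Implicit Types c : 'rV[R]_d.

Lemma sqr_enorm (x : 'rV[R]_d) : enorm x ^+ 2 = \sum_(i < d) x ord0 i ^+ 2.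
Proof. by rewrite sqr_sqrtr// sumr_ge0// => i _; exact: sqr_ge0. Qed.

Lemma enorm_ge0 (x : 'rV[R]_d) : 0 <= enorm x. Proof. exact: sqrtr_ge0. Qed.

Lemma enormN (x : 'rV[R]_d) : enorm (- x) = enorm x.
Proof. by congr Num.sqrt; apply: eq_bigr => i _; rewrite mxE sqrrN. Qed.

Lemma enormZ (a : R) (x : 'rV[R]_d) : enorm (a *: x) = `|a| * enorm x.
Proof.
rewrite /enorm -sqrtr_sqr -sqrtrM ?sqr_ge0//.
by congr Num.sqrt; rewrite mulr_sumr; apply: eq_bigr => i _; rewrite mxE exprMn.
Qed.

(** Cauchy-Schwarz, by summing AM-GM with weights [B / A] and [A / B] for which both halves add up
    to [A * B / 2]. Vanishing norms are treated apart because the weights divide by them. *)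
Lemma enorm_dot (x y : 'rV[R]_d) : \sum_(i < d) x ord0 i * y ord0 i <= enorm x * enorm y.
Proof.
have := enorm_ge0 x; rewrite le_eqVlt => /orP[/eqP x0|x0].
  have /eqP := sqr_enorm x; rewrite -x0 expr0n /= eq_sym psumr_eq0; last first.
    by move=> i _; exact: sqr_ge0.
  move=> /allP xE; rewrite mul0r big1// => i _.
  by have := xE i (mem_index_enum _); rewrite sqrf_eq0 => /eqP ->; rewrite mul0r.
have := enorm_ge0 y; rewrite le_eqVlt => /orP[/eqP y0|y0].
  have /eqP := sqr_enorm y; rewrite -y0 expr0n /= eq_sym psumr_eq0; last first.
    by move=> i _; exact: sqr_ge0.
  move=> /allP yE; rewrite mulr0 big1// => i _.
  by have := yE i (mem_index_enum _); rewrite sqrf_eq0 => /eqP ->; rewrite mulr0.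
set A := enorm x in x0 *; set B := enorm y in y0 *.
have H i : x ord0 i * y ord0 i <=
    (B / A / 2) * x ord0 i ^+ 2 + (A / B / 2) * y ord0 i ^+ 2.
  rewrite -subr_ge0 (_ : _ - _ = (B * x ord0 i - A * y ord0 i) ^+ 2 / (2 * A * B)).
    by rewrite divr_ge0 ?sqr_ge0// !mulr_ge0// ltW.
  by field; rewrite !lt0r_neq0.
apply: le_trans (ler_sum _ (fun i _ => H i)) _.
rewrite big_split /= -!mulr_sumr -!sqr_enorm -/A -/B.
rewrite le_eqVlt; apply/orP; left; apply/eqP; field; rewrite !lt0r_neq0//.
Qed.

Lemma ler_enormD (x y : 'rV[R]_d) : enorm (x + y) <= enorm x + enorm y.
Proof.
rewrite -(@ler_pXn2r _ 2)// ?nnegrE ?addr_ge0 ?enorm_ge0//.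
rewrite sqrrD !sqr_enorm.
under eq_bigr do rewrite mxE sqrrD.
rewrite big_split; apply: lerD => //; rewrite big_split; apply: lerD => //.
by rewrite sumrMnl; rewrite lerMn2r /=; exact: enorm_dot.
Qed.

Lemma overlap_EuclideanP c c' (r r' : R) : 0 < r -> 0 < r' ->
  overlap Euclidean (c, r) (c', r') <-> enorm (c - c') < r + r'.
Proof.
move=> r0 r'0; split=> [[y [/= yc yc']]|h].
  rewrite (_ : c - c' = - (y - c) + (y - c')); last first.
    by rewrite opprB addrA subrK.
  by rewrite (le_lt_trans (ler_enormD _ _))// enormN ltrD.
have rr : 0 < r + r' by rewrite addr_gt0.
(* The common point divides the segment between the centres in the ratio of the radii. *)
exists (c - (r / (r + r')) *: (c - c')); split=> /=.
  rewrite addrAC subrr add0r enormN enormZ ger0_norm ?divr_ge0 ?ltW//.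
  by rewrite mulrAC ltr_pdivrMr// ltr_pM2l.
rewrite (_ : _ - c' = (r' / (r + r')) *: (c - c')).
  rewrite enormZ ger0_norm ?divr_ge0 ?ltW//.
  by rewrite mulrAC ltr_pdivrMr// ltr_pM2l.
rewrite addrAC -{1}[c - c']scale1r -scalerBl; congr (_ *: _).
by field; exact: lt0r_neq0.
Qed.

Lemma overlap_TorusP c c' (r r' : R) : 0 < r -> 0 < r' ->
  overlap Torus (c, r) (c', r') <->
  exists k : 'rV[int]_d, enorm (c - c' - map_mx intr k) < r + r'.
Proof.
move=> r0 r'0; split=> [[y [/= [k yc] [k' yc']]]|[k h]].
  exists (k' - k); rewrite raddfB/=.
  set a := map_mx _ k; set a' := map_mx _ k'.
  have -> : c - c' - (a' - a) = (c + a) - (c' + a').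
    by apply/rowP => i; rewrite !mxE; ring.
  apply/(overlap_EuclideanP _ _ r0 r'0); exists y; split=> /=; rewrite opprD addrA//.
have : enorm ((c - map_mx intr k) - c') < r + r' by rewrite addrAC.
move=> /(overlap_EuclideanP _ _ r0 r'0)[y /= [yc yc']]; exists y; split=> /=.
  by exists (- k); rewrite raddfN/= -addrA -opprD.
exists 0; rewrite raddf0 subr0//.
Qed.

(** For [|x| <= 1] this is the squared distance from [x] to the nearest integer. The axes can be
    minimised one by one since a lattice vector shifts them independently. *)
Definition axis_sqr (b : boundary) (x : R) : R :=
  if b is Torus then Num.min (x ^+ 2) (Num.min ((x - 1) ^+ 2) ((x + 1) ^+ 2))
  else x ^+ 2.

Lemma axis_sqr_ge0 b x : 0 <= axis_sqr b x.
Proof. by case: b => /=; rewrite ?le_min !sqr_ge0. Qed.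

Lemma axis_sqr_le b x : axis_sqr b x <= x ^+ 2.
Proof. by case: b => //=; rewrite ge_min lexx. Qed.

Lemma axis_sqr_int x (k : int) : `|x| <= 1 ->
  axis_sqr Torus x <= (x - k%:~R) ^+ 2.
Proof.
move=> x1 /=; have /= xx := axis_sqr_le Torus x.
(* A shift by at least 2 never beats no shift, so only -1, 0 and 1 compete. *)
have far (t : R) : 2 <= `|t| -> x ^+ 2 <= (x - t) ^+ 2.
  move=> t2; rewrite -[leLHS]real_normK ?num_real// -[leRHS]real_normK ?num_real//.
  rewrite ler_sqr ?nnegrE ?normr_ge0// (le_trans x1)//.
  have := lerB_dist t x; rewrite distrC; lra.
have [k2|] := lerP 2 `|k%:~R : R|; first exact: le_trans xx (far _ k2).
rewrite ltr_norml => /andP[k2 k2'].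
have : k \in [:: -1; 0; 1].
  rewrite !inE; move: k2 k2'; rewrite -[2]/(2%:~R : R) -mulrNz !ltr_int; clear; lia.
rewrite !inE !ge_min => /or3P[] /eqP ->.
- by rewrite mulrN1z opprK lexx !orbT.
- by rewrite subr0 lexx.
- by rewrite lexx orbT.
Qed.

Lemma axis_sqr_witness x : exists k : int, axis_sqr Torus x = (x - k%:~R) ^+ 2.
Proof.
rewrite /= /Num.min; case: ifP => _; first by exists 0; rewrite subr0.
case: ifP => _; first by exists 1.
by exists (-1); rewrite mulrN1z opprK.
Qed.

Lemma overlapP b c c' (r r' : R) : 0 < r -> 0 < r' ->
    (forall i, `|c ord0 i - c' ord0 i| <= 1) ->
  overlap b (c, r) (c', r') <->
  Num.sqrt (\sum_(i < d) axis_sqr b (c ord0 i - c' ord0 i)) < r + r'.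
Proof.
move=> r0 r'0 cc; case: b; last first.
  rewrite overlap_EuclideanP// /enorm /=.
  by under eq_bigr do rewrite !mxE.
rewrite overlap_TorusP//; split.
  move=> [k]; apply: le_lt_trans; apply: ler_wsqrtr; apply: ler_sum => i _.
  by rewrite !mxE; exact: axis_sqr_int.
have /choice [k kE] := fun i => axis_sqr_witness (c ord0 i - c' ord0 i).
move=> h; exists (\row_i k i); move: h; apply: le_lt_trans.
apply: ler_wsqrtr; apply: ler_sum => i _.
by rewrite !mxE kE.
Qed.

End overlap_distance.

(** * Real-valued probabilities and independent events *)

Section probability_of_event.
Context d (T : measurableType d) (R : realType) (P : probability T R).

Definition pr (B : set T) : R := fine (P B).

Lemma prE B : measurable B -> P B = (pr B)%:E.
Proof. by move=> mB; rewrite fineK// fin_num_measure. Qed.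

Lemma pr_ge0 B : 0 <= pr B. Proof. exact: fine_ge0. Qed.

Lemma pr_le1 B : measurable B -> pr B <= 1.
Proof. by move=> mB; rewrite -lee_fin -prE// probability_le1. Qed.

Lemma le_pr B B' : measurable B -> measurable B' -> B `<=` B' -> pr B <= pr B'.
Proof. by move=> mB mB' BB; rewrite -lee_fin -!prE// le_measure// inE. Qed.

Lemma prT : pr setT = 1.
Proof. by rewrite /pr probability_setT. Qed.

Lemma prC B : measurable B -> pr (~` B) = 1 - pr B.
Proof. by move=> mB; rewrite /pr probability_setC// prE. Qed.

Lemma pr_setU_le B B' : measurable B -> measurable B' ->
  pr (B `|` B') <= pr B + pr B'.
Proof.
move=> mB mB'; rewrite -lee_fin EFinD -!prE//; last exact: measurableU.
exact: measureU2.
Qed.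

Lemma pr_bigsetU_le (I : Type) (s : seq I) (F : I -> set T) :
  (forall i, measurable (F i)) ->
  pr (\big[setU/set0]_(i <- s) F i) <= \sum_(i <- s) pr (F i).
Proof.
move=> mF; elim: s => [|i s IHs]; first by rewrite !big_nil /pr measure0.
rewrite !big_cons (le_trans (pr_setU_le _ _))//; first exact: bigsetU_measurable.
by rewrite lerD2l.
Qed.

Lemma pr_setDI B B' : measurable B -> measurable B' ->
  pr B = pr (B `\` B') + pr (B `&` B').
Proof.
move=> mB mB'; apply/EFin_inj; rewrite EFinD -!prE//.
- exact: measureDI.
- exact: measurableI.
- exact: measurableD.
Qed.

Lemma eq_pr_ae B B' N : measurable B -> measurable B' -> measurable N ->
  pr N = 0 -> (forall w, ~ N w -> B w <-> B' w) -> pr B = pr B'.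
Proof.
move=> mB mB' mN N0 BB.
have half C C' : measurable C -> measurable C' ->
    (forall w, ~ N w -> C w <-> C' w) -> pr C <= pr C'.
  move=> mC mC' CC.
  rewrite -[leRHS]addr0 -N0 (le_trans _ (pr_setU_le _ _))// le_pr//.
    exact: measurableU.
  move=> w Cw; have [Nw|Nw] := pselect (N w); first by right.
  by left; apply/CC.
apply/eqP; rewrite eq_le !half// => w Nw; apply: iff_sym; exact: BB.
Qed.

End probability_of_event.

Section independent_events.
Context (R : realType) (I : choiceType) (mu : I -> set R -> \bar R).
Context (Q : probability (config R I) R).
Hypothesis Qmu : product_law mu Q.

Lemma pr_mix (J : pred I) B : measurable B ->
  (pr Q B)%:E = (\int[Q]_w Q [set w' | B (mix J w w')])%E.
Proof.
move=> mB; rewrite -prE// -[in LHS](setIT B) -integral_indic//.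
rewrite [LHS](integral_mix Qmu J)//; last first.
  by apply/measurable_EFinP; exact: measurable_indic.
apply: eq_integral => w _.
rewrite -[in RHS](setIT [set w' | _]) -integral_indic//.
rewrite -[X in measurable X]setTI; exact: measurable_mixr.
Qed.

Lemma measurable_set_mix (J : pred I) w B : measurable B ->
  measurable [set w' : config R I | B (mix J w w')].
Proof.
by move=> mB; rewrite -[X in measurable X]setTI; exact: measurable_mixr.
Qed.

Lemma measurable_pr_mix (J : pred I) B : measurable B ->
  measurable_fun setT (fun w => Q [set w' | B (mix J w w')]).
Proof.
move=> mB.
have mf : measurable_fun setT (fun z : config R I * config R I =>
    (\1_B (mix J z.1 z.2) : R)%:E).
  apply/measurable_EFinP; apply: (measurableT_comp (measurable_indic mB)).
  exact: measurable_mix.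
have H := measurable_fun_fubini_tonelli_F (m2 := Q) _ mf (fun z => _).
apply: eq_measurable_fun (H _).
- move=> w _; rewrite /fubini_F /= -[in RHS](setIT [set w' | _]) -integral_indic//.
  exact: measurable_set_mix.
- by move=> z; rewrite lee_fin.
Qed.

(** Invariance under [mix] expresses which coordinates an event depends on: [B] on those in [J],
    [B'] on the others. *)
Lemma pr_indep (J : pred I) B B' : measurable B -> measurable B' ->
  (forall w w', B (mix J w w') <-> B w) ->
  (forall w w', B' (mix J w w') <-> B' w') ->
  pr Q (B `&` B') = pr Q B * pr Q B'.
Proof.
move=> mB mB' BJ B'J; apply/EFin_inj; rewrite (pr_mix J); last exact: measurableI.
transitivity (\int[Q]_w ((pr Q B')%:E * (\1_B w)%:E))%E.
  apply: eq_integral => w _; rewrite indicE.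
  have [Bw|Bw] := pselect (B w).
    rewrite mem_set// mule1 -prE//; congr (Q _); apply/seteqP; split=> w' /=.
      by move=> [_ /B'J].
    by move=> /B'J B'w; split=> //; apply/BJ.
  rewrite memNset// mule0 -[RHS](measure0 Q); congr (Q _).
  by apply/seteqP; split=> w' //= [/BJ].
rewrite ge0_integralZl//; last 2 first.
- by apply/measurable_EFinP; exact: measurable_indic.
- by rewrite lee_fin pr_ge0.
rewrite mulrC EFinM integral_indic// setIT; congr (_ * _)%E; exact: prE.
Qed.

Lemma pr_reindex (p g : I -> I) B : cancel p g -> (forall i, mu (p i) = mu i) ->
  measurable B ->
  pr Q [set w | B ((fun i => w (p i)) : config R I)] = pr Q B.
Proof. by move=> pK mup mB; rewrite /pr; congr fine; exact: (law_reindex Qmu pK mup mB). Qed.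

End independent_events.

Lemma measurable_set_ltr d (T : measurableType d) (R : realType) (f g : T -> R) :
  measurable_fun setT f -> measurable_fun setT g ->
  measurable [set t | f t < g t].
Proof.
move=> mf mg.
rewrite (_ : [set t | f t < g t] = setT `&` (fun t => f t < g t) @^-1` [set true]).
  exact: measurable_fun_ltr.
by rewrite setTI.
Qed.

Lemma measurable_axis_sqr (R : realType) b :
  measurable_fun setT (@axis_sqr R b).
Proof.
by case: b => /=; repeat apply: measurable_minr; apply: measurable_funX => //;
  apply: measurable_funD.
Qed.

Lemma axis_sqrN (R : realType) b (x : R) : axis_sqr b (- x) = axis_sqr b x.
Proof.
case: b => /=; rewrite ?sqrrN//; congr Num.min; rewrite minC.
by congr Num.min; rewrite -sqrrN; congr (_ ^+ 2); ring.
Qed.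

(** * Packings: spheres of a region without mutual overlap *)

Section packings.
Context (R : realType) (d : nat).
Local Notation idx := (nat * option 'I_d)%type.
Local Notation spheres := (config R (nat * option 'I_d)%type).
Local Notation marked_point := (config R (option 'I_d)).
Implicit Types (b : boundary) (r : R) (A : set marked_point) (t : seq nat).

(* Key [(n, Some i)] is the [i]-th coordinate of the centre of sphere [n], and
   [(n, None)] its radius before scaling. *)
Definition sphere_at (w : spheres) (n : nat) : marked_point := fun o => w (n, o).

Lemma measurable_sphere_at n : measurable_fun setT (sphere_at ^~ n).
Proof. by apply: measurable_config => o; exact: measurable_coord. Qed.

Definition gap b (x y : marked_point) : R :=
  Num.sqrt (\sum_(i < d) axis_sqr b (x (Some i) - y (Some i))).

(** Marks hold unscaled radii and [r] is the common scale. On the unit cube and for positive radii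
    this is the distance criterion of [overlapP]. *)
Definition spheres_meet b r (x y : marked_point) : bool :=
  gap b x y < r * (x None + y None).

Lemma spheres_meetC b r x y : spheres_meet b r x y = spheres_meet b r y x.
Proof.
rewrite /spheres_meet /gap addrC; congr (Num.sqrt _ < _); apply: eq_bigr => i _.
by rewrite -axis_sqrN opprB.
Qed.

Lemma measurable_gap d' (T : measurableType d') b (f g : T -> marked_point) :
  measurable_fun setT f -> measurable_fun setT g ->
  measurable_fun setT (fun z => gap b (f z) (g z)).
Proof.
move=> mf mg; apply: (measurableT_comp (continuous_measurable_fun (@sqrt_continuous R))).
apply: measurable_sum => i.
apply: (measurableT_comp (measurable_axis_sqr b)).
by apply: measurable_funB; apply: (measurableT_comp (measurable_coord (Some i))).
Qed.

Lemma measurable_spheres_meet d' (T : measurableType d') b r (f g : T -> marked_point) :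
  measurable_fun setT f -> measurable_fun setT g ->
  measurable [set z | spheres_meet b r (f z) (g z)].
Proof.
move=> mf mg; apply: measurable_set_ltr; first exact: measurable_gap.
apply: measurable_funM => //.
by apply: measurable_funD; apply: (measurableT_comp (measurable_coord None)).
Qed.

(** [A] restricts centre and radius together, so that cells of the cube, sets of large spheres and
    their intersections are all admissible regions. *)
Definition packing b r A t : set spheres :=
  [set w | (forall i, i \in t -> A (sphere_at w i)) /\
    forall i j, i \in t -> j \in t -> i != j -> ~~ spheres_meet b r (sphere_at w i) (sphere_at w
      j)].

Lemma measurable_packing b r A t : measurable A -> measurable (packing b r A t).
Proof.
move=> mA.
rewrite (_ : packing b r A t = \bigcap_(i in [set` t]) ((sphere_at ^~ i) @^-1` A) `&`
  \bigcap_(i in [set` t]) \bigcap_(j in [set` t])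
     (if i != j then ~` [set w | spheres_meet b r (sphere_at w i) (sphere_at w j)] else setT)).
  apply: measurableI; apply: fin_bigcap_measurable => // i _.
    by rewrite -[X in measurable X]setTI; exact: measurable_sphere_at.
  apply: fin_bigcap_measurable => // j _; case: ifP => // _; apply: measurableC.
  by apply: measurable_spheres_meet; exact: measurable_sphere_at.
apply/seteqP; split=> w /=.
  move=> [h1 h2]; split=> // i it j jt; case: ifPn => // ij.
  by apply/negP; exact: h2.
by move=> [h1 h2]; split=> // i j it jt ij; have := h2 i it j jt; rewrite ij => /negP.
Qed.

Context (mu : option 'I_d -> set R -> \bar R) (Q : probability spheres R).
Hypothesis Qmu : product_law (fun k => mu k.2) Q.

Definition pack b r A n : R := pr Q (packing b r A (iota 0 n)).

Lemma pack_ge0 b r A n : 0 <= pack b r A n. Proof. exact: pr_ge0. Qed.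

(** The spheres are exchangeable, so only the number of labels matters. *)
Lemma pr_packing b r A t : measurable A -> uniq t ->
  pr Q (packing b r A t) = pack b r A (size t).
Proof.
move=> mA ut.
(* [p] lists the labels of [t] and then jumps beyond [sumn t], which bounds all of them; this makes
   it injective with left inverse [g]. *)
pose p k := if (k < size t)%N then nth 0%N t k else (k + (sumn t).+1)%N.
pose g m := if m \in t then index m t else (m - (sumn t).+1)%N.
have le_sumn m : m \in t -> (m <= sumn t)%N.
  elim: (t) => // x s IHs; rewrite inE => /orP[/eqP ->|/IHs ms] /=.
    exact: leq_addr.
  exact: leq_trans ms (leq_addl _ _).
have pK : cancel p g.
  move=> k; rewrite /p /g; case: ltnP => kt; first by rewrite mem_nth// index_uniq.
  by rewrite ifF ?addnK//; apply/negbTE/negP => /le_sumn; lia.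
pose p' (k : idx) : idx := (p k.1, k.2).
pose g' (k : idx) : idx := (g k.1, k.2).
have pK' : cancel p' g' by case=> k o; rewrite /p' /g' /= pK.
rewrite /pack -[RHS](pr_reindex Qmu pK')//; last exact: measurable_packing.
have pE w n : sphere_at (fun k => w (p' k)) n = sphere_at w (p n) by [].
congr (pr Q _); apply/seteqP; split=> w /= [h1 h2]; split.
- by move=> i; rewrite mem_iota add0n pE /p => /andP[_ it]; rewrite it; apply/h1/mem_nth.
- move=> i j; rewrite !mem_iota !add0n !pE /p => /andP[_ it] /andP[_ jt] ij.
  by rewrite it jt h2 ?mem_nth// nth_uniq.
- move=> i it; have := h1 (index i t); rewrite mem_iota add0n index_mem it pE /p.
  by rewrite index_mem it nth_index//; apply.
- move=> i j it jt ij; have := h2 (index i t) (index j t).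
  rewrite !mem_iota !add0n !index_mem it jt !pE /p !index_mem it jt !nth_index//.
  apply=> //; apply: contra ij => /eqP e.
  by rewrite -(nth_index 0%N it) e nth_index.
Qed.

Lemma packing_mix b r A t (J : pred nat) (w w' : spheres) :
  (forall i, i \in t -> J i) ->
  packing b r A t (mix (fun k => J k.1) w w') <-> packing b r A t w.
Proof.
move=> tJ.
have E i : i \in t -> sphere_at (mix (fun k => J k.1) w w') i = sphere_at w i.
  by move=> it; apply/funext => o; rewrite /sphere_at /mix /= tJ.
split=> -[h1 h2]; split.
- by move=> i it; rewrite -E//; exact: h1.
- by move=> i j it jt ij; rewrite -!E//; exact: h2.
- by move=> i it; rewrite E//; exact: h1.
- by move=> i j it jt ij; rewrite !E//; exact: h2.
Qed.

Lemma packing_mixr b r A t (J : pred nat) (w w' : spheres) :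
  (forall i, i \in t -> ~~ J i) ->
  packing b r A t (mix (fun k => J k.1) w w') <-> packing b r A t w'.
Proof.
move=> tJ; rewrite -(@packing_mix b r A t (predC J) w' w)//.
by rewrite (_ : mix _ _ _ = mix (fun k => predC J k.1) w' w)//;
  apply/funext => k; rewrite /mix /=; case: (J k.1).
Qed.

(* [A] and [A'] need not be disjoint: sum over the set of spheres lying in [A]. *)
Lemma pack_setU b r A A' n : measurable A -> measurable A' ->
  pack b r (A `|` A') n <=
  \sum_(j < n.+1) 'C(n, j)%:R * pack b r A j * pack b r A' (n - j).
Proof.
move=> mA mA'.
pose ts (S : {set 'I_n}) := [seq val i | i <- enum S].
have uts S : uniq (ts S) by rewrite map_inj_uniq ?enum_uniq//; exact: val_inj.
have sts S : size (ts S) = #|S| by rewrite size_map -cardE.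
have mem_ts S (i : 'I_n) : (val i \in ts S) = (i \in S).
  by rewrite mem_map ?mem_enum//; exact: val_inj.
have Pts S k : k \in ts S -> exists2 i : 'I_n, k = val i & i \in S.
  by move=> /mapP[i]; rewrite mem_enum => iS ->; exists i.
pose F S := packing b r A (ts S) `&` packing b r A' (ts (~: S)).
have mF S : measurable (F S) by apply: measurableI; exact: measurable_packing.
have sub : packing b r (A `|` A') (iota 0 n) `<=`
    \big[setU/set0]_(S <- index_enum {set 'I_n}) F S.
  move=> w [h1 h2]; rewrite -bigcup_seq.
  exists [set i : 'I_n | `[< A (sphere_at w i) >]]%SET; first by rewrite /= mem_index_enum.
  have io (i : 'I_n) : val i \in iota 0 n by rewrite mem_iota add0n ltn_ord.
  split; split.
  - by move=> _ /Pts[i -> ]; rewrite inE => /asboolP.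
  - by move=> _ _ /Pts[i -> _] /Pts[j -> _]; exact: h2.
  - by move=> _ /Pts[i -> ]; rewrite !inE => /asboolP Ai; have [] := h1 i (io i).
  - by move=> _ _ /Pts[i -> _] /Pts[j -> _]; exact: h2.
apply: le_trans (le_pr Q _ _ sub) _.
- by apply: measurable_packing; exact: measurableU.
- by apply: bigsetU_measurable => S _; exact: mF.
apply: le_trans (pr_bigsetU_le _ _ mF) _.
have FE S : pr Q (F S) = pack b r A #|S| * pack b r A' (n - #|S|).
  rewrite (pr_indep Qmu (J := fun k => k.1 \in ts S)); try exact: measurable_packing.
  - rewrite !pr_packing// !sts; congr (_ * pack _ _ _ _).
    by rewrite [#|~: S|]cardsCs finset.setCK card_ord.
  - by move=> w w'; apply: (@packing_mix _ _ _ _ (mem (ts S))).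
  - move=> w w'; apply: (@packing_mixr _ _ _ _ (mem (ts S))) => k /Pts[i ->].
    by rewrite inE -mem_ts.
under eq_bigr do rewrite FE.
rewrite (partition_big (fun S : {set 'I_n} => inord #|S| : 'I_n.+1) xpredT)//=.
apply: ler_sum => j _.
rewrite (eq_bigr (fun _ => pack b r A j * pack b r A' (n - j))); last first.
  move=> S /eqP <-; rewrite inordK// ltnS.
  by rewrite -[leqRHS]card_ord max_card.
rewrite sumr_const -mulrA mulr_natl le_eqVlt; apply/orP; left; apply/eqP.
congr (_ *+ _); rewrite -[n in 'C(n, _)]card_ord -card_draws; apply: eq_card => S.
rewrite !inE; change ((inord #|S| : 'I_n.+1) == j :> nat = (#|S| == j)); rewrite inordK// ltnS.
by rewrite -[leqRHS]card_ord max_card.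
Qed.

End packings.

(** * Exponential generating functions *)

Section exponential_generating_function.
Context (R : realType).
Implicit Types (a b c : nat -> R) (x : R).

Definition egf_sum a x M : R := \sum_(n < M) x ^+ n / n`!%:R * a n.

(** For the nonnegative coefficients used later the supremum of the partial sums is the sum of the
    series. Upper bounds then reduce to finite sums. *)
Definition egf a x : R := sup [set egf_sum a x M | M in setT].

Lemma egf_coef_ge0 x n : 0 <= x -> 0 <= x ^+ n / n`!%:R :> R.
Proof. by move=> x0; rewrite divr_ge0 ?exprn_ge0. Qed.

Lemma egf_sum_le_expR a x M : 0 <= x -> (forall n, a n <= 1) ->
  egf_sum a x M <= expR x.
Proof.
move=> x0 a1; apply: (@le_trans _ _ (series (exp_coeff x) M)).
  rewrite /series /= big_mkord; apply: ler_sum => n _.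
  by rewrite /exp_coeff ler_piMr// egf_coef_ge0.
apply: (nondecreasing_cvgn_le _ (is_cvg_series_exp_coeff x)).
by apply: nondecreasing_series => n _ _; exact: egf_coef_ge0.
Qed.

Section bounded.
Context a x (x0 : 0 <= x) (a1 : forall n, a n <= 1).

Lemma egf_has_sup : has_sup [set egf_sum a x M | M in setT].
Proof.
split; first by exists (egf_sum a x 0), 0%N.
by exists (expR x) => _ [M _ <-]; exact: egf_sum_le_expR.
Qed.

Lemma egf_sum_le M : egf_sum a x M <= egf a x.
Proof. by apply: ub_le_sup; [exact: (proj2 egf_has_sup)|exists M]. Qed.

Lemma egf_le C : (forall M, egf_sum a x M <= C) -> egf a x <= C.
Proof.
move=> aC; apply: ge_sup; first exact: (proj1 egf_has_sup).
by move=> _ [M _ <-].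
Qed.

Lemma egf_le_expR : egf a x <= expR x.
Proof. by apply: egf_le => M; exact: egf_sum_le_expR. Qed.

End bounded.

Lemma egf_ge0 a x : 0 <= x -> (forall n, a n <= 1) -> 0 <= egf a x.
Proof.
by move=> x0 a1; have := egf_sum_le x0 a1 0; rewrite /egf_sum big_ord0.
Qed.

Lemma le_egf a b x : 0 <= x -> (forall n, a n <= b n) -> (forall n, b n <= 1) ->
  egf a x <= egf b x.
Proof.
move=> x0 ab b1; have a1 n : a n <= 1 by exact: le_trans (ab n) (b1 n).
apply: egf_le => // M; apply: le_trans (egf_sum_le x0 b1 M).
by apply: ler_sum => n _; rewrite ler_wpM2l// egf_coef_ge0.
Qed.

(** Thinning: a factor [s] for each sphere amounts to multiplying the Poisson parameter by [s]. *)
Lemma egf_scale a s x : egf (fun n => s ^+ n * a n) x = egf a (s * x).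
Proof.
rewrite /egf; congr (sup _); apply: eq_imagel => M _; rewrite /egf_sum.
by apply: eq_bigr => n _; rewrite exprMn; ring.
Qed.

(** The pairs with sum below [M] lie in the square of side [M], and the terms are nonnegative. *)
Lemma ler_sum_triangle (u : nat -> nat -> R) M : (forall i j, 0 <= u i j) ->
  \sum_(n < M) \sum_(j < n.+1) u j (n - j)%N <= \sum_(i < M) \sum_(j < M) u i j.
Proof.
move=> u0.
rewrite (eq_bigr (fun n : 'I_M => \sum_(j < M | (j <= n)%N) u j (n - j)%N)); last first.
  by move=> n _; rewrite (big_ord_widen_cond M xpredT (fun j => u j (n - j)%N)).
rewrite (exchange_big_dep xpredT)//=; apply: ler_sum => j _.
rewrite [leLHS](_ : _ = \sum_(k < M | (k < M - j)%N) u j k).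
  rewrite [leRHS](bigID (fun k : 'I_M => (k < M - j)%N))/= lerDl.
  by apply: sumr_ge0 => k _; exact: u0.
rewrite -(big_ord_widen M (fun k => u j k) (leq_subr j M)).
rewrite -(big_mkord (fun k => (j <= k)%N) (fun k => u j (k - j)%N)).
rewrite -(big_mkord xpredT (fun k => u j k)).
rewrite (@big_cat_nat _ _ _ j) //=; last exact: ltnW.
rewrite big_nat_cond big1 ?add0r; last by move=> k /andP[/andP[_ kj]]; rewrite leqNgt kj.
rewrite -{1}[val j]add0n big_addn big_nat_cond [RHS]big_nat_cond.
by apply: eq_big => k; rewrite ?addnK // leq_addl andbT.
Qed.

(** Binomial convolution of coefficients is multiplication of exponential generating functions. *)
Lemma egf_mul_le a b c x : 0 <= x ->
    (forall n, 0 <= a n <= 1) -> (forall n, 0 <= b n <= 1) ->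
    (forall n, c n <= 1) ->
    (forall n, c n <= \sum_(j < n.+1) 'C(n, j)%:R * a j * b (n - j)%N) ->
  egf c x <= egf a x * egf b x.
Proof.
move=> x0 a01 b01 c1 cab.
have [a0 a1] : (forall n, 0 <= a n) /\ (forall n, a n <= 1).
  by split=> n; have /andP[] := a01 n.
have [b0 b1] : (forall n, 0 <= b n) /\ (forall n, b n <= 1).
  by split=> n; have /andP[] := b01 n.
apply: egf_le => // M.
pose u n := x ^+ n / n`!%:R * a n; pose v n := x ^+ n / n`!%:R * b n.
have u0 n : 0 <= u n by rewrite mulr_ge0// egf_coef_ge0.
have v0 n : 0 <= v n by rewrite mulr_ge0// egf_coef_ge0.
apply: (@le_trans _ _ (egf_sum a x M * egf_sum b x M)); last first.
  by apply: ler_pM; rewrite ?egf_sum_le//; apply: sumr_ge0 => i _; [exact: u0|exact: v0].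
apply: (@le_trans _ _ (\sum_(n < M) \sum_(j < n.+1) u j * v (n - j)%N)).
  apply: ler_sum => n _.
  apply: (@le_trans _ _ (x ^+ n / n`!%:R *
      \sum_(j < n.+1) 'C(n, j)%:R * a j * b (n - j)%N)).
    by rewrite ler_wpM2l// egf_coef_ge0.
  rewrite mulr_sumr le_eqVlt; apply/orP; left; apply/eqP; apply: eq_bigr => j _.
  have jn : (j <= n)%N by rewrite -ltnS.
  rewrite /u /v -(@bin_fact n j)// !natrM -{1}(subnKC jn) exprD.
  by field; rewrite !pnatr_eq0 -!lt0n !fact_gt0 bin_gt0 jn.
apply: le_trans (ler_sum_triangle (u := fun j k => u j * v k) _ _) _.
  by move=> i j; exact: mulr_ge0.
rewrite /egf_sum mulr_suml; apply: ler_sum => i _; rewrite mulr_sumr.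
exact: lexx.
Qed.

End exponential_generating_function.

Section uniform_affine.
Context (R : realType).

Lemma uniform_prob01E (A : set R) : measurable A ->
  uniform_prob (@ltr01 R) A = lebesgue_measure (A `&` `[0, 1]).
Proof.
move=> mA; rewrite /uniform_prob integral_uniform_pdf.
rewrite (eq_integral (cst 1%E)).
  by rewrite integral_cst ?mul1e//; exact: measurableI.
move=> x; rewrite inE/= in_itv/= /uniform_pdf => -[_ ->].
by rewrite subr0 invr1.
Qed.

Lemma uniform_prob_affine (c s : R) (A : set R) : 0 < s -> 0 <= c -> c + s <= 1 ->
    measurable A ->
  (uniform_prob (@ltr01 R) (A `&` `[c, (c + s)%R]) =
   s%:E * uniform_prob (@ltr01 R) ((fun x => c + s * x)%R @^-1` A))%E.
Proof.
move=> s0 c0 cs1 mA; rewrite !uniform_prob01E//; last 2 first.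
- by rewrite -[X in measurable X]setTI; exact: measurable_affine.
- exact: measurableI.
rewrite (lebesgue_measure_affine c s0); last by do 2 apply: measurableI => //.
congr (_ * lebesgue_measure _)%E; apply/seteqP; split=> x /=; rewrite !in_itv/=.
  move=> [[Ax h] _]; split=> //; move: h.
  by rewrite lerDl lerD2l pmulr_rge0// ger_pMr.
move=> [Ax /andP[x0 x1]]; split; first split => //.
  by rewrite lerDl lerD2l pmulr_rge0// ger_pMr// x0.
apply/andP; split; first by rewrite addr_ge0// mulr_ge0// ltW.
by apply: le_trans cs1; rewrite lerD2l ger_pMr.
Qed.

End uniform_affine.

(** * Packing probabilities on the Euclidean cube *)

Section hard_sphere_law.
Context (R : realType) (d : nat).
Local Notation idx := (nat * option 'I_d)%type.
Local Notation spheres := (config R (nat * option 'I_d)%type).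
Local Notation marked_point := (config R (option 'I_d)).
Implicit Types (b : boundary) (r x : R) (A : set marked_point) (t : seq nat).

Definition sphere_marginal (rho : set R -> \bar R) (o : option 'I_d) :
    set R -> \bar R :=
  if o is Some _ then uniform_prob (@ltr01 R) else rho.

Context (rho : probability R R) (Q : probability spheres R).
Hypothesis Qrho : product_law (fun k => sphere_marginal rho k.2) Q.

Lemma pr_coord k (A : set R) : measurable A ->
  Q [set w | A (w k)] = sphere_marginal rho k.2 A.
Proof.
move=> mA; rewrite (_ : [set w | _] = cylinder [fset k]%fset (fun=> A)).
  by rewrite Qrho// big_seq_fset1.
apply/seteqP; split=> w /=; first by move=> Aw j; rewrite inE => /eqP ->.
by move=> /(_ k); rewrite inE eqxx; apply.
Qed.

Lemma pack_le1 b r A n : measurable A -> pack Q b r A n <= 1.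
Proof. by move=> mA; apply: pr_le1; exact: measurable_packing. Qed.

Lemma pack_01 b r A n : measurable A -> 0 <= pack Q b r A n <= 1.
Proof. by move=> mA; rewrite pack_ge0 pack_le1. Qed.

Lemma egf_pack_setU b r A A' x : measurable A -> measurable A' -> 0 <= x ->
  egf (pack Q b r (A `|` A')) x <= egf (pack Q b r A) x * egf (pack Q b r A') x.
Proof.
move=> mA mA' x0; apply: egf_mul_le => // n; rewrite ?pack_01 ?pack_le1//.
- exact: measurableU.
- exact: (pack_setU Qrho).
Qed.

Lemma pack_set0 b r n : pack Q b r set0 n = (n == 0%N)%:R.
Proof.
rewrite /pack; case: n => [|n] /=.
  rewrite (_ : packing _ _ _ _ = setT) ?prT//.
  by apply/seteqP; split=> // w _; split.
rewrite (_ : packing _ _ _ _ = set0) ?/pr ?measure0//.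
by apply/seteqP; split=> // w [/(_ 0%N)]; rewrite inE eqxx => /(_ isT).
Qed.

Lemma egf_pack_bigsetU b r x (I : Type) (s : seq I) (F : I -> set marked_point) :
  (forall i, measurable (F i)) -> 0 <= x ->
  egf (pack Q b r (\big[setU/set0]_(i <- s) F i)) x <=
  \prod_(i <- s) egf (pack Q b r (F i)) x.
Proof.
move=> mF x0; elim: s => [|i s IHs].
  rewrite !big_nil; apply: egf_le => // [n|M]; first exact: pack_le1.
  rewrite /egf_sum; case: M => [|M]; first by rewrite big_ord0.
  rewrite big_ord_recl /= pack_set0 eqxx expr0 fact0 divr1 mulr1 big1 ?addr0//.
  by move=> n _; rewrite pack_set0 mulr0.
rewrite !big_cons; apply: le_trans (egf_pack_setU _ _ _ _ _) _ => //.
  exact: bigsetU_measurable.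
by rewrite ler_wpM2l// egf_ge0// => n; exact: pack_le1.
Qed.

Definition box (c : 'I_d -> R) (s : R) : set marked_point :=
  [set z | forall i, c i <= z (Some i) <= c i + s].

Lemma measurable_box c s : measurable (box c s).
Proof.
rewrite (_ : box c s = \bigcap_(i in [set: 'I_d])
    ((fun z : marked_point => z (Some i)) @^-1` `[c i, c i + s])).
  apply: fin_bigcap_measurable => // i _; rewrite -[X in measurable X]setTI.
  exact: measurable_coord.
by apply/seteqP; split=> z /= h i; [move=> _|have := h i I];
  rewrite ?in_itv//=; exact: h.
Qed.

(** Only the first [N] centres are moved: for [s < 1] infinitely many centres lie in the box with
    probability zero at once, so finitely many at a time have to be considered. *)
Definition affine_spheres (c : 'I_d -> R) (s : R) N (w : spheres) : spheres :=
  fun k => if k.2 is Some i then (if (k.1 < N)%N then c i + s * w k else w k)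
           else w k.

Lemma measurable_affine_spheres c s N : measurable_fun setT (affine_spheres c s N).
Proof.
apply: measurable_config => -[n [i|]]; rewrite /affine_spheres /=; last first.
  exact: measurable_coord.
case: (n < N)%N; last exact: measurable_coord.
by apply: measurable_funD => //; apply: measurable_funM => //; exact: measurable_coord.
Qed.

(** Given that the first [N] centres fall into the box they are uniform in it. Both sides are
    measures in [B], compared on cylinders; each of the [d * N] coordinates in [K] yields one factor
    [s]. *)
Lemma law_box (c : 'I_d -> R) (s : R) (N : nat) (B : set spheres) :
    0 < s -> (forall i, 0 <= c i) -> (forall i, c i + s <= 1) -> measurable B ->
  Q (B `&` [set w | forall n, (n < N)%N -> box c s (sphere_at w n)]) =
  (((s ^+ d) ^+ N)%:E * Q (affine_spheres c s N @^-1` B))%E.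
Proof.
move=> s0 c0 cs1 mB.
set C := [set w | _].
pose K := [fset k in [seq (n, Some i) | n <- iota 0 N, i <- enum 'I_d]]%fset.
have KE (k : idx) : (k \in K) = (if k.2 is Some _ then (k.1 < N)%N else false).
  case: k => n [i|] /=; rewrite !inE /=.
    apply/allpairsP/idP => [[[m j] /= [+ _ [-> _]]]|nN]; first by rewrite mem_iota.
    by exists (n, i); split=> //=; rewrite ?mem_iota ?mem_enum.
  by apply/allpairsP => -[[m j] /= []].
pose D (k : idx) : set R := if k \in K then
  (if k.2 is Some i then `[c i, c i + s]%classic else setT) else setT.
have mD k : measurable (D k).
  by rewrite /D; case: ifP => // _; case: (k.2).
have CE : C = cylinder K D.
  apply/seteqP; split=> w /= h.
    move=> [n [i|]]; rewrite KE//= => nN; rewrite /D KE /= nN /= in_itv/=.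
    exact: h.
  move=> n nN i; have := h (n, Some i); rewrite KE /= => /(_ nN).
  by rewrite /D KE /= nN /= in_itv.
have mC : measurable C by rewrite CE; exact: measurable_cylinder.
pose m1 := mrestr Q mC.
have mf := measurable_affine_spheres c s N.
have sN0 : 0 <= (s ^+ d) ^+ N by rewrite !exprn_ge0// ltW.
pose m2 := mscale (NngNum sN0) (image_measure Q mf).
apply: (config_measure_unique (m1 := m1) (m2 := m2)) => //.
  by rewrite /m1 /= /mrestr setTI (le_lt_trans (probability_le1 Q mC))// ltry.
move=> J A mA.
rewrite /m1 /m2 /= /mrestr /mscale /= /pushforward.
pose A' k := if k \in J then A k else setT.
pose J' := (K `|` J)%fset.
have mA' k : measurable (A' k) by rewrite /A'; case: ifP.
have cJ : cylinder J A = cylinder J' A'.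
  apply/seteqP; split=> w /= h k; rewrite /A'.
    by case: ifP => // kJ _; exact: h.
  by move=> kJ; have := h k; rewrite /A' in_fsetU kJ orbT => /(_ isT).
pose g (k : idx) (u : R) := if k \in K then
  (if k.2 is Some i then c i + s * u else u) else u.
have mg k : measurable_fun setT (g k).
  rewrite /g; case: (k \in K) => //; case: (k.2) => // i; exact: measurable_affine.
have mgA k : measurable (g k @^-1` A' k).
  by rewrite -[X in measurable X]setTI; exact: mg.
have -> : affine_spheres c s N @^-1` cylinder J A = cylinder J' (fun k => g k @^-1` A' k).
  rewrite cJ; apply/seteqP; split=> w /= h k kJ; have := h k kJ;
  rewrite /= /affine_spheres /g KE; by case: (k) => n [i|] //=.
have -> : cylinder J A `&` C = cylinder J' (fun k => A' k `&` D k).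
  rewrite cJ CE; apply/seteqP; split=> w /=.
    move=> [h1 h2] k kJ; split; first exact: h1.
    by rewrite /D; case: ifPn => // kK; have := h2 k kK; rewrite /D kK.
  move=> h; split=> k kJ; first by have [] := h k kJ.
  by have [] := h k; rewrite // in_fsetU kJ.
apply: etrans (Qrho J' _) _; first by move=> k; exact: measurableI.
transitivity (\prod_(k <- J') (if k \in K then s%:E else 1) *
    \prod_(k <- J') sphere_marginal rho k.2 (g k @^-1` A' k))%E.
  rewrite -big_split /=; apply: eq_bigr => -[n [i|]] _ /=; rewrite /g /D KE /=.
    case: ifP => nN /=; last by rewrite setIT mul1e.
    exact: uniform_prob_affine.
  by rewrite setIT mul1e.
congr (_ * _)%E; last exact/esym/Qrho.
rewrite -(@big_fset_incl _ _ _ _ K J'); last 2 first.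
- exact: fsubsetUl.
- by move=> k _ /negbTE ->.
rewrite big_seq (eq_bigr (fun=> s%:E)); last by move=> k ->.
rewrite -big_seq (perm_big [seq (n, Some i) | n <- iota 0 N, i <- enum 'I_d]); last first.
  apply: uniq_perm; first exact: fset_uniq.
    by apply: allpairs_uniq; rewrite ?iota_uniq ?enum_uniq// => -[? ?] [? ?] _ _ [-> ->].
  by move=> k; rewrite inE.
rewrite big_const_seq count_predT size_allpairs size_iota -cardE card_ord -exprM mulnC.
by elim: (d * N)%N => //= n ->; rewrite exprS EFinM.
Qed.

(** Enlarging the box to the unit cube divides lengths by [s], hence the scale [r / s]. A sub-box
    has no periodic boundary, which is why the distance is Euclidean. *)
Lemma pack_box r (c : 'I_d -> R) s n :
    0 < s -> (forall i, 0 <= c i) -> (forall i, c i + s <= 1) ->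
  pack Q Euclidean r (box c s) n = (s ^+ d) ^+ n * pack Q Euclidean (r / s) setT n.
Proof.
move=> s0 c0 cs1.
apply/EFin_inj; rewrite EFinM -!prE; try by apply: measurable_packing; try exact: measurable_box.
have mE : measurable (packing Euclidean r setT (iota 0 n) : set spheres).
  exact: measurable_packing.
rewrite (_ : packing _ _ (box c s) _ = packing Euclidean r setT (iota 0 n) `&`
    [set w | forall k, (k < n)%N -> box c s (sphere_at w k)]); last first.
  apply/seteqP; split=> w /= [h1 h2].
    by split; [split|move=> k kn; apply: h1; rewrite mem_iota].
  by split; [move=> k; rewrite mem_iota add0n => /andP[_] /h2|case: h1].
rewrite law_box//; congr (_ * Q _)%E.
have gapE w i j : (i < n)%N -> (j < n)%N ->
    spheres_meet Euclidean r (sphere_at (affine_spheres c s n w) i)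
      (sphere_at (affine_spheres c s n w) j) =
    spheres_meet Euclidean (r / s) (sphere_at w i) (sphere_at w j).
  move=> ni nj; rewrite /spheres_meet /gap /sphere_at /affine_spheres /= ni nj.
  rewrite (eq_bigr (fun l => s ^+ 2 * (w (i, Some l) - w (j, Some l)) ^+ 2)); last first.
    by move=> l _; rewrite -exprMn; congr (_ ^+ 2); ring.
  rewrite -mulr_sumr sqrtrM ?sqr_ge0// sqrtr_sqr gtr0_norm//.
  by rewrite mulrAC ltr_pdivlMr// mulrC.
apply/seteqP; split=> w /= [_ h]; split=> // i j; rewrite !mem_iota !add0n =>
  /andP[_ ni] /andP[_ nj] ij.
  by rewrite -gapE//; apply: h; rewrite ?mem_iota ?add0n.
by rewrite gapE//; apply: h; rewrite ?mem_iota ?add0n.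
Qed.

Context (rbar : R) (rho_pos : rho `]0, rbar]%classic = 1%E).

Definition cube : set marked_point :=
  [set z | (forall i, 0 <= z (Some i) <= 1) /\ 0 < z None <= rbar].

Lemma measurable_cube : measurable cube.
Proof.
rewrite (_ : cube = box (fun=> 0) 1 `&`
   (fun z : marked_point => z None) @^-1` `]0, rbar]).
  apply: measurableI; first exact: measurable_box.
  by rewrite -[X in measurable X]setTI; exact: measurable_coord.
apply/seteqP; split=> z /= [h1 h2]; split; rewrite ?in_itv//=.
  by move=> i; rewrite add0r.
by move=> i; have := h1 i; rewrite add0r.
Qed.

Lemma pr_not_cube n : pr Q [set w | ~ cube (sphere_at w n)] = 0.
Proof.
pose N (k : idx) := [set w : spheres | ~ (if k.2 is Some _ then `[0, 1]%classic else
  `]0, rbar]%classic) (w k)].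
have N0 k : Q (N k) = 0%E.
  rewrite (pr_coord k (A := ~` (if k.2 is Some _ then `[0, 1]%classic else
     `]0, rbar]%classic))); last by case: (k.2) => [_|]; exact: measurableC.
  case: k => m [i|] /=; rewrite probability_setC ?rho_pos ?subee//.
  have := @uniform_prob01E R _ (measurable_itv `[0, 1]).
  rewrite setIid lebesgue_measure_itv/= lte_fin ltr01 oppr0 adde0 => h.
  by apply: etrans (congr1 (fun v => 1 - v)%E h) _; rewrite subee.
have mN k : measurable (N k).
  rewrite /N; apply: measurableC; case: (k.2) => [_|];
  by rewrite -[X in measurable X]setTI; exact: measurable_coord.
apply/eqP; rewrite eq_le pr_ge0 andbT.
have mcube : measurable [set w | ~ cube (sphere_at w n)].
  apply: measurableC; rewrite -[X in measurable X]setTI; apply: measurable_sphere_at => //.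
  exact: measurable_cube.
apply: (@le_trans _ _ (pr Q (\big[setU/set0]_(o <- index_enum (option 'I_d)) N (n, o)))).
  apply: le_pr => //; first exact: bigsetU_measurable.
  move=> w /= h; rewrite -bigcup_seq; apply: contrapT => h'; apply: h; split=> [i|];
    apply: contrapT => h; apply: h'.
    by exists (Some i); [rewrite /= mem_index_enum|rewrite /N /= in_itv/=].
  by exists None; [rewrite /= mem_index_enum|rewrite /N /= in_itv/=].
apply: le_trans (pr_bigsetU_le _ _ _) _ => //.
by rewrite big1// => o _; rewrite /pr N0.
Qed.

Lemma eq_pr_cube (s : seq nat) (B B' : set spheres) : measurable B -> measurable B' ->
  (forall w, (forall n, n \in s -> cube (sphere_at w n)) -> B w <-> B' w) ->
  pr Q B = pr Q B'.
Proof.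
move=> mB mB' BB'.
have mcube n : measurable [set w | ~ cube (sphere_at w n)].
  apply: measurableC; rewrite -[X in measurable X]setTI; apply: measurable_sphere_at => //.
  exact: measurable_cube.
apply: (@eq_pr_ae _ _ _ _ B B' (\big[setU/set0]_(n <- s) [set w | ~ cube (sphere_at w n)])) => //.
- exact: bigsetU_measurable.
- apply/eqP; rewrite eq_le pr_ge0 andbT (le_trans (pr_bigsetU_le _ _ _))//.
  by rewrite big1// => n _; exact: pr_not_cube.
- move=> w; rewrite -bigcup_seq => h; apply: BB' => n ns.
  by apply: contrapT => h'; apply: h; exists n.
Qed.

Lemma pack_cube b r A A' n : measurable A -> measurable A' ->
  (forall z, cube z -> A z <-> A' z) -> pack Q b r A n = pack Q b r A' n.
Proof.
move=> mA mA' AA'; apply: (@eq_pr_cube (iota 0 n)); try exact: measurable_packing.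
move=> w h; split=> -[h1 h2]; split=> // i it; have := h1 i it.
  by move/(AA' _ (h i it)).
by move/(AA' _ (h i it)).
Qed.

End hard_sphere_law.

(** * Subdivision of the cube into cells *)

Section subdivision.
Context (R : realType) (d : nat) (rbar : R).
Local Notation spheres := (config R (nat * option 'I_d)%type).
Local Notation marked_point := (config R (option 'I_d)).
Implicit Types (b : boundary) (r x : R) (A : set marked_point).
Context (rho : probability R R) (Q : probability spheres R).
Hypothesis Qrho : product_law (fun k => sphere_marginal rho k.2) Q.
Hypothesis rho_pos : rho `]0, rbar]%classic = 1%E.

Definition packing_prob b r n : R := pack Q b r setT n.

Lemma packing_prob_le1 b r n : packing_prob b r n <= 1. Proof. exact: pack_le1. Qed.

Lemma packing_prob_ge0 b r n : 0 <= packing_prob b r n. Proof. exact: pack_ge0. Qed.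

Lemma egf_pack_box r x (c : 'I_d -> R) s :
    0 < s -> (forall i, 0 <= c i) -> (forall i, c i + s <= 1) ->
  egf (pack Q Euclidean r (box c s)) x = egf (packing_prob Euclidean (r / s)) (s ^+ d * x).
Proof.
move=> s0 c0 cs1; rewrite -egf_scale; congr (egf _ x).
by apply/funext => n; exact: (pack_box Qrho).
Qed.

Section grid.
Variable k : nat.

(** Closed cells share faces; this is harmless because [pack_setU] allows regions to intersect. *)
Definition cell (f : {ffun 'I_d -> 'I_k.+1}) : set marked_point :=
  box (fun i => (f i)%:R / k.+1%:R) k.+1%:R^-1.

Lemma measurable_cell f : measurable (cell f).
Proof. exact: measurable_box. Qed.

Lemma cell_le1 (f : {ffun 'I_d -> 'I_k.+1}) i :
  (f i)%:R / k.+1%:R + k.+1%:R^-1 <= 1 :> R.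
Proof. by rewrite -{2}[k.+1%:R^-1]mul1r -mulrDl natr1 ler_pdivrMr// mul1r ler_nat. Qed.

Lemma cube_cell z : cube rbar z -> exists f, cell f z.
Proof.
move=> [z01 _].
have H i : exists j : 'I_k.+1,
    j%:R / k.+1%:R <= z (Some i) <= j%:R / k.+1%:R + k.+1%:R^-1.
  have /andP[z0 z1] := z01 i.
  (* The minimum with [k] puts the coordinate 1 into the last cell. *)
  pose j := minn (Num.truncn (k.+1%:R * z (Some i))) k.
  have jk : (j < k.+1)%N by rewrite ltnS geq_minr.
  have kz0 : 0 <= k.+1%:R * z (Some i) by rewrite mulr_ge0.
  have /andP[t1 t2] := truncn_itv kz0.
  exists (Ordinal jk) => /=; rewrite -{3}[k.+1%:R^-1]mul1r -mulrDl.
  rewrite ler_pdivrMr// ler_pdivlMr// [z _ * _]mulrC /j; apply/andP; split.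
    by apply: le_trans t1; rewrite ler_nat geq_minl.
  rewrite natr1; case: (leqP (Num.truncn (k.+1%:R * z (Some i))) k) => h.
    exact: ltW.
  by rewrite ler_piMr.
have /choice[f fE] := H.
by exists [ffun i => f i] => i; rewrite ffunE.
Qed.

Lemma packing_prob_cells b r n :
  packing_prob b r n = pack Q b r (\big[setU/set0]_(f <- index_enum {ffun 'I_d -> 'I_k.+1}) cell
    f) n.
Proof.
apply: (pack_cube Qrho rho_pos) => //.
  by apply: bigsetU_measurable => f _; exact: measurable_cell.
move=> z /cube_cell[f fz]; split=> // _; rewrite -bigcup_seq.
by exists f => //=; exact: mem_index_enum.
Qed.

(** Only the constraints inside each cell are kept, and each cell is a rescaled unit cube. *)
Lemma egf_packing_prob_subdivide r x : 0 <= x ->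
  egf (packing_prob Euclidean r) x <=
  egf (packing_prob Euclidean (r * k.+1%:R)) (x / k.+1%:R ^+ d) ^+ (k.+1 ^ d).
Proof.
move=> x0; have -> : packing_prob Euclidean r = pack Q Euclidean r
    (\big[setU/set0]_(f <- index_enum {ffun 'I_d -> 'I_k.+1}) cell f).
  by apply/funext => n; exact: packing_prob_cells.
apply: le_trans (egf_pack_bigsetU Qrho _ _ _ measurable_cell x0) _.
rewrite (eq_bigr (fun=> egf (packing_prob Euclidean (r * k.+1%:R)) (x / k.+1%:R ^+ d))).
  by rewrite prodr_const card_ffun !card_ord.
move=> f _; rewrite egf_pack_box//; last exact: cell_le1.
by rewrite invrK exprVn [_^-1 * x]mulrC.
Qed.

End grid.

Lemma pr_all_in A n : measurable A ->
  pr Q [set w | forall i, (i < n)%N -> A (sphere_at w i)] =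
  pr Q [set w | A (sphere_at w 0)] ^+ n.
Proof.
move=> mA.
have mi i : measurable [set w | A (sphere_at w i)].
  by rewrite -[X in measurable X]setTI; exact: measurable_sphere_at.
have mall m : measurable [set w | forall i, (i < m)%N -> A (sphere_at w i)].
  rewrite (_ : mkset _ = \bigcap_(i in [set j | (j < m)%N]) [set w | A (sphere_at w i)]) //.
  by apply: fin_bigcap_measurable => //; exact: finite_II.
elim: n => [|n IHn].
  by rewrite expr0 (_ : mkset _ = setT) ?prT//; apply/seteqP; split.
rewrite (_ : mkset _ = [set w | forall i, (i < n)%N -> A (sphere_at w i)] `&`
    [set w | A (sphere_at w n)]); last first.
  apply/seteqP; split=> w /= h.
    by split=> [i ni|]; apply: h => //; exact: ltnW.
  by move=> i; rewrite ltnS leq_eqVlt => /orP[/eqP ->|]; [exact: (proj2 h)|exact: (proj1 h)].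
rewrite (pr_indep Qrho (J := fun k => k.1 < n)%N)// => [|w w'|w w'].
- rewrite IHn exprSr; congr (_ * _).
  (* A single sphere is a packing of one label, so [pr_packing] moves the label to 0. *)
  have h (m : nat) : [set w | A (sphere_at w m)] = packing Euclidean 0 A [:: m].
    apply/seteqP; split=> w /=.
      move=> Aw; split=> [i|i j]; rewrite !inE => /eqP ->//.
      by move=> /eqP ->; rewrite eqxx.
    by move=> [/(_ m)]; rewrite inE eqxx => /(_ isT).
  by rewrite !h !(pr_packing Qrho).
- have E i : (i < n)%N -> sphere_at (mix (fun k => k.1 < n)%N w w') i = sphere_at w i.
    by move=> ni; apply/funext => o; rewrite /sphere_at /mix /= ni.
  by split=> /= h i ni; have := h i ni; rewrite E.
- rewrite /= (_ : sphere_at _ n = sphere_at w' n)//.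
  by apply/funext => o; rewrite /sphere_at /mix /= ltnn.
Qed.

Definition point_prob A : R := pr Q [set w | A (sphere_at w 0)].

Lemma point_prob_ge0 A : 0 <= point_prob A. Proof. exact: pr_ge0. Qed.

Lemma point_probC A : measurable A -> point_prob (~` A) = 1 - point_prob A.
Proof.
move=> mA; rewrite /point_prob -prC//.
by rewrite -[X in measurable X]setTI; exact: measurable_sphere_at.
Qed.

Lemma pack_le_exp b r A n : measurable A -> pack Q b r A n <= point_prob A ^+ n.
Proof.
move=> mA; rewrite -pr_all_in//; apply: le_pr; first exact: measurable_packing.
  rewrite (_ : mkset _ = \bigcap_(i in [set j | (j < n)%N])
     [set w | A (sphere_at w i)]) //.
  apply: fin_bigcap_measurable => [|i _]; first exact: finite_II.
  by rewrite -[X in measurable X]setTI; exact: measurable_sphere_at.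
by move=> w [h _] i ni; apply: h; rewrite mem_iota.
Qed.

(** Forgetting non-overlap inside [A] leaves the bound [point_prob A ^+ n] for the coefficients. *)
Lemma egf_pack_le_expR b r A x : measurable A -> 0 <= x ->
  egf (pack Q b r A) x <= expR (point_prob A * x).
Proof.
move=> mA x0; have p0 := point_prob_ge0 A.
have p1 : point_prob A <= 1.
  by apply: pr_le1; rewrite -[X in measurable X]setTI; exact: measurable_sphere_at.
apply: le_trans (@egf_le_expR _ (fun=> 1) _ _ _) => //; last exact: mulr_ge0.
rewrite -egf_scale; apply: le_egf => // n; rewrite mulr1; first exact: pack_le_exp.
exact: exprn_ile1.
Qed.

Lemma point_prob_boxI (c : 'I_d -> R) s (C : set R) :
    0 < s -> (forall i, 0 <= c i) -> (forall i, c i + s <= 1) -> measurable C ->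
  point_prob (box c s `&` [set z | C (z None)]) =
  s ^+ d * point_prob [set z | C (z None)].
Proof.
move=> s0 c0 cs1 mC; rewrite /point_prob.
have mA : measurable [set w : spheres | C (w (0%N, None))].
  by rewrite -[X in measurable X]setTI; exact: measurable_coord.
rewrite (_ : mkset _ = [set w | C (w (0%N, None))] `&`
    [set w | forall k, (k < 1)%N -> box c s (sphere_at w k)]); last first.
  apply/seteqP; split=> w /=.
    by move=> [h1 h2]; split=> // -[].
  by move=> [h1 /(_ 0%N isT)].
by apply/EFin_inj; rewrite EFinM /pr (law_box Qrho)// expr1 fineM// fin_num_measure.
Qed.

(** Non-overlap is kept in one box only; its complement, of volume [1 - s ^+ d], contributes at most
    the exponential of its mean number of points. *)
Lemma egf_packing_prob_subbox r x s : 0 < s <= 1 -> 0 <= x ->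
  egf (packing_prob Euclidean r) x <=
  expR ((1 - s ^+ d) * x) * egf (packing_prob Euclidean (r / s)) (s ^+ d * x).
Proof.
move=> /andP[s0 s1] x0.
have mb := @measurable_box R d (fun=> 0) s.
have -> : packing_prob Euclidean r = pack Q Euclidean r (~` box (fun=> 0) s `|` box (fun=> 0) s).
  by rewrite setUC setUv.
apply: le_trans (egf_pack_setU Qrho _ _ (measurableC mb) mb x0) _.
rewrite egf_pack_box ?add0r// ler_wpM2r//.
  by apply: egf_ge0 => [|n]; [rewrite mulr_ge0// exprn_ge0// ltW|exact: packing_prob_le1].
apply: le_trans (egf_pack_le_expR _ _ (measurableC mb) x0) _.
rewrite point_probC//.
have := @point_prob_boxI (fun=> 0) s setT s0 (fun=> lexx 0).
rewrite setIT => ->//; last by move=> _; rewrite add0r.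
by rewrite /point_prob prT mulr1.
Qed.

End subdivision.

(** * Birthday problem *)

Section birthday_sums.
Context (R : realFieldType).

(** A truncated form of the series of [(1 - w)^-(k+1)]: by Pascal's rule, multiplying by [1 - w]
    lowers [k] by one up to a boundary term. *)
Lemma negative_binomial_sum (w : R) k M :
  (1 - w) * \sum_(j < M) 'C(j + k.+1, k.+1)%:R * w ^+ j =
  \sum_(j < M) 'C(j + k, k)%:R * w ^+ j - 'C(M + k, k.+1)%:R * w ^+ M.
Proof.
elim: M => [|M IHM]; first by rewrite !big_ord0 mulr0 add0n bin_small// mul0r subr0.
rewrite !big_ord_recr/= mulrDr IHM addSn addnS binS natrD exprS.
ring.
Qed.

Lemma negative_binomial_le (w : R) k M : 0 <= w < 1 ->
  \sum_(j < M) 'C(j + k, k)%:R * w ^+ j <= (1 - w)^-1 ^+ k.+1.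
Proof.
move=> /andP[w0 w1]; have w10 : 0 < 1 - w by rewrite subr_gt0.
elim: k => [|k IHk].
  rewrite expr1 -[leRHS]mulr1 ler_pdivlMl//.
  rewrite (eq_bigr (fun j : 'I_M => w ^+ j)); last by move=> j _; rewrite bin0 mul1r.
  by rewrite -opprB mulNr -subrX1 opprB gerBl exprn_ge0.
rewrite exprS ler_pdivlMl// negative_binomial_sum.
by rewrite (le_trans _ IHk)// gerBl mulr_ge0// exprn_ge0.
Qed.

(** Let c_i be the probability that [i] birthdays among [K] days are distinct. Then c_{i+1} = c_i (K
    - i) / K, so i c_i = K (c_i - c_{i+1}) telescopes. *)
Lemma ffact_sum (K M : nat) : (0 < K)%N ->
  \sum_(i < M) i%:R * ((K ^_ i)%:R / K%:R ^+ i) <= K%:R :> R.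
Proof.
move=> K0; have K0' : K%:R != 0 :> R by rewrite pnatr_eq0 -lt0n.
suff -> : \sum_(i < M) i%:R * ((K ^_ i)%:R / K%:R ^+ i) =
    K%:R - K%:R * ((K ^_ M)%:R / K%:R ^+ M) :> R.
  by rewrite gerBl mulr_ge0// divr_ge0// exprn_ge0.
elim: M => [|M IHM]; first by rewrite big_ord0 ffactn0 expr0 divr1 mulr1 subrr.
rewrite big_ord_recr/= IHM ffactnSr natrM exprS.
have [KM|MK] := ltnP K M; first by rewrite ffact_small// !(mul0r, mulr0, subr0, addr0).
rewrite natrB//; field; rewrite K0' expf_neq0//.
Qed.

(** Only the term [i = 0] escapes the comparison [c i <= i * c i]; it accounts for the summand 1. *)
Lemma ffact_sumS (K M : nat) : (0 < K)%N ->
  \sum_(i < M) i.+1%:R * ((K ^_ i)%:R / K%:R ^+ i) <= 2 * K%:R + 1 :> R.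
Proof.
move=> K0; pose c (i : nat) : R := (K ^_ i)%:R / K%:R ^+ i.
have c0 i : 0 <= c i by rewrite divr_ge0// exprn_ge0.
rewrite (eq_bigr (fun i : 'I_M => i%:R * c i + c i)); last first.
  by move=> i _; rewrite -natr1 mulrDl mul1r.
rewrite big_split/=.
have H := ffact_sum M K0.
suff : \sum_(i < M) c i <= 1 + K%:R by move: H; rewrite -/c; lra.
case: M H => [|M] H; first by rewrite big_ord0 addr_ge0.
rewrite big_ord_recl /= {1}/c ffactn0 expr0 divr1 lerD2l.
apply: le_trans H; rewrite [leRHS]big_ord_recl mul0r add0r.
by apply: ler_sum => i _; rewrite ler_peMl// ler1n.
Qed.

Lemma binomial_sum_le (K M : nat) (y : R) : 0 <= y ->
  \sum_(n < M) 'C(K, n)%:R * y ^+ n <= (1 + y) ^+ K.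
Proof.
move=> y0; rewrite addrC exprD1n.
have term0 n : 0 <= 'C(K, n)%:R * y ^+ n by rewrite mulr_ge0// exprn_ge0.
have eqn (n : nat) : 'C(K, n)%:R * y ^+ n = y ^+ n *+ 'C(K, n) by rewrite mulr_natl.
under [leRHS]eq_bigr do rewrite -eqn.
have [MK|KM] := leqP M K.+1.
  rewrite (big_ord_widen K.+1 (fun n => 'C(K, n)%:R * y ^+ n) MK).
  rewrite [leRHS](bigID (fun n : 'I_K.+1 => (n < M)%N))/= lerDl.
  by apply: sumr_ge0 => n _.
rewrite (big_ord_widen M (fun n => 'C(K, n)%:R * y ^+ n) (ltnW KM)).
rewrite [leLHS](bigID (fun n : 'I_M => (n < K.+1)%N))/= [X in _ + X]big1 ?addr0//.
by move=> n; rewrite -leqNgt => Kn; rewrite bin_small// mul0r.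
Qed.

End birthday_sums.

Section birthday.
Context (R : realType) (d : nat) (rbar : R).
Local Notation spheres := (config R (nat * option 'I_d)%type).
Local Notation marked_point := (config R (option 'I_d)).
Implicit Types (b : boundary) (r x : R) (A : set marked_point).
Context (rho : probability R R) (Q : probability spheres R).
Hypothesis Qrho : product_law (fun k => sphere_marginal rho k.2) Q.
Hypothesis rho_pos : rho `]0, rbar]%classic = 1%E.
Local Notation packing_prob := (@packing_prob R d Q).
Local Notation point_prob := (@point_prob R d Q).

Variables (r a : R) (k : nat).
(** A cell has diameter at most [d / (k + 1)], with [d] as a crude bound for its square root. Two
    spheres of unscaled radius at least [a] centred in one cell therefore overlap. *)
Hypotheses (r_gt0 : 0 < r) (grid_fine : d%:R / k.+1%:R < 2 * a * r).

Definition large : set marked_point := [set z | a <= z None].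

Lemma measurable_large : measurable large.
Proof.
rewrite (_ : large = setT `&` (fun z : marked_point => z None) @^-1` `[a, +oo[).
  exact: measurable_coord.
by rewrite setTI; apply/seteqP; split=> z /=; rewrite in_itv/= andbT.
Qed.

Definition large_cell (f : {ffun 'I_d -> 'I_k.+1}) := @cell R d k f `&` large.

Lemma measurable_large_cell f : measurable (large_cell f).
Proof. by apply: measurableI; [exact: measurable_cell|exact: measurable_large]. Qed.

Let K := (k.+1 ^ d)%N.
Let p := point_prob large.

Lemma large_cell_meet f z z' : large_cell f z -> large_cell f z' ->
  spheres_meet Euclidean r z z'.
Proof.
move=> [zf za] [z'f z'a]; rewrite /spheres_meet /gap /=.
apply: (@le_lt_trans _ _ (d%:R / k.+1%:R)).
  rewrite -[leRHS]ger0_norm ?divr_ge0// -sqrtr_sqr ler_wsqrtr// exprMn.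
  apply: (@le_trans _ _ (\sum_(i < d) k.+1%:R^-1 ^+ 2)).
    apply: ler_sum => i _; rewrite -[leLHS]real_normK ?num_real// ler_sqr ?nnegrE ?normr_ge0//.
    have /andP[z1 z2] := zf i; have /andP[z1' z2'] := z'f i.
    move: z1 z2 z1' z2'; set q := _ / _; set h := _^-1 => z1 z2 z1' z2'.
    by rewrite ler_norml; apply/andP; split; move: z1 z2 z1' z2'; lra.
  rewrite sumr_const card_ord -[leLHS]mulr_natl ler_wpM2r ?sqr_ge0//.
  by rewrite -natrX ler_nat; case: (d) => // n; rewrite expnS leq_pmulr// expn_gt0.
apply: lt_le_trans grid_fine _.
by rewrite mulrC ler_pM2l//; move: za z'a; rewrite /large /=; lra.
Qed.

Lemma pack_large_cell0 f n : pack Q Euclidean r (large_cell f) n.+2 = 0.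
Proof.
rewrite /pack (_ : packing _ _ _ _ = set0) ?/pr ?measure0//.
apply/seteqP; split=> // w [h1 h2].
have i0 : 0%N \in iota 0 n.+2 by rewrite mem_iota.
have i1 : 1%N \in iota 0 n.+2 by rewrite mem_iota.
by have := h2 0%N 1%N i0 i1 isT; rewrite (large_cell_meet (h1 _ i0) (h1 _ i1)).
Qed.

Lemma pack_large_cell1 f : pack Q Euclidean r (large_cell f) 1 <= p / K%:R.
Proof.
apply: le_trans (pack_le_exp Qrho _ _ _ (measurable_large_cell f)) _.
rewrite expr1 /large_cell (_ : large = [set z | `[a, +oo[%classic (z None)]); last first.
  by apply/seteqP; split=> z /=; rewrite in_itv/= andbT.
rewrite (point_prob_boxI Qrho)//; last exact: cell_le1.
rewrite exprVn -natrX mulrC -/K /p /large (_ : [set z | a <= z None] = [set z | `[a, +oo[%classic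
  (z None)])//.
by apply/seteqP; split=> z /=; rewrite in_itv/= andbT.
Qed.

Lemma p_ge0 : 0 <= p. Proof. exact: pr_ge0. Qed.

(** A new cell holds no sphere or exactly one of the [n + 1] spheres. This is the recursion of the
    falling factorial, which counts the injections of spheres into cells; each placement has
    probability at most [p / K]. *)
Lemma pack_large_cells (s : seq {ffun 'I_d -> 'I_k.+1}) n :
  pack Q Euclidean r (\big[setU/set0]_(f <- s) large_cell f) n <=
  (p / K%:R) ^+ n * (size s ^_ n)%:R.
Proof.
have pK : 0 <= p / K%:R by rewrite divr_ge0// p_ge0.
have mU (s' : seq {ffun 'I_d -> 'I_k.+1}) :
    measurable (\big[setU/set0]_(f <- s') large_cell f).
  by apply: bigsetU_measurable => f _; exact: measurable_large_cell.
elim: s n => [|f s IHs] n.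
  rewrite big_nil pack_set0; case: n => [|n]; first by rewrite expr0 ffactn0 mulr1.
  by rewrite ffact_small//= mulr0.
rewrite big_cons.
apply: le_trans (pack_setU Qrho _ _ _ (measurable_large_cell f) (mU s)) _.
case: n => [|n].
  rewrite big_ord_recl big_ord0 addr0 expr0 ffactn0 mulr1 bin0 mul1r.
  by rewrite mulr_ile1 ?pack_ge0 ?pack_le1//; exact: measurable_large_cell.
rewrite 2!big_ord_recl [X in _ + (_ + X)]big1 ?addr0; last first.
  by move=> i _; rewrite !lift0 pack_large_cell0 mulr0 mul0r.
rewrite bin0 mul1r subn0 lift0 bin1 subn1.
apply: (@le_trans _ _ ((p / K%:R) ^+ n.+1 * (size s ^_ n.+1)%:R +
    n.+1%:R * (p / K%:R) * ((p / K%:R) ^+ n * (size s ^_ n)%:R))).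
  apply: lerD.
    apply: le_trans (IHs _); rewrite ler_piMl ?pack_ge0 ?pack_le1//.
    exact: measurable_large_cell.
  rewrite ler_pM ?mulr_ge0 ?pack_ge0 ?IHs//.
  by rewrite ler_wpM2l// pack_large_cell1.
rewrite ffactSS exprS le_eqVlt; apply/orP; left; apply/eqP.
rewrite -[in RHS](_ : (size s ^_ n.+1 + n.+1 * size s ^_ n)%N = ((size s).+1 * size s ^_ n)%N).
  by rewrite natrD natrM; ring.
rewrite ffactnSr mulnC -mulnDl; have [sn|ns] := leqP n (size s).
  by rewrite addnS subnK.
by rewrite ffact_small// !muln0.
Qed.

Lemma packing_prob_large_cells b n : packing_prob b r n = pack Q b r
  (~` large `|` \big[setU/set0]_(f <- index_enum {ffun 'I_d -> 'I_k.+1}) large_cell f) n.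
Proof.
apply: (pack_cube Qrho rho_pos) => //.
  apply: measurableU; first exact: (measurableC measurable_large).
  by apply: bigsetU_measurable => f _; exact: measurable_large_cell.
move=> z zc; split=> // _; have [za|za] := pselect (large z); last by left.
right; rewrite -bigcup_seq; have [f fz] := cube_cell k zc.
by exists f => //=; exact: mem_index_enum.
Qed.

(** [j] counts the spheres of radius below [a], whose mutual constraints are dropped; the others
    occupy distinct cells. *)
Lemma packing_prob_birthday n : packing_prob Euclidean r n <=
  \sum_(j < n.+1) 'C(n, j)%:R * (1 - p) ^+ j *
    ((p / K%:R) ^+ (n - j) * (K ^_ (n - j))%:R).
Proof.
rewrite packing_prob_large_cells.
have mU : measurable (\big[setU/set0]_(f <- index_enum {ffun 'I_d -> 'I_k.+1}) large_cell f).
  by apply: bigsetU_measurable => f _; exact: measurable_large_cell.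
apply: le_trans (pack_setU Qrho _ _ _ (measurableC measurable_large) mU) _.
have KE : K = size (index_enum {ffun 'I_d -> 'I_k.+1}).
  by rewrite -sum1_size sum1_card card_ffun !card_ord.
apply: ler_sum => j _; apply: ler_pM; rewrite ?mulr_ge0 ?pack_ge0//.
  rewrite ler_wpM2l// -point_probC; last exact: measurable_large.
  exact: (pack_le_exp Qrho _ _ _ (measurableC measurable_large)).
by rewrite {2}KE; exact: pack_large_cells.
Qed.

Lemma p_le1 : p <= 1.
Proof.
apply: pr_le1; rewrite -[X in measurable X]setTI.
by apply: measurable_sphere_at => //; exact: measurable_large.
Qed.

Lemma K_gt0 : (0 < K)%N. Proof. by rewrite expn_gt0. Qed.

(** The first factor comes from the unconstrained small spheres. For the large ones the sum of 'C(K,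
    n) (x p / K)^n is a binomial power: each cell is empty or holds one sphere. *)
Lemma egf_birthday x : 0 <= x ->
  egf (packing_prob Euclidean r) x <=
  expR ((1 - p) * x) * (1 + x * p / K%:R) ^+ K.
Proof.
move=> x0; have p0 := p_ge0; have p1 := p_le1; have K0 := K_gt0.
have q0 : 0 <= 1 - p by rewrite subr_ge0.
pose B n := (p / K%:R) ^+ n * (K ^_ n)%:R.
have B0 n : 0 <= B n by rewrite mulr_ge0// exprn_ge0// divr_ge0.
have ffK n : (K ^_ n <= K ^ n)%N.
  elim: n => [|n IHn]; first by rewrite ffactn0.
  by rewrite ffactnSr expnSr leq_mul// leq_subr.
have B1 n : B n <= 1.
  rewrite /B exprMn exprVn -natrX -mulrA; apply: mulr_ile1; rewrite ?exprn_ge0 ?exprn_ile1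
    ?mulr_ge0 ?invr_ge0//.
  by rewrite ler_pdivrMl ?mulr1 ?ler_nat// ltr0n expn_gt0 K0.
apply: (@le_trans _ _ (egf (fun n => (1 - p) ^+ n) x * egf B x)).
  apply: egf_mul_le => // n.
  - by rewrite exprn_ge0// exprn_ile1// lerBlDl lerDr.
  - by rewrite B0 B1.
  - exact: packing_prob_le1.
  - exact: packing_prob_birthday.
apply: ler_pM.
- by apply: egf_ge0 => // n; rewrite exprn_ile1// lerBlDl lerDr.
- exact: egf_ge0.
- rewrite (_ : (fun n => _) = (fun n => (1 - p) ^+ n * 1)); last first.
    by apply/funext => n; rewrite mulr1.
  by rewrite egf_scale; apply: egf_le_expR; [exact: mulr_ge0|].
- apply: egf_le => // M; apply: le_trans (@binomial_sum_le _ K M (x * p / K%:R) _); last first.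
    by rewrite divr_ge0// mulr_ge0.
  rewrite le_eqVlt; apply/orP; left; apply/eqP; apply: eq_bigr => n _.
  rewrite /B -bin_ffact natrM -[x * p / _]mulrA [in RHS]exprMn.
  by field; rewrite pnatr_eq0 -lt0n fact_gt0.
Qed.

Lemma sum_packing_prob_le M : 0 < p ->
  \sum_(n < M) n%:R * packing_prob Euclidean r n <= (2 * K%:R + 1) / p ^+ 2.
Proof.
move=> p0; have p1 := p_le1; have K0 := K_gt0.
have q0 : 0 <= 1 - p by rewrite subr_ge0.
have KR : K%:R != 0 :> R by rewrite pnatr_eq0 -lt0n.
(* The factor [n] is raised to [n + 1] because (j+i+1) C(j+i, j) = (i+1) C(j+i+1, i+1). The sum over
   [j] is then negative binomial, at most p^-(i+2), and the power of [p] in front leaves p^-2. *)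
pose u (j i : nat) : R := (j + i).+1%:R * ('C(j + i, j)%:R * (1 - p) ^+ j *
  ((p / K%:R) ^+ i * (K ^_ i)%:R)).
have u0 j i : 0 <= u j i.
  by rewrite !mulr_ge0 ?exprn_ge0// divr_ge0// ltW.
apply: (@le_trans _ _ (\sum_(n < M) \sum_(j < n.+1) u j (n - j)%N)).
  apply: ler_sum => n _.
  apply: (@le_trans _ _ (n.+1%:R * packing_prob Euclidean r n)).
    by rewrite ler_wpM2r ?packing_prob_ge0// ler_nat.
  rewrite (le_trans (ler_wpM2l _ (packing_prob_birthday n)))// mulr_sumr.
  apply: ler_sum => j _; have jn : (j <= n)%N by rewrite -ltnS.
  by rewrite /u subnKC.
apply: le_trans (ler_sum_triangle M u0) _.
rewrite exchange_big /=.
apply: (@le_trans _ _ (\sum_(i < M) i.+1%:R * ((K ^_ i)%:R / K%:R ^+ i) / p ^+ 2)).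
  apply: ler_sum => i _.
  have uE (j : nat) : u j i = (p / K%:R) ^+ i * (K ^_ i)%:R * i.+1%:R *
      ('C(j + i.+1, i.+1)%:R * (1 - p) ^+ j).
    have e : (j + i).+1%:R * 'C(j + i, j)%:R = i.+1%:R * 'C(j + i.+1, i.+1)%:R :> R.
      rewrite -!natrM; congr (_%:R); rewrite -[in LHS]bin_sub ?leq_addr// addKn.
      by rewrite mul_bin_diag addnS.
    by rewrite /u mulrA [in LHS]mulrA e; ring.
  rewrite (eq_bigr (fun j : 'I_M => (p / K%:R) ^+ i * (K ^_ i)%:R * i.+1%:R *
      ('C(j + i.+1, i.+1)%:R * (1 - p) ^+ j))); last by move=> j _; rewrite uE.
  rewrite -mulr_sumr.
  have c0 : 0 <= (p / K%:R) ^+ i * (K ^_ i)%:R * i.+1%:R.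
    by rewrite !mulr_ge0// exprn_ge0// divr_ge0// ltW.
  apply: (@le_trans _ _ ((p / K%:R) ^+ i * (K ^_ i)%:R * i.+1%:R * (1 - (1 - p))^-1 ^+ i.+2)).
    apply: ler_wpM2l => //; apply: negative_binomial_le.
    by rewrite q0 gtrBl.
  rewrite le_eqVlt; apply/orP; left; apply/eqP.
  rewrite opprB addrC subrK exprMn !exprVn [p ^+ i.+2]exprSr exprSr.
  by field; rewrite !expf_neq0 ?gt_eqF// ltr0n.
rewrite -mulr_suml ler_pM2r ?invr_gt0 ?exprn_gt0//.
exact: ffact_sumS.
Qed.

End birthday.

(** * Overlap of two spheres *)

Section axis_integral.
Context (R : realType) (d : nat).
Local Notation mu := (@lebesgue_measure R).

Lemma measurable_ball_volume_axis b (c t : R) :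
  measurable_fun setT (fun x : R => ball_volume d (t - axis_sqr b (x - c))).
Proof.
apply: (measurableT_comp (measurable_ball_volume d)).
apply: measurable_funB => //; apply: (measurableT_comp (measurable_axis_sqr b)).
exact: measurable_funB.
Qed.

Lemma ball_volume_axis_le (x t : R) :
  (ball_volume d (t - axis_sqr Torus x) <= ball_volume d (t - x ^+ 2) +
   (ball_volume d (t - (x - 1) ^+ 2) + ball_volume d (t - (x + 1) ^+ 2)))%E.
Proof.
have v0 u : (0 <= ball_volume d u :> \bar R)%E by exact: ball_volume_ge0.
rewrite /= /Order.min; case: ifP => _; first by apply: leeDl; exact: adde_ge0.
case: ifP => _; first by rewrite addeCA; apply: leeDl; exact: adde_ge0.
by rewrite addeA; apply: leeDr; exact: adde_ge0.
Qed.

(** On the torus the three candidate shifts carry the unit interval onto [[-1, 0[], [[0, 1[] and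
    [[1, 2[]. These are disjoint, so the three integrals add up to at most the one over the line;
    half-open intervals avoid double counting. *)
Lemma integral_axis_le b (c t : R) :
  (\int[mu]_(x in `[0%R, 1%R]) ball_volume d (t - axis_sqr b (x - c))%R <=
   ball_volume d.+1 t)%E.
Proof.
pose g (x : R) := ball_volume d (t - (x - c) ^+ 2)%R.
have g0 x : (0 <= g x)%E by exact: ball_volume_ge0.
have mg : measurable_fun setT g := measurable_ball_volume_axis Euclidean c t.
have gE : (\int[mu]_x g x = ball_volume d.+1 t)%E.
  rewrite (ge0_integral_affine c ltr01)// mul1e; apply: eq_integral => x _.
  by rewrite /g mul1r addrAC subrr add0r.
rewrite -gE; case: b; last first.
  by apply: ge0_subset_integral => //; first [exact: mg|move=> x _; exact: g0].
rewrite -integral_itv_bndo_bndc; last first.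
  by apply: measurable_funTS; exact: measurable_ball_volume_axis.
pose h (k : R) (x : R) : \bar R := (g (x + k)%R * (\1_(`[0%R, 1%R[ : set R) x)%:E)%E.
have mgk k : measurable_fun setT (fun x : R => g (x + k)).
  by apply: (measurableT_comp mg); exact: measurable_funD.
have mh k : measurable_fun setT (h k).
  by apply: emeasurable_funM => //; apply/measurable_EFinP; exact: measurable_indic.
have h0 k x : (0 <= h k x)%E by rewrite mule_ge0// lee_fin.
have hE k : (\int[mu]_x h k x =
    \int[mu]_x (g x * (\1_(`[0%R, 1%R[ : set R) (x - k))%:E))%E.
  rewrite (ge0_integral_affine (- k) ltr01)// mul1e; apply: eq_integral => x _.
  by rewrite /h mul1r addrAC addNr add0r addrC.
apply: (@le_trans _ _ (\int[mu]_x (h 0%R x + (h (-1)%R x + h 1%R x)))%E).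
  rewrite integral_mkcond; apply: ge0_le_integral => //.
  - by move=> x _; rewrite erestrict_ge0// => y _; exact: ball_volume_ge0.
  - apply/(measurable_restrictT _ _).1 => //.
    by apply: measurable_funTS; exact: measurable_ball_volume_axis.
  - by apply: emeasurable_funD; [exact: mh|apply: emeasurable_funD; exact: mh].
  - move=> x _; rewrite patchE /h indicE; case: ifPn => _; last first.
      by rewrite !mule0 !adde0.
    rewrite !mule1 /g addr0 [(x + -1 - c)%R]addrAC [(x + 1 - c)%R]addrAC.
    exact: ball_volume_axis_le.
have D3 (f1 f2 f3 : R -> \bar R) :
    measurable_fun setT f1 -> measurable_fun setT f2 -> measurable_fun setT f3 ->
    (forall x, 0 <= f1 x)%E -> (forall x, 0 <= f2 x)%E -> (forall x, 0 <= f3 x)%E ->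
    (\int[mu]_x (f1 x + (f2 x + f3 x)) =
     \int[mu]_x f1 x + (\int[mu]_x f2 x + \int[mu]_x f3 x))%E.
  move=> m1 m2 m3 p1 p2 p3.
  apply: etrans (ge0_integralD _ _ _ _ _ _) _ => //.
  - by move=> x _; exact: adde_ge0.
  - exact: emeasurable_funD.
  - congr (_ + _)%E; exact: ge0_integralD.
have mgi k : measurable_fun setT
    (fun x : R => (g x * (\1_(`[0%R, 1%R[ : set R) (x - k))%:E)%E).
  apply: emeasurable_funM => //; apply/measurable_EFinP.
  by apply: (measurableT_comp (measurable_indic _)) => //; exact: measurable_funB.
have gi0 k x : (0 <= g x * (\1_(`[0%R, 1%R[ : set R) (x - k))%:E)%E.
  by rewrite mule_ge0// lee_fin.
rewrite D3// !hE -D3//.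
apply: ge0_le_integral => //.
- by move=> x _; rewrite !adde_ge0.
- by apply: emeasurable_funD; [exact: mgi|apply: emeasurable_funD; exact: mgi].
move=> x _; rewrite -ge0_muleDr ?lee_fin// -ge0_muleDr ?lee_fin ?addr_ge0//.
rewrite -!EFinD -[leRHS]mule1 lee_wpmul2l// lee_fin !indicE !mem_setE !in_itv/=.
have [x0|x0] := leP 0 (x - 0); have [x1|x1] := ltP (x - 0) 1;
have [y0|y0] := leP 0 (x - -1); have [y1|y1] := ltP (x - -1) 1;
have [z0|z0] := leP 0 (x - 1); have [z1|z1] := ltP (x - 1) 1 => //=; lra.
Qed.

(** The slices vanish at distance [h] or more from [c], hence nothing is lost outside [[0, 1]]. *)
Lemma integral_axis_interior (h c t : R) : h <= c <= 1 - h -> t <= h ^+ 2 -> 0 <= h ->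
  (\int[mu]_(x in `[0%R, 1%R]) ball_volume d (t - (x - c) ^+ 2)%R =
   ball_volume d.+1 t)%E.
Proof.
move=> /andP[hc ch] th h0.
rewrite /= [RHS](ge0_integral_affine (- c) ltr01) ?mul1e//; last 2 first.
- exact: measurable_ball_volumeB.
- by move=> x; exact: ball_volume_ge0.
rewrite integral_mkcond; apply: eq_integral => x _.
rewrite patchE mul1r [- c + x]addrC; case: ifPn => //; rewrite notin_setE /= in_itv/= => xN.
rewrite ball_volume_le0// subr_le0 (le_trans th)//.
have [x0|x0] := ltP x 0; first by rewrite -[leRHS]sqrrN ler_sqr ?nnegrE; lra.
have [x1|x1] := ltP 1 x; first by rewrite ler_sqr ?nnegrE; lra.
by exfalso; apply: xN; rewrite x0 x1.
Qed.

End axis_integral.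

Section pair_overlap.
Context (R : realType) (d : nat) (rbar : R).
Local Notation spheres := (config R (nat * option 'I_d)%type).
Local Notation mu := (@lebesgue_measure R).
Implicit Types (b : boundary) (r x t : R).
Context (rho : probability R R) (Q : probability spheres R).
Hypothesis Qrho : product_law (fun k => sphere_marginal rho k.2) Q.

Lemma integral_coord_uniform n i (f : R -> \bar R) :
  measurable_fun setT f -> (forall x, 0 <= f x)%E ->
  (\int[Q]_w f (w (n, Some i)) = \int[mu]_(x in `[0%R, 1%R]) f x)%E.
Proof.
move=> mf f0.
have mc : measurable_fun setT (fun w : spheres => w (n, Some i) : measurableTypeR R).
  exact: measurable_coord.
transitivity (\int[pushforward Q (fun w : spheres => w (n, Some i) : measurableTypeR R)]_x f x)%E.
  by rewrite (ge0_integral_pushforward mc).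
transitivity (\int[uniform_prob (@ltr01 R)]_x f x)%E.
  apply: eq_measure_integral => A mA _.
  exact: (pr_coord Qrho (n, Some i)).
by rewrite integral_uniform// subr0 invr1 mul1e.
Qed.

(** A squared distance restricted to the axes in [l]; the list permits induction on axes, each
    matching one slicing integral of [ball_volume]. *)
Definition offset b n (c : 'I_d -> R) (l : seq 'I_d) (w : spheres) : R :=
  \sum_(i <- l) axis_sqr b (w (n, Some i) - c i).

Lemma measurable_offset b n c l : measurable_fun setT (offset b n c l).
Proof.
apply: measurable_sum => i; apply: (measurableT_comp (measurable_axis_sqr b)).
by apply: measurable_funB => //; exact: measurable_coord.
Qed.

Lemma measurable_offset_lt b n c l t : measurable [set w | offset b n c l w < t].
Proof. by apply: measurable_set_ltr => //; exact: measurable_offset. Qed.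

Lemma measurable_pr_offset b n c l :
  measurable_fun setT (fun t => (pr Q [set w | offset b n c l w < t])%:E).
Proof.
apply/measurable_EFinP; apply: nondecreasing_measurable => // t u tu.
by apply: le_pr; try exact: measurable_offset_lt; move=> w /= /lt_le_trans; apply.
Qed.

Lemma pr_offset_cons b n c i l t : i \notin l ->
  ((pr Q [set w | offset b n c (i :: l) w < t])%:E =
   \int[mu]_(x in `[0%R, 1%R])
     (pr Q [set w | offset b n c l w < t - axis_sqr b (x - c i)])%:E)%E.
Proof.
move=> il; rewrite (pr_mix Qrho (pred1 (n, Some i))); last exact: measurable_offset_lt.
rewrite -(integral_coord_uniform n i (f := fun x => (pr Q [set w | offset b n c l w < t -
  axis_sqr b (x - c i)])%:E)) //.
- apply: eq_integral => w _; rewrite -prE; last exact: measurable_offset_lt.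
  congr (Q _); apply/seteqP.
  have E w' : offset b n c (i :: l) (mix (pred1 (n, Some i)) w w') =
      axis_sqr b (w (n, Some i) - c i) + offset b n c l w'.
    rewrite /offset big_cons /mix /= eqxx; congr (_ + _).
    rewrite !big_seq; apply: eq_bigr => j jl; rewrite xpair_eqE eqxx /=.
    by rewrite ifF//; apply/negbTE; apply: contra il => /eqP [<-].
  by split=> w' /=; rewrite E ltrBrDl.
- apply: (measurableT_comp (measurable_pr_offset b n c l)).
  apply: measurable_funB => //; apply: (measurableT_comp (measurable_axis_sqr b)).
  exact: measurable_funB.
- by move=> x; rewrite lee_fin pr_ge0.
Qed.

Lemma pr_offset_le b n (c : 'I_d -> R) l t : uniq l ->
  ((pr Q [set w | offset b n c l w < t])%:E <= ball_volume (size l) t)%E.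
Proof.
elim: l t => [|i l IHl] t /= => [_|/andP[il ul]].
  have [t0|t0] := ltP 0 t; first by rewrite lee_fin pr_le1//; exact: measurable_offset_lt.
  rewrite (_ : mkset _ = set0) ?/pr ?measure0//.
  by apply/seteqP; split=> // w; rewrite /= /offset big_nil ltNge t0.
rewrite pr_offset_cons//; apply: le_trans (integral_axis_le _ b (c i) t).
apply: ge0_le_integral => //.
- by move=> x _; rewrite lee_fin pr_ge0.
- apply: measurable_funTS; apply: (measurableT_comp (measurable_pr_offset b n c l)).
  apply: measurable_funB => //; apply: (measurableT_comp (measurable_axis_sqr b)).
  exact: measurable_funB.
- by apply: measurable_funTS; exact: measurable_ball_volume_axis.
- by move=> x _; exact: IHl.
Qed.

Lemma pr_offset_interior n (h : R) (c : 'I_d -> R) l t : uniq l -> 0 <= h ->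
  t <= h ^+ 2 -> (forall i, h <= c i <= 1 - h) ->
  (pr Q [set w | offset Euclidean n c l w < t])%:E = ball_volume (size l) t.
Proof.
move=> + h0 + ch; elim: l t => [|i l IHl] t /= => [_ th|/andP[il ul] th].
  rewrite (_ : mkset _ = if 0 < t then setT else set0); last first.
    by apply/seteqP; split=> w; rewrite /= /offset big_nil; case: ifP.
  by case: ifP => _; rewrite ?prT// /pr measure0.
rewrite pr_offset_cons//; apply: etrans _ (integral_axis_interior _ (ch i) th h0).
apply: eq_integral => x _; rewrite IHl//.
by rewrite (le_trans _ th)// gerBl sqr_ge0.
Qed.

(* The cut-off changes nothing almost surely and makes the function bounded. *)
Definition pair_size (z : R * R) : R :=
  if (0 < z.1 <= rbar) && (0 < z.2 <= rbar) then (z.1 + z.2) ^+ d else 0.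

Lemma pair_size_ge0 z : 0 <= pair_size z.
Proof.
rewrite /pair_size; case: ifP => // /andP[/andP[x0 _] /andP[y0 _]].
by rewrite exprn_ge0// addr_ge0// ltW.
Qed.

Lemma measurable_pair_size : measurable_fun setT pair_size.
Proof.
apply: measurable_fun_ifT => //=.
  by apply: measurable_and; apply: measurable_and;
    first [exact: measurable_fun_ltr|exact: measurable_fun_ler].
by apply: measurable_funX; exact: measurable_funD.
Qed.

Definition mean_pair_size : \bar R := \int[(rho \x rho)%E]_z (pair_size z)%:E.

Lemma mean_pair_size_ge0 : (0 <= mean_pair_size)%E.
Proof. by apply: integral_ge0 => z _; rewrite lee_fin pair_size_ge0. Qed.

Lemma integral_radii m n : m != n ->
  (\int[Q]_w (pair_size (w (m, None), w (n, None)))%:E = mean_pair_size)%E.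
Proof.
move=> mn.
pose f (w : spheres) : R * R := (w (m, None), w (n, None)).
have mf : measurable_fun setT f.
  by apply: measurable_fun_pair; exact: measurable_coord.
have mg : measurable_fun setT (fun z => (pair_size z)%:E).
  by apply/measurable_EFinP; exact: measurable_pair_size.
transitivity (\int[pushforward Q f]_z (pair_size z)%:E)%E.
  rewrite (ge0_integral_pushforward mf)//.
  by move=> z _; rewrite lee_fin pair_size_ge0.
apply/esym; apply: eq_measure_integral => A mA _.
apply: (product_measure_unique (m' := image_measure Q mf)) => // B C mB mC.
rewrite /= /pushforward (_ : f @^-1` (B `*` C) = cylinder [fset (m, None); (n, None)]%fset
   (fun k : nat * option 'I_d => if k.1 == m then B else C)); last first.
  apply/seteqP; split=> w /=.
    by move=> [Bw Cw] k; rewrite !inE => /orP[] /eqP -> /=; rewrite ?eqxx// eq_sym (negbTE mn).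
  move=> h; have := h (m, None); rewrite !inE !eqxx /= => /(_ isT) Bw; split=> //.
  by have := h (n, None); rewrite !inE eqxx orbT /= eq_sym (negbTE mn) => /(_ isT).
apply: etrans (Qrho _ _) _; first by move=> k; case: ifP.
rewrite big_fsetU1/=; last by rewrite inE xpair_eqE (negbTE mn).
by rewrite big_seq_fset1 /= eqxx eq_sym (negbTE mn).
Qed.

End pair_overlap.

Section exclusion.
Context (R : realType) (d : nat) (rbar : R).
Local Notation idx := (nat * option 'I_d)%type.
Local Notation spheres := (config R (nat * option 'I_d)%type).
Implicit Types (b : boundary) (r x t : R).
Context (rho : probability R R) (Q : probability spheres R).
Hypothesis Qrho : product_law (fun k => sphere_marginal rho k.2) Q.
Hypothesis rho_pos : rho `]0, rbar]%classic = 1%E.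
Local Notation gamma := (unit_ball_volume R d).
Local Notation M1 := (mean_pair_size d rbar rho).

Lemma ltr_sqrtl (a u : R) : 0 < u -> (Num.sqrt a < u) = (a < u ^+ 2).
Proof.
move=> u0; rewrite -{1}[u]ger0_norm ?ltW// -sqrtr_sqr ltr_sqrt// exprn_gt0//.
Qed.

Lemma size_index_ord : size (index_enum 'I_d) = d.
Proof. by rewrite -sum1_size sum1_card card_ord. Qed.

Lemma unit_ball_volume_ge0 : 0 <= gamma.
Proof. by rewrite -lee_fin -ball_volume1 ball_volume_ge0. Qed.

Lemma ball_volume_radius u : 0 < u -> ball_volume d (u ^+ 2) = (gamma * u ^+ d)%:E.
Proof. by move=> u0; rewrite ball_volume_sqr// ball_volume1 -EFinM mulrC. Qed.

Definition radius_ok (u : R) := 0 < u <= rbar.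

Lemma measurable_radius_ok n : measurable [set w : spheres | radius_ok (w (n, None))].
Proof.
rewrite (_ : mkset _ = (fun w : spheres => w (n, None)) @^-1` `]0, rbar]).
  by rewrite -[X in measurable X]setTI; exact: measurable_coord.
by apply/seteqP; split=> w; rewrite /= in_itv.
Qed.

(** Overlap of spheres [j] and [m] with the centre of [j] frozen at [c]: the two radii and the
    centre of [m] stay random. *)
Definition capture b r j m (c : 'I_d -> R) : set spheres :=
  [set w | Num.sqrt (\sum_(i < d) axis_sqr b (c i - w (m, Some i))) <
           r * (w (j, None) + w (m, None))].

Lemma measurable_capture b r j m c : measurable (capture b r j m c).
Proof.
apply: measurable_set_ltr; last first.
  by apply: measurable_funM => //; apply: measurable_funD; exact: measurable_coord.
apply: (measurableT_comp (continuous_measurable_fun (@sqrt_continuous R))).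
apply: measurable_sum => i; apply: (measurableT_comp (measurable_axis_sqr b)).
by apply: measurable_funB => //; exact: measurable_coord.
Qed.

Lemma captureE b r j m c w :
  0 < r * (w (j, None) + w (m, None)) ->
  capture b r j m c w <->
  offset b m c (index_enum 'I_d) w < (r * (w (j, None) + w (m, None))) ^+ 2.
Proof.
move=> u0; rewrite /capture /= ltr_sqrtl// /offset.
by under eq_bigr do rewrite -axis_sqrN opprB.
Qed.

Let is_radius : pred idx := fun k => k.2 == None.

(** Given the radii, the centre of [m] must hit a ball of volume [gamma * (r * (R_j + R_m)) ^+ d],
    whatever [c] is; averaging over the radii gives [M1]. *)
Lemma pr_capture_le b r j m c : 0 < r -> j != m ->
  ((pr Q (capture b r j m c))%:E <= (gamma * r ^+ d)%:E * M1)%E.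
Proof.
move=> r0 jm.
pose B := capture b r j m c `&` ([set w | radius_ok (w (j, None))] `&`
  [set w | radius_ok (w (m, None))]).
have mB : measurable B.
  apply: measurableI; first exact: measurable_capture.
  by apply: measurableI; exact: measurable_radius_ok.
have -> : pr Q (capture b r j m c) = pr Q B.
  apply: (eq_pr_cube Qrho rho_pos (s := [:: j; m])) => //; first exact: measurable_capture.
  move=> w wc; have [_ Sj] := wc j (mem_head _ _).
  have [|_ Sm] := wc m; first by rewrite !inE eqxx orbT.
  by split=> [|[]].
rewrite (pr_mix Qrho is_radius)//.
apply: (@le_trans _ _ (\int[Q]_w ((gamma * r ^+ d)%:E *
    (pair_size d rbar (w (j, None), w (m, None)))%:E))%E); last first.
  have mp : measurable_fun setT
     (fun w : spheres => (pair_size d rbar (w (j, None), w (m, None)))%:E).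
    apply/measurable_EFinP; apply: (measurableT_comp (measurable_pair_size d rbar)).
    by apply: measurable_fun_pair; exact: measurable_coord.
  rewrite ge0_integralZl//.
  - by rewrite (integral_radii rbar Qrho).
  - by move=> w _; rewrite lee_fin pair_size_ge0.
  - by rewrite lee_fin mulr_ge0 ?unit_ball_volume_ge0// exprn_ge0// ltW.
have mq := measurable_pr_mix Q is_radius mB.
apply: ge0_le_integral => //.
- apply/measurable_EFinP; apply: measurable_funM => //.
  apply: (measurableT_comp (measurable_pair_size d rbar)).
  by apply: measurable_fun_pair; exact: measurable_coord.
move=> w _; rewrite /pair_size /=.
case: ifPn => [/andP[/andP[Sj0 Sj1] /andP[Sm0 Sm1]]|Snok]; last first.
  rewrite mule0 (_ : mkset _ = set0) ?measure0//.
  apply/seteqP; split=> // w' [_ []]; rewrite /= /mix /= /radius_ok => h1 h2.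
  by move: Snok; rewrite h1 h2.
have u0 : 0 < r * (w (j, None) + w (m, None)) by rewrite mulr_gt0// addr_gt0.
rewrite -EFinM -mulrA -exprMn -ball_volume_radius//.
have := pr_offset_le Qrho b m c ((r * (w (j, None) + w (m, None))) ^+ 2) (index_enum_uniq 'I_d).
rewrite size_index_ord; apply: le_trans.
rewrite -prE; last exact: measurable_offset_lt.
apply: le_measure; rewrite ?inE; last 2 first.
- exact: measurable_offset_lt.
- move=> w' [/captureE]; rewrite /mix /= => /(_ u0).
  by [].
- exact: measurable_set_mix.
Qed.

End exclusion.

(** * Excluded volume and adding one sphere *)

Section exclusion_bounds.
Context (R : realType) (d : nat) (rbar : R).
Local Notation idx := (nat * option 'I_d)%type.
Local Notation spheres := (config R (nat * option 'I_d)%type).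
Implicit Types (b : boundary) (r x t : R).
Context (rho : probability R R) (Q : probability spheres R).
Hypothesis Qrho : product_law (fun k => sphere_marginal rho k.2) Q.
Hypothesis rho_pos : rho `]0, rbar]%classic = 1%E.
Local Notation gamma := (unit_ball_volume R d).
Local Notation M1 := (mean_pair_size d rbar rho).
Local Notation packing_prob := (packing_prob Q).

Definition pair_meet b r m n : set spheres :=
  [set w | spheres_meet b r (sphere_at w m) (sphere_at w n)].

Lemma measurable_pair_meet b r m n : measurable (pair_meet b r m n).
Proof. by apply: measurable_spheres_meet; exact: measurable_sphere_at. Qed.

(** If the first centre is at distance at least [h = 2 * rbar * r] from every face, the ball
    forbidden to the second centre lies inside the cube. The first centre does so with probability
    [(1 - 2 * h) ^+ d]. *)
Lemma pr_pair_meet_ge r : 0 < r -> 2 * (2 * rbar * r) < 1 -> 0 < rbar ->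
  ((gamma * r ^+ d * (1 - 2 * (2 * rbar * r)) ^+ d)%:E * M1 <=
   (pr Q (pair_meet Euclidean r 0 1))%:E)%E.
Proof.
set h := 2 * rbar * r => r0 h1 rbar0.
have h0 : 0 < h by rewrite /h !mulr_gt0.
have s0 : 0 < 1 - 2 * h by rewrite subr_gt0.
have grd0 : 0 <= gamma * r ^+ d by rewrite mulr_ge0 ?unit_ball_volume_ge0// exprn_ge0// ltW.
pose C := [set w : spheres | box (fun=> h) (1 - 2 * h) (sphere_at w 0)].
have mC : measurable C.
  rewrite -[X in measurable X]setTI; apply: measurable_sphere_at => //.
  exact: measurable_box.
pose B := C `&` ([set w | radius_ok rbar (w (0%N, None))] `&`
  [set w | radius_ok rbar (w (1%N, None))]) `&` pair_meet Euclidean r 0 1.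
have mB : measurable B.
  apply: measurableI; last exact: measurable_pair_meet.
  apply: measurableI => //; apply: measurableI; exact: measurable_radius_ok.
apply: (@le_trans _ _ (pr Q B)%:E); last first.
  by rewrite lee_fin le_pr//; [exact: measurable_pair_meet|move=> w []].
pose f (w : spheres) : \bar R :=
  ((\1_C w)%:E * ((gamma * r ^+ d)%:E * (pair_size d rbar (w (0%N, None), w (1%N, None)))%:E))%E.
have mp : measurable_fun setT
   (fun w : spheres => (pair_size d rbar (w (0%N, None), w (1%N, None)))%:E).
  apply/measurable_EFinP; apply: (measurableT_comp (measurable_pair_size d rbar)).
  by apply: measurable_fun_pair; exact: measurable_coord.
have p0 (w : spheres) : (0 <= (pair_size d rbar (w (0%N, None), w (1%N, None)))%:E)%E.
  by rewrite lee_fin pair_size_ge0.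
have mf : measurable_fun setT f.
  apply: emeasurable_funM; first by apply/measurable_EFinP; exact: measurable_indic.
  by apply: emeasurable_funM.
have f0 w : (0 <= f w)%E.
  apply: mule_ge0; first by rewrite lee_fin.
  by apply: mule_ge0; [rewrite lee_fin|exact: p0].
(* Everything but the centre of sphere 1 is frozen. *)
rewrite (pr_mix Qrho (fun k => ~~ ((k.1 == 1%N) && (k.2 != None))))//.
rewrite (eq_integral f); last first.
  move=> w _; rewrite /f /pair_size /= indicE.
  set J := (X in mix X).
  have EC w' : C (mix J w w') <-> C w by split.
  have EB w' : B (mix J w w') <-> C w /\ (radius_ok rbar (w (0%N, None)) /\
      radius_ok rbar (w (1%N, None))) /\
      offset Euclidean 1 (fun i => w (0%N, Some i)) (index_enum 'I_d) w' <
      (r * (w (0%N, None) + w (1%N, None))) ^+ 2.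
    have Emeet : radius_ok rbar (w (0%N, None)) -> radius_ok rbar (w (1%N, None)) ->
        pair_meet Euclidean r 0 1 (mix J w w') <->
        offset Euclidean 1 (fun i => w (0%N, Some i)) (index_enum 'I_d) w' <
        (r * (w (0%N, None) + w (1%N, None))) ^+ 2.
      move=> /andP[S0 _] /andP[S1 _].
      rewrite /pair_meet /= /spheres_meet /gap /sphere_at /mix /=.
      rewrite ltr_sqrtl; last by rewrite mulr_gt0// addr_gt0.
      rewrite /offset (eq_bigr (fun i => axis_sqr Euclidean (w' (1%N, Some i) - w (0%N, Some
        i))))//.
      by move=> i _; rewrite -axis_sqrN opprB.
    split=> [[[Cw [S0 S1]] meet]|[Cw [[S0 S1] meet]]].
      by split; [exact/EC|split; [split|exact/Emeet]].
    by split; [split; [exact/EC|split]|exact/Emeet].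
  have [Cw|Cw] := pselect (C w); last first.
    rewrite memNset// mul0e -[RHS](measure0 Q); congr (Q _).
    by apply/seteqP; split=> // w' /EB[].
  rewrite mem_set// mul1e; case: ifPn => [/andP[Sok0 Sok1]|Snok]; last first.
    rewrite mule0 -[RHS](measure0 Q); congr (Q _).
    apply/seteqP; split=> // w' /EB[_ [[h2 h3] _]].
    by move: Snok; rewrite /radius_ok in h2 h3; rewrite h2 h3.
  have /andP[S00 S01] := Sok0; have /andP[S10 S11] := Sok1.
  have u0 : 0 < r * (w (0%N, None) + w (1%N, None)) by rewrite mulr_gt0// addr_gt0.
  rewrite -EFinM -mulrA -exprMn -ball_volume_radius//.
  have := pr_offset_interior Qrho 1 (h := h) (c := fun i => w (0%N, Some i))
    (t := (r * (w (0%N, None) + w (1%N, None))) ^+ 2) (index_enum_uniq 'I_d) (ltW h0).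
  rewrite size_index_ord => <-.
  - rewrite -prE; last exact: measurable_offset_lt.
    by congr (Q _); apply/seteqP; split=> w' /=; [move/EB => [_ []]|move=> ?; apply/EB].
  - rewrite ler_sqr ?nnegrE ?(ltW u0) ?(ltW h0)// /h; nra.
  - by move=> i; have := Cw i; rewrite /sphere_at; lra.
(* Freezing the radii separates the position of sphere 0 from the sizes of the pair, so the two
   means multiply. *)
rewrite (integral_mix Qrho (fun k => k.2 == None))//.
rewrite (eq_integral (fun w : spheres => ((gamma * r ^+ d)%:E *
   (pair_size d rbar (w (0%N, None), w (1%N, None)))%:E * (pr Q C)%:E)%E)); last first.
  move=> w _; rewrite /f.
  transitivity (\int[Q]_w' ((gamma * r ^+ d)%:E *
     (pair_size d rbar (w (0%N, None), w (1%N, None)))%:E * (\1_C w')%:E))%E.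
    by apply: eq_integral => w' _; rewrite muleC; congr (_ * (_)%:E)%E.
  rewrite ge0_integralZl//.
  - rewrite integral_indic// setIT; congr (_ * _)%E; exact: prE.
  - by apply/measurable_EFinP; exact: measurable_indic.
  - by apply: mule_ge0; [rewrite lee_fin|exact: p0].
rewrite ge0_integralZr//; last 3 first.
- exact: emeasurable_funM.
- by move=> w _; apply: mule_ge0; [rewrite lee_fin|exact: p0].
- by rewrite lee_fin pr_ge0.
rewrite ge0_integralZl// (integral_radii rbar Qrho)// muleAC -EFinM.
have -> // : pr Q C = (1 - 2 * h) ^+ d.
have := point_prob_boxI Qrho (c := fun=> h) s0 _ _ measurableT.
rewrite setIT /point_prob prT mulr1; apply.
- by move=> _; exact: ltW.
- by move=> _; lra.
Qed.

(** Harris' inequality for one coordinate: the hypotheses force both events to depend on [w k]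
    alone. If they meet at some [w0], then [D] holds below [w0 k] and [U] above, so they cover the
    space and the claim is (1 - pr D) (1 - pr U) >= 0. Otherwise the intersection is empty. *)
Lemma pr_down_up k (D U : set spheres) : measurable D -> measurable U ->
  (forall w1 w2 : spheres, w1 k <= w2 k -> D w2 -> D w1) ->
  (forall w1 w2 : spheres, w1 k <= w2 k -> U w1 -> U w2) ->
  pr Q (D `&` U) <= pr Q D * pr Q U.
Proof.
move=> mD mU down up; have [[w0 [Dw0 Uw0]]|nDU] := pselect (exists w0, D w0 /\ U w0).
  have DUT : D `|` U = setT.
    apply/seteqP; split=> // w _; have [ww0|/ltW w0w] := leP (w k) (w0 k).
      by left; exact: down Dw0.
    by right; exact: up Uw0.
  have e1 : pr Q D = pr Q (D `\` U) + pr Q (D `&` U) by exact: pr_setDI.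
  have DUC : D `\` U = ~` U.
    apply/seteqP; split=> w /=; first by move=> [].
    move=> Uw; split=> //; have : (D `|` U) w by rewrite DUT.
    by case.
  have e2 := prC Q mU.
  have D1 := pr_le1 Q mD; have U1 := pr_le1 Q mU.
  move: e1; rewrite DUC e2 => e1; nra.
rewrite (_ : D `&` U = set0) ?/pr ?measure0 ?mulr_ge0 ?pr_ge0//.
by apply/seteqP; split=> // w h; apply: nDU; exists w.
Qed.

Lemma radius_bound_gt0 : 0 < rbar.
Proof.
rewrite ltNge; apply/negP => rb; have := rho_pos.
rewrite set_itv_ge ?bnd_simp -?leNgt// measure0 => /eqP.
by rewrite eqe eq_sym oner_eq0.
Qed.

Lemma mean_pair_size_lty : (M1 < +oo)%E.
Proof.
have rb := radius_bound_gt0.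
apply: (@le_lt_trans _ _ (\int[(rho \x rho)%E]_z cst ((2 * rbar) ^+ d)%:E z)%E).
  apply: ge0_le_integral => //.
  - by move=> z _; rewrite lee_fin pair_size_ge0.
  - by apply/measurable_EFinP; exact: measurable_pair_size.
  - move=> z _; rewrite lee_fin /pair_size.
    case: ifPn => [/andP[/andP[x0 x1] /andP[y0 y1]]|_].
      by apply: lerXn2r; rewrite ?nnegrE; lra.
    by rewrite exprn_ge0// mulr_ge0// ltW.
rewrite integral_cst//; apply: lte_mul_pinfty => //.
  by rewrite lee_fin exprn_ge0// mulr_ge0// ltW.
have e : ((rho \x rho) setT = 1)%E.
  have := product_measure1E rho rho measurableT measurableT.
  rewrite setXTT => e; apply: etrans e _.
  exact: etrans (congr2 mule (probability_setT rho) (probability_setT rho)) (mule1 1%E).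
by apply: (@le_lt_trans _ _ 1%E); [rewrite -e|exact: ltry].
Qed.

Definition excluded r : R := gamma * r ^+ d * fine M1.

Lemma excluded_ge0 r : 0 <= r -> 0 <= excluded r.
Proof.
move=> r0; apply: mulr_ge0.
  by apply: mulr_ge0; [exact: unit_ball_volume_ge0|exact: exprn_ge0].
by apply: fine_ge0; exact: mean_pair_size_ge0.
Qed.

(* Given everything but the radius of sphere [i], [packing] is a decreasing and
   [pair_meet] an increasing event of that radius: they are negatively correlated. *)
Lemma pr_packing_meet_le r m i : 0 < r -> (i < m)%N ->
  pr Q (packing Torus r setT (iota 0 m) `&` pair_meet Torus r i m) <=
  packing_prob Torus r m * excluded r.
Proof.
move=> r0 im.
set D := packing _ _ _ _; set U := pair_meet _ _ _ _.
have mD : measurable D by exact: measurable_packing.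
have mU : measurable U by exact: measurable_pair_meet.
(* [mix J] resamples only the radius of sphere [i], and [mix J2] only the spheres from [m] on. [al]
   and [ep] are the conditional probabilities of [D] and [U] given all but that radius. *)
pose J : pred idx := fun k => k != (i, None).
pose J2 : pred idx := fun k => (k.1 < m)%N.
pose al w := Q [set w' | D (mix J w w')].
pose ep w := Q [set w' | U (mix J w w')].
have mal : measurable_fun setT al by exact: measurable_pr_mix.
have mep : measurable_fun setT ep by exact: measurable_pr_mix.
have al0 w : (0 <= al w)%E by exact: measure_ge0.
have ep0 w : (0 <= ep w)%E by exact: measure_ge0.
have mixE w w' n o : mix J w w' (n, o) = if (n, o) == (i, None) then w' (i, None) else w (n, o).
  by rewrite /mix /J; case: eqP => [[-> ->]|].
have rad_le w w1 w2 n : w1 (i, None) <= w2 (i, None) ->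
    mix J w w1 (n, None) <= mix J w w2 (n, None).
  by move=> w12; rewrite !mixE; case: ifP.
have ctrE w w1 n l : mix J w w1 (n, Some l) = w (n, Some l).
  by rewrite mixE; case: eqP => // -[].
have gapE w w1 n n' : gap Torus (sphere_at (mix J w w1) n) (sphere_at (mix J w w1) n') =
    gap Torus (sphere_at w n) (sphere_at w n').
  by rewrite /gap /sphere_at; under eq_bigr do rewrite !ctrE.
have meet_mono w w1 w2 n n' : w1 (i, None) <= w2 (i, None) ->
    spheres_meet Torus r (sphere_at (mix J w w1) n) (sphere_at (mix J w w1) n') ->
    spheres_meet Torus r (sphere_at (mix J w w2) n) (sphere_at (mix J w w2) n').
  move=> w12; rewrite /spheres_meet !gapE => /lt_le_trans; apply.
  by rewrite ler_pM2l// lerD// /sphere_at rad_le.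
have step w : (Q [set w' | (D `&` U) (mix J w w')] <= al w * ep w)%E.
  have mDw := measurable_set_mix J w mD; have mUw := measurable_set_mix J w mU.
  rewrite /al /ep [X in (X * _)%E]prE// [X in (_ * X)%E]prE// prE; last first.
    exact: measurableI mDw mUw.
  rewrite -EFinM lee_fin; apply: (@pr_down_up (i, None)) => //.
    move=> w1 w2 w12 [h1 h2]; split=> // n n' nm n'm nn'.
    apply: contra (h2 n n' nm n'm nn'); exact: meet_mono.
  by move=> w1 w2 w12; exact: meet_mono.
have ep_mean w : (\int[Q]_w2 ep (mix J2 w w2) <= (excluded r)%:E)%E.
  have -> : (\int[Q]_w2 ep (mix J2 w w2) =
      (pr Q (capture Torus r i m (fun l => w (i, Some l))))%:E)%E.
    rewrite (pr_mix Qrho J); last exact: measurable_capture.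
    apply: eq_integral => w2 _; congr (Q _); apply/funext => w'.
    have J2i l : mix J2 w w2 (i, Some l) = w (i, Some l) by rewrite /mix /J2 /= im.
    have J2m o : mix J2 w w2 (m, o) = w2 (m, o) by rewrite /mix /J2 /= ltnn.
    have mi o : ((m, o) == (i, None :> option 'I_d)) = false.
      by rewrite xpair_eqE (gtn_eqF im).
    rewrite /U /pair_meet /capture /= /spheres_meet /gap /sphere_at.
    rewrite !mixE eqxx !mi J2m; congr (is_true (Num.sqrt _ < _)).
    by apply: eq_bigr => l _; rewrite !ctrE J2i J2m.
  apply: le_trans (pr_capture_le Qrho rho_pos _ _ _ _) _ => //.
    by rewrite ltn_eqF.
  by rewrite /excluded [leRHS]EFinM fineK// ge0_fin_numE ?mean_pair_size_ge0 ?mean_pair_size_lty.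
rewrite -lee_fin (pr_mix Qrho J); last exact: measurableI.
apply: (@le_trans _ _ (\int[Q]_w (al w * ep w))%E).
  apply: ge0_le_integral => //.
  - by apply: measurable_pr_mix; exact: measurableI.
  - exact: emeasurable_funM.
rewrite (integral_mix Qrho J2); last 2 first.
- exact: emeasurable_funM.
- by move=> w; exact: mule_ge0.
(* The first [m] spheres do not involve sphere [m], so [al] leaves the average over that sphere. *)
have alJ2 w w2 : al (mix J2 w w2) = al w.
  have E w' : D (mix J (mix J2 w w2) w') <-> D (mix J w w').
    have E2 n : n \in iota 0 m -> sphere_at (mix J (mix J2 w w2) w') n = sphere_at (mix J w w') n.
      rewrite mem_iota add0n => /andP[_ nm].
      by apply/funext => o; rewrite /sphere_at !mixE /mix /J2 /= nm.
    by split=> -[_ h]; split=> // n n' nm n'm nn'; have := h n n' nm n'm nn'; rewrite !E2.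
  by congr (Q _); apply/seteqP; split=> w' /= /E.
apply: (@le_trans _ _ (\int[Q]_w (al w * (excluded r)%:E))%E).
  apply: ge0_le_integral => //.
  - move=> w _; apply: integral_ge0 => w2 _; exact: mule_ge0.
  - have mF : measurable_fun setT (fun z : spheres * spheres => (al (mix J2 z.1 z.2) * ep (mix J2
    z.1 z.2))%E).
      by apply: emeasurable_funM; apply: (measurableT_comp _ (measurable_mix J2)).
    apply: (measurable_fun_fubini_tonelli_F (m2 := Q) _ mF) => z.
    exact: mule_ge0.
  - by apply: emeasurable_funM.
  - move=> w _; under eq_integral do rewrite alJ2.
    rewrite ge0_integralZl//.
      by apply: lee_wpmul2l.
    exact: (measurableT_comp mep (measurable_mixr J2 w)).
rewrite ge0_integralZr//; last by rewrite lee_fin excluded_ge0// ltW.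
have -> : (\int[Q]_w al w = (packing_prob Torus r m)%:E)%E by rewrite [RHS](pr_mix Qrho J).
by rewrite -EFinM lexx.
Qed.

(** Union bound over the earlier sphere that the new one overlaps. *)
Lemma packing_prob_TorusS r m : 0 < r ->
  packing_prob Torus r m * (1 - m%:R * excluded r) <= packing_prob Torus r m.+1.
Proof.
move=> r0.
have mD n : measurable (packing Torus r setT (iota 0 n) : set spheres).
  exact: measurable_packing.
have mF (i : 'I_m) : measurable (packing Torus r setT (iota 0 m) `&` pair_meet Torus r i m).
  by apply: measurableI => //; exact: measurable_pair_meet.
rewrite mulrBr mulr1 lerBlDr.
apply: (@le_trans _ _ (pr Q (packing Torus r setT (iota 0 m.+1) `|`
  \big[setU/set0]_(i < m) (packing Torus r setT (iota 0 m) `&` pair_meet Torus r i m)))).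
  apply: le_pr; first exact: mD.
    by apply: measurableU; [exact: mD|apply: bigsetU_measurable => i _; exact: mF].
  move=> w [_ h].
  have [[i [im wi]]|nm] := pselect (exists i, (i < m)%N /\ pair_meet Torus r i m w).
    by right; rewrite -bigcup_seq; exists (Ordinal im) => /=; rewrite ?mem_index_enum.
  left; split=> // i j; rewrite !mem_iota !add0n !ltnS /= => im jm ij.
  have [im'|im'] := ltnP i m; have [jm'|jm'] := ltnP j m.
  - by apply: h; rewrite ?mem_iota.
  - have -> : j = m by apply/eqP; rewrite eqn_leq jm jm'.
    by apply/negP => H; apply: nm; exists i.
  - have -> : i = m by apply/eqP; rewrite eqn_leq im im'.
    by rewrite spheres_meetC; apply/negP => H; apply: nm; exists j.
  - by move: ij; rewrite (_ : i = j) ?eqxx//; lia.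
apply: le_trans (pr_setU_le _ _ _) _; first exact: mD.
  by apply: bigsetU_measurable => i _; exact: mF.
rewrite lerD2l (le_trans (pr_bigsetU_le _ _ mF))//.
apply: (@le_trans _ _ (\sum_(i < m) packing_prob Torus r m * excluded r)).
  by apply: ler_sum => i _; exact: pr_packing_meet_le.
by rewrite sumr_const card_ord -[leLHS]mulr_natl [leLHS]mulrCA.
Qed.

End exclusion_bounds.

(** Equivalent to ln (1 + y) >= y - y^2 / 2; the difference of the two sides has derivative x^2 / (1
    + x). *)
Lemma expR_le1D (R : realType) (y : R) : 0 <= y -> expR (y - y ^+ 2 / 2) <= 1 + y.
Proof.
rewrite le_eqVlt => /predU1P[<-|y0]; first by rewrite expr0n mul0r subr0 expR0 addr0.
pose f (x : R) := ln (1 + x) - x + x ^+ 2 / 2.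
have df (x : R) : 0 <= x -> is_derive x 1 f ((1 + x)^-1 - 1 + x).
  move=> x0; have x1 : 0 < 1 + x by lra.
  have dl : is_derive x 1 (fun x : R => ln (1 + x)) (1 + x)^-1.
    rewrite -[X in is_derive _ _ _ X]mulr1.
    apply: (@is_derive1_comp _ (@ln R) (fun x : R => 1 + x)).
    - exact: is_derive1_ln.
    - by apply: is_derive_eq; rewrite add0r mul1r.
  apply: is_derive_eq; rewrite /GRing.scale /=. by field; lra.
have f0 : f 0 <= f y.
  apply: (@ger0_derive1_le_cc R f 0 y).
  - by move=> x; rewrite in_itv/= => /andP[/ltW x0 _]; apply: ex_derive; exact: df.
  - move=> x; rewrite in_itv/= => /andP[x0 _].
    have [_ dE] := df x (ltW x0); rewrite derive1E dE.
    have -> : (1 + x)^-1 - 1 + x = x ^+ 2 / (1 + x) by field; lra.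
    by rewrite divr_ge0 ?sqr_ge0//; lra.
  - apply: derivable_within_continuous => x; rewrite in_itv/= => /andP[x0 _].
    by apply: ex_derive; exact: df.
  - by rewrite in_itv/= lexx ltW.
  - by rewrite in_itv/= lexx ltW.
  - exact: ltW.
have y1 : 0 < 1 + y by lra.
rewrite -[leRHS]lnK ?posrE// ler_expR.
by move: f0; rewrite /f addr0 ln1 expr0n mul0r; lra.
Qed.

(** * Acceptance probability *)

Section no_overlap_probability.
Context (R : realType) (d : nat) (rbar : R).
Local Notation spheres := (config R (nat * option 'I_d)%type).
Local Notation marked_point := (config R (option 'I_d)).
Implicit Types (b : boundary) (r x t : R).
Context (rho : probability R R) (Q : probability spheres R).
Hypothesis Qrho : product_law (fun k => sphere_marginal rho k.2) Q.
Hypothesis rho_pos : rho `]0, rbar]%classic = 1%E.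
Local Notation packing_prob := (packing_prob Q).
Local Notation excluded := (excluded d rbar rho).

Lemma packing_probET r n : packing_prob Torus r n <= packing_prob Euclidean r n.
Proof.
apply: le_pr; try exact: measurable_packing.
move=> w [_ h]; split=> // i j it jt ij; apply: contra (h i j it jt ij).
rewrite /spheres_meet; apply: le_lt_trans; rewrite ler_wsqrtr//.
by apply: ler_sum => l _; exact: axis_sqr_le.
Qed.

(** Overlapping across the boundary would need a torus distance below [2 * rbar * r = 1 - s], while
    wrapping around costs at least [1 - s] for two points of a box of side [s]. *)
Lemma torus_meet_box r s (z z' : marked_point) : 0 <= r -> s = 1 - 2 * rbar * r -> 0 < s ->
  box (fun=> 0) s z -> box (fun=> 0) s z' -> cube rbar z -> cube rbar z' ->
  spheres_meet Torus r z z' -> spheres_meet Euclidean r z z'.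
Proof.
move=> r0 sE s0 zs z's [_ zr] [_ z'r]; rewrite /spheres_meet => meet.
have gapT : gap Torus z z' < 1 - s.
  apply: lt_le_trans meet _; rewrite sE; move: zr z'r => /andP[_ ?] /andP[_ ?]; nra.
suff axisE i : axis_sqr Torus (z (Some i) - z' (Some i)) =
    (z (Some i) - z' (Some i)) ^+ 2.
  by move: meet; rewrite /gap; under eq_bigr do rewrite axisE.
have s1 : 0 <= 1 - s by rewrite (le_trans _ (ltW gapT))// sqrtr_ge0.
have axis_lt : axis_sqr Torus (z (Some i) - z' (Some i)) < (1 - s) ^+ 2.
  apply: (@le_lt_trans _ _ (gap Torus z z' ^+ 2)).
    rewrite sqr_sqrtr; last by apply: sumr_ge0 => j _; exact: axis_sqr_ge0.
    by rewrite (bigD1 i)// lerDl; apply: sumr_ge0 => j _; exact: axis_sqr_ge0.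
  by rewrite ltrXn2r ?sqrtr_ge0.
have /andP[] := zs i; have /andP[] := z's i; rewrite add0r => z'0 z's1 z0 zs1.
move: axis_lt; set u := z (Some i) - z' (Some i) => axis_lt.
have us : -s <= u <= s by rewrite /u; apply/andP; split; lra.
move: axis_lt; rewrite /= /Order.min; case: ifP => // _; case: ifP => _ h; exfalso.
  suff : (1 - s) ^+ 2 <= (u - 1) ^+ 2 by lra.
  by rewrite -[leRHS]sqrrN ler_sqr ?nnegrE; move/andP: us => [? ?]; lra.
suff : (1 - s) ^+ 2 <= (u + 1) ^+ 2 by lra.
by rewrite ler_sqr ?nnegrE; move/andP: us => [? ?]; lra.
Qed.

(** All centres are forced into the box of side [s], where torus and Euclidean overlaps agree; this
    costs a factor [s ^+ d] for each sphere. *)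
Lemma packing_prob_Torus_ge r s n : 0 <= r -> s = 1 - 2 * rbar * r -> 0 < s ->
  (s ^+ d) ^+ n * packing_prob Euclidean (r / s) n <= packing_prob Torus r n.
Proof.
move=> r0 sE s0; have rb := radius_bound_gt0 rho_pos.
have s1 : s <= 1 by rewrite sE gerBl !mulr_ge0// ltW.
rewrite -(pack_box Qrho r (c := fun=> 0) n s0)// => [|i]; last by rewrite add0r.
have mb := @measurable_box R d (fun=> 0) s.
have mc := @measurable_cube R d rbar.
rewrite (pack_cube Qrho rho_pos _ _ _ (A' := box (fun=> 0) s `&` cube rbar))//; last 2 first.
- exact: measurableI.
- by move=> z zc; split=> [|[]].
apply: le_pr; try (apply: measurable_packing => //; exact: measurableI).
move=> w [h1 h2]; split=> // i j it jt ij; apply: contra (h2 i j it jt ij).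
have [b1 c1] := h1 i it; have [b2 c2] := h1 j jt.
exact: (torus_meet_box r0 sE s0 b1 b2 c1 c2).
Qed.

(** Adding spheres one at a time gives the product of the factors 1 - i / K. An integer [K] turns it
    into a falling factorial, which vanishes beyond [K] before any factor becomes negative. *)
Lemma packing_prob_ge_ffact r n (K : nat) : 0 < r -> (0 < K)%N ->
  K%:R * excluded r <= 1 -> (K ^_ n)%:R / K%:R ^+ n <= packing_prob Torus r n.
Proof.
move=> r0 K0 Kv; have KR : 0 < K%:R :> R by rewrite ltr0n.
elim: n => [|n IHn].
  rewrite ffactn0 expr0 divr1 /packing_prob /pack (_ : packing _ _ _ _ = setT) ?prT//.
  by apply/seteqP; split.
have [Kn|nK] := ltnP K n.+1.
  by rewrite ffact_small// mul0r packing_prob_ge0.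
apply: le_trans (packing_prob_TorusS Qrho rho_pos n r0).
have v0 := excluded_ge0 d rbar rho (ltW r0).
rewrite ffactnSr natrM exprSr invfM mulrACA; apply: ler_pM.
- by rewrite divr_ge0 ?exprn_ge0// ltW.
- by rewrite divr_ge0// ltW.
- exact: IHn.
- rewrite natrB ?(ltnW nK)// ler_pdivrMr// mulrBl mul1r lerD2l lerN2.
  by rewrite -mulrA ler_piMr// mulrC.
Qed.

Lemma packing_prob_ge_sqr r n : 0 < r ->
  1 - n%:R ^+ 2 * excluded r <= packing_prob Torus r n.
Proof.
move=> r0; have v0 := excluded_ge0 d rbar rho (ltW r0).
elim: n => [|n IHn].
  rewrite expr0n mul0r subr0 /packing_prob /pack (_ : packing _ _ _ _ = setT) ?prT//.
  by apply/seteqP; split.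
apply: le_trans (packing_prob_TorusS Qrho rho_pos n r0).
have q1 := packing_prob_le1 Q Torus r n; have q0 := packing_prob_ge0 Q Torus r n.
rewrite mulrBr mulr1.
have : packing_prob Torus r n * (n%:R * excluded r) <= n%:R * excluded r.
  by rewrite ler_piMl// mulr_ge0.
have n0 : 0 <= n%:R :> R by [].
by rewrite -natr1; nra.
Qed.

(** Intensity [x] and scale [r] are separate parameters because passing to a box changes each in its
    own way. *)
Definition no_overlap b x r : R := expR (- x) * egf (packing_prob b r) x.

Lemma packing_prob0 b r : packing_prob b r 0 = 1.
Proof.
rewrite /packing_prob /pack (_ : packing _ _ _ _ = setT) ?prT//.
by apply/seteqP; split.
Qed.

Lemma no_overlap_ge b x r : 0 <= x -> expR (- x) <= no_overlap b x r.
Proof.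
move=> x0; rewrite ler_peMr ?expR_ge0//.
apply: le_trans (egf_sum_le x0 (packing_prob_le1 Q b r) 1).
by rewrite /egf_sum big_ord1 expr0 fact0 divr1 mul1r packing_prob0.
Qed.

Lemma no_overlap_le1 b x r : 0 <= x -> no_overlap b x r <= 1.
Proof.
move=> x0; rewrite /no_overlap expRN ler_pdivrMl ?expR_gt0// mulr1.
by apply: egf_le_expR => // n; exact: packing_prob_le1.
Qed.

Lemma no_overlap_gt0 b x r : 0 <= x -> 0 < no_overlap b x r.
Proof. by move=> x0; apply: lt_le_trans (no_overlap_ge b r x0); exact: expR_gt0. Qed.

Lemma no_overlapET x r : 0 <= x -> no_overlap Torus x r <= no_overlap Euclidean x r.
Proof.
move=> x0; rewrite ler_wpM2l ?expR_ge0// le_egf// => n; first exact: packing_probET.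
exact: packing_prob_le1.
Qed.

Lemma no_overlap_subdivide k x r : 0 <= x ->
  no_overlap Euclidean x r <=
  no_overlap Euclidean (x / k.+1%:R ^+ d) (r * k.+1%:R) ^+ (k.+1 ^ d).
Proof.
move=> x0; rewrite /no_overlap exprMn -expRM_natr.
have -> : - (x / k.+1%:R ^+ d) * (k.+1 ^ d)%:R = - x.
  by rewrite natrX mulNr divfK// expf_neq0// pnatr_eq0.
by rewrite ler_wpM2l ?expR_ge0//; exact: (egf_packing_prob_subdivide Qrho rho_pos).
Qed.

Lemma no_overlap_subbox x r s : 0 < s <= 1 -> 0 <= x ->
  no_overlap Euclidean x r <= no_overlap Euclidean (s ^+ d * x) (r / s).
Proof.
move=> s01 x0; rewrite /no_overlap.
have -> : - (s ^+ d * x) = - x + (1 - s ^+ d) * x by ring.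
rewrite expRD -mulrA ler_wpM2l ?expR_ge0//.
exact: (egf_packing_prob_subbox Qrho).
Qed.

Lemma no_overlap_Torus_ge x r s : 0 <= r -> 0 <= x -> s = 1 - 2 * rbar * r -> 0 < s ->
  expR (- ((1 - s ^+ d) * x)) * no_overlap Euclidean (s ^+ d * x) (r / s) <=
  no_overlap Torus x r.
Proof.
move=> r0 x0 sE s0; rewrite /no_overlap mulrA -expRD.
have -> : - ((1 - s ^+ d) * x) - s ^+ d * x = - x by ring.
rewrite ler_wpM2l ?expR_ge0// -egf_scale; apply: le_egf => // n.
  exact: packing_prob_Torus_ge.
exact: packing_prob_le1.
Qed.

(** The falling factorials sum to [(1 + x / K) ^+ K]. By [expR_le1D] its linear order cancels
    [expR (- x)] and the quadratic term remains. *)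
Lemma no_overlap_Torus_quadratic x r (K : nat) : 0 < r -> 0 <= x -> (0 < K)%N ->
  K%:R * excluded r <= 1 -> expR (- (x ^+ 2 / (2 * K%:R))) <= no_overlap Torus x r.
Proof.
move=> r0 x0 K0 Kv; have KR : K%:R != 0 :> R by rewrite pnatr_eq0 -lt0n.
apply: (@le_trans _ _ (expR (- x) * (1 + x / K%:R) ^+ K)).
  apply: (@le_trans _ _ (expR (- x) * expR (x / K%:R - (x / K%:R) ^+ 2 / 2) ^+ K)).
    rewrite -expRM_natr -expRD ler_expR le_eqVlt; apply/orP; left; apply/eqP.
    by field.
  rewrite ler_wpM2l ?expR_ge0// lerXn2r ?nnegrE ?expR_ge0 ?addr_ge0 ?divr_ge0//.
  by apply: expR_le1D; rewrite divr_ge0.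
rewrite ler_wpM2l ?expR_ge0//.
apply: le_trans (egf_sum_le x0 (packing_prob_le1 Q Torus r) K.+1).
rewrite addrC exprD1n; apply: ler_sum => n _.
rewrite -mulr_natl exprMn exprVn.
rewrite (_ : _ * _ = x ^+ n / n`!%:R * ((K ^_ n)%:R / K%:R ^+ n)); last first.
  rewrite -bin_ffact natrM; field.
  by rewrite expf_neq0//= pnatr_eq0 -lt0n fact_gt0.
by rewrite ler_wpM2l ?egf_coef_ge0//; exact: packing_prob_ge_ffact.
Qed.

(** Every coefficient is bounded by 1 except that of two spheres, which loses [e]; this is sharp to
    first order when [x] and [r] are small. *)
Lemma no_overlap_pair x r : 0 <= x -> 0 < r -> 2 * (2 * rbar * r) < 1 ->
  no_overlap Euclidean x r <=
  1 - expR (- x) * (x ^+ 2 / 2) * (excluded r * (1 - 2 * (2 * rbar * r)) ^+ d).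
Proof.
move=> x0 r0 h1; have rb := radius_bound_gt0 rho_pos.
set e := excluded r * _.
have q2 : packing_prob Euclidean r 2 <= 1 - e.
  apply: (@le_trans _ _ (pr Q (~` pair_meet Euclidean r 0 1))).
    apply: le_pr; first exact: measurable_packing.
      by apply: measurableC; exact: measurable_pair_meet.
    by move=> w [_ h]; apply/negP; apply: h; rewrite ?mem_iota.
  rewrite prC; last exact: measurable_pair_meet.
  rewrite lerD2l lerN2 -lee_fin; apply: le_trans (pr_pair_meet_ge Qrho r0 h1 rb).
  rewrite /e /excluded mulrAC EFinM fineK//.
  by rewrite ge0_fin_numE ?mean_pair_size_ge0 ?(mean_pair_size_lty d rho_pos).
rewrite /no_overlap (_ : 1 - _ = expR (- x) * (expR x - x ^+ 2 / 2 * e)); last first.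
  by rewrite mulrBr -expRD addNr expR0 -!mulrA.
rewrite ler_wpM2l ?expR_ge0//.
apply: egf_le => // [n|M]; first exact: packing_prob_le1.
have term1 (n : nat) : x ^+ n / n`!%:R * packing_prob Euclidean r n <= x ^+ n / n`!%:R * 1.
  by rewrite ler_wpM2l ?packing_prob_le1 ?egf_coef_ge0.
(* Three more terms make sure that the coefficient of index 2 is present. *)
apply: (@le_trans _ _ (egf_sum (packing_prob Euclidean r) x (M + 3))).
  rewrite /egf_sum [leRHS]big_split_ord /= lerDl; apply: sumr_ge0 => n _.
  by rewrite mulr_ge0 ?egf_coef_ge0 ?packing_prob_ge0.
have := @egf_sum_le_expR R (fun=> 1) x (M + 3) x0 (fun=> lexx 1).
rewrite addnC /egf_sum !big_ord_recl /= => H.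
rewrite lerBrDr; apply: le_trans H.
have T0 := term1 0%N; have T1 := term1 1%N.
have T2 : x ^+ 2 / 2`!%:R * packing_prob Euclidean r 2 + x ^+ 2 / 2 * e <= x ^+ 2 / 2`!%:R * 1.
  rewrite (_ : 2`! = 2%N)// -mulrDr ler_wpM2l ?divr_ge0 ?sqr_ge0//; lra.
set S1 := \sum_(i < M) _; set S2 := (X in _ <= _ + (_ + (_ + X))).
have TS : S1 <= S2 by apply: ler_sum => n _; exact: term1.
move: T0 T1 T2 TS; rewrite /bump /=; lra.
Qed.

Lemma no_overlap_birthday x r (a : R) k : 0 <= x -> 0 < r ->
    d%:R / k.+1%:R < 2 * a * r ->
  no_overlap Euclidean x r <=
  expR (- (point_prob Q (large a) * x)) *
    (1 + x * point_prob Q (large a) / (k.+1 ^ d)%:R) ^+ (k.+1 ^ d).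
Proof.
move=> x0 r0 grid; rewrite /no_overlap.
set p := point_prob _ _.
have -> : expR (- (p * x)) = expR (- x) * expR ((1 - p) * x).
  by rewrite -expRD; congr expR; ring.
rewrite -mulrA ler_wpM2l ?expR_ge0//.
exact: (egf_birthday Qrho rho_pos).
Qed.

End no_overlap_probability.

(** * Laws of the samples and mean number of checks *)

Section sample_configuration.
Context disp (T : measurableType disp) (R : realType) (P : probability T R) (d : nat).
Local Notation idx := (nat * option 'I_d)%type.
Local Notation spheres := (config R (nat * option 'I_d)%type).
Context (R0 : {RV P >-> R}) (eta lambda : R) (s : sample P d).
Hypothesis lambda_gt0 : 0 < lambda.
Hypothesis s_law : sample_law R0 eta lambda s.

Local Notation u := (lambda `^ eta).
Local Notation rho := (distribution P R0 : probability R R).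

Let u_gt0 : 0 < u. Proof. exact: powR_gt0. Qed.

(* Radii are multiplied by [lambda `^ eta], which makes the law independent of
   [lambda]. *)
Definition spheres_of (w : T) : spheres := fun k =>
  if k.2 is Some i then sample_coord s k.1 i w else u * sample_radius s k.1 w.

Lemma measurable_spheres_of : measurable_fun setT spheres_of.
Proof.
apply: measurable_config => -[n [i|]]; rewrite /spheres_of /=.
  exact: measurable_funPT.
by apply: measurable_funM => //; exact: measurable_funPT.
Qed.

Let key (k : idx) : unit + nat + nat * 'I_d :=
  if k.2 is Some i then inr (k.1, i) else inl (inr k.1).

Let key_inj : injective key.
Proof. by move=> [n [i|]] [m [j|]] // [] => [-> ->|->]. Qed.

Lemma pr_count_cylinder (S : set nat) (J : {fset idx}) (A : idx -> set R) :
  (forall k, measurable (A k)) ->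
  P (sample_count s @^-1` S `&` spheres_of @^-1` (cylinder J A)) =
  (P (sample_count s @^-1` S) * \prod_(k <- J) sphere_marginal rho k.2 (A k))%E.
Proof.
move=> mA; have [_ coord_law radius_law indep] := s_law.
pose E (j : unit + nat + nat * 'I_d) : set T := match j with
  | inl (inl _) => sample_count s @^-1` S
  | inl (inr n) => [set w | A (n, None) (u * sample_radius s n w)]
  | inr (n, i) => [set w | A (n, Some i) (sample_coord s n i w)] end.
have mscale (n : nat) : measurable ((fun x => u * x) @^-1` A (n, None)).
  by rewrite -[X in measurable X]setTI; apply: measurable_funM.
have keyN k : key k != inl (inl tt) by case: k => n [].
pose J' := (inl (inl tt) |` [fset key k | k in J])%fset.
have := indep J' E.
rewrite big_fsetU1 /=; last first.
  by apply/negP => /imfsetP[k _ e]; have := keyN k; rewrite -e eqxx.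
rewrite big_imfset /=; last by move=> ? ? _ _; exact: key_inj.
have -> : \bigcap_(j in [set` J']) E j =
    sample_count s @^-1` S `&` spheres_of @^-1` (cylinder J A).
  apply/seteqP; split=> w /=.
    move=> h; split; first by apply: (h (inl (inl tt))); rewrite /= !inE eqxx.
    move=> k kJ; have := h (key k); rewrite /= !inE (negbTE (keyN k)) /=.
    rewrite in_imfset// => /(_ isT); rewrite /spheres_of.
    by case: (k) => n [i|].
  move=> [Sw h] j; rewrite /= !inE => /orP[/eqP -> //|/imfsetP[k /= kJ ->]].
  by have := h k kJ; rewrite /spheres_of; case: (k) => n [i|].
move=> ->.
  congr (_ * _)%E; apply: eq_bigr => -[n [i|]] _ /=; first exact: coord_law.
  rewrite -[LHS]/(P (sample_radius s n @^-1` ((fun x => u * x) @^-1` A (n, None)))).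
  rewrite radius_law// /distribution /pushforward; congr (P _).
  apply/seteqP; split=> w /=; rewrite mulrC divfK// gt_eqF//.
move=> j; rewrite !inE => /orP[/eqP ->|/imfsetP[[n [i|]] /= kJ ->]] /=.
- by exists S.
- by exists (A (n, Some i)).
- by exists ((fun x => u * x) @^-1` A (n, None)).
Qed.

(** The product law is obtained as the image of the probability on which the sample lives, so none
    has to be constructed. *)
Lemma exists_spheres_law :
  exists Q : probability spheres R, product_law (fun k => sphere_marginal rho k.2) Q.
Proof.
pose X : {mfun T >-> spheres} := mfun_Sub (mem_set measurable_spheres_of).
exists (distribution P X) => J A mA.
have := pr_count_cylinder setT J mA.
by rewrite preimage_setT setTI probability_setT mul1e.
Qed.

Context (Q : probability spheres R).
Hypothesis Qrho : product_law (fun k => sphere_marginal rho k.2) Q.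

(** Independence of the count and the spheres, extended from cylinders to all events. *)
Lemma count_spheres_law (S : set nat) (B : set spheres) : measurable B ->
  P (sample_count s @^-1` S `&` spheres_of @^-1` B) =
  (P (sample_count s @^-1` S) * Q B)%E.
Proof.
move=> mB.
have mN : measurable (sample_count s @^-1` S).
  by rewrite -[X in measurable X]setTI; exact: measurable_funPT.
have mF := measurable_spheres_of.
have p0 : 0 <= pr P (sample_count s @^-1` S) by exact: pr_ge0.
pose m1 := image_measure (mrestr P mN) mF.
pose m2 := mscale (NngNum p0) Q.
rewrite setIC [X in (X * _)%E]prE//.
apply: (config_measure_unique (m1 := m1) (m2 := m2)) => //.
  rewrite /m1 /= /pushforward /mrestr preimage_setT setTI.
  by rewrite (le_lt_trans (probability_le1 P mN))// ltry.
move=> J A mA; rewrite /m1 /m2 /= /pushforward /mrestr /mscale /= setIC.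
by rewrite pr_count_cylinder// -prE//; congr (_ * _)%E; exact/esym/Qrho.
Qed.

End sample_configuration.

Section sample_probabilities.
Context disp (T : measurableType disp) (R : realType) (P : probability T R) (d : nat).
Local Notation spheres := (config R (nat * option 'I_d)%type).
Context (R0 : {RV P >-> R}) (eta lambda rbar : R) (s : sample P d) (b : boundary).
Hypothesis lambda_gt0 : 0 < lambda.
Hypothesis s_law : sample_law R0 eta lambda s.
Local Notation u := (lambda `^ eta).
Local Notation rho := (distribution P R0 : probability R R).
Context (Q : probability spheres R).
Hypothesis Qrho : product_law (fun k => sphere_marginal rho k.2) Q.
Hypothesis rho_pos : rho `]0, rbar]%classic = 1%E.
Local Notation F := (spheres_of eta lambda s).
Local Notation q := (packing_prob Q b u^-1).

Let u_gt0 : 0 < u. Proof. exact: powR_gt0. Qed.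

Lemma sphere_radius_gt0 (c y : 'rV[R]_d) r : sphere b c r y -> 0 < r.
Proof.
case: b => /=; last by apply: le_lt_trans; exact: enorm_ge0.
by move=> [k]; apply: le_lt_trans; exact: enorm_ge0.
Qed.

Lemma measurable_sample_overlap i j :
  measurable [set w | overlap b (sample_sphere s w i) (sample_sphere s w j)].
Proof.
have mr n : measurable [set w | 0 < sample_radius s n w].
  by apply: measurable_set_ltr => //; exact: measurable_funPT.
have mnorm (k : 'rV[R]_d) : measurable [set w |
    enorm ((sample_sphere s w i).1 - (sample_sphere s w j).1 - k) <
    sample_radius s i w + sample_radius s j w].
  apply: measurable_set_ltr; last by apply: measurable_funD; exact: measurable_funPT.
  apply: (measurableT_comp (continuous_measurable_fun (@sqrt_continuous R))).
  apply: measurable_sum => l.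
  rewrite (_ : (fun w => _) = (fun w => (sample_coord s i l w - sample_coord s j l w - k ord0 l)
    ^+ 2)).
    apply: measurable_funX; apply: measurable_funB => //.
    by apply: measurable_funB; exact: measurable_funPT.
  by apply/funext => w; rewrite !mxE.
pose N (k : 'rV[int]_d) := [set w | enorm ((sample_sphere s w i).1 -
    (sample_sphere s w j).1 - map_mx intr k) <
    sample_radius s i w + sample_radius s j w].
(* Overlap forces both radii to be positive and is then a distance condition; the lattice vectors of
   the torus are countable. *)
rewrite (_ : mkset _ = [set w | 0 < sample_radius s i w] `&`
    [set w | 0 < sample_radius s j w] `&`
    (if b is Torus then \bigcup_k N k else N 0)).
  apply: measurableI; first exact: measurableI.
  case: b; last exact: mnorm.
  apply: countable_bigcupT_measurable => [|k]; last exact: mnorm.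
  by apply: countableP.
apply/seteqP; split=> w /=.
  move=> [y [yi yj]].
  have ri := sphere_radius_gt0 yi; have rj := sphere_radius_gt0 yj.
  split=> //.
  have : overlap b (sample_sphere s w i) (sample_sphere s w j) by exists y.
  rewrite /N; case: b.
    by move=> /(overlap_TorusP _ _ ri rj)[k h]; exists k.
  by move=> /(overlap_EuclideanP _ _ ri rj); rewrite /= raddf0 subr0.
rewrite /N; case: b => /= -[[ri rj]].
  by move=> [k _ h]; apply/(overlap_TorusP _ _ ri rj); exists k.
by rewrite raddf0 subr0 => h; apply/(overlap_EuclideanP _ _ ri rj).
Qed.

Definition nonoverlapping n : set T := [set w | ~ overlap_within b s w n].

Lemma measurable_nonoverlapping n : measurable (nonoverlapping n).
Proof.
apply: measurableC.
rewrite [X in measurable X](_ : _ = \bigcup_(i in [set i | (i < n)%N]) \bigcup_(j in [set j | (i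
  < j < n)%N])
  [set w | overlap b (sample_sphere s w i) (sample_sphere s w j)]).
  by do 2 (apply: bigcup_measurable => ? _); exact: measurable_sample_overlap.
apply/seteqP; split=> w /=.
  by move=> [i [j [/andP[ij jn] h]]]; exists i => /=; [exact: ltn_trans jn|exists j => //=;
    rewrite ij].
by move=> [i _ [j ij h]]; exists i, j.
Qed.

Lemma nonoverlapping_packing w n :
  (forall m, cube rbar (sphere_at (F w) m)) ->
  nonoverlapping n w <-> packing b u^-1 setT (iota 0 n) (F w).
Proof.
move=> wc.
have meetE i j : overlap b (sample_sphere s w i) (sample_sphere s w j) <->
    spheres_meet b u^-1 (sphere_at (F w) i) (sphere_at (F w) j).
  have rad m : 0 < sample_radius s m w.
    have [_ /andP[+ _]] := wc m; rewrite /sphere_at /spheres_of /=.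
    by rewrite pmulr_rgt0.
  rewrite /sample_sphere overlapP//.
    rewrite /spheres_meet /gap /sphere_at /spheres_of /= -mulrDr mulKf ?gt_eqF//.
    by under eq_bigr do rewrite !mxE.
  move=> l; rewrite !mxE; have [/(_ l)/andP[+ +] _] := wc i; have [/(_ l)/andP[+ +] _] := wc j.
  by rewrite /sphere_at /spheres_of /= ler_norml; lra.
split=> [no|[_ h] [i [j [/andP[ij jn] /meetE]]]].
  split=> // i j; rewrite !mem_iota !add0n /= => ni nj ij; apply/negP => /meetE ov.
  move: ij; rewrite neq_ltn => /orP[ij|ji]; apply: no.
    by exists i, j; rewrite ij nj.
  exists j, i; rewrite ji ni; split=> //; apply/meetE; rewrite spheres_meetC; exact/meetE.
apply/negP; apply: h; rewrite ?mem_iota ?add0n//=; first exact: ltn_trans jn.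
by rewrite neq_ltn ij.
Qed.

Lemma pr_count_nonoverlapping (S : set nat) n :
  pr P (sample_count s @^-1` S `&` nonoverlapping n) =
  pr P (sample_count s @^-1` S) * q n.
Proof.
have mS : measurable (sample_count s @^-1` S).
  by rewrite -[X in measurable X]setTI; exact: measurable_funPT.
have mF (B : set spheres) : measurable B -> measurable (F @^-1` B).
  by move=> mB; rewrite -[X in measurable X]setTI; exact: measurable_spheres_of.
have mpack : measurable (packing b u^-1 setT (iota 0 n) : set spheres).
  exact: measurable_packing.
have mcube m : measurable [set v : spheres | ~ cube rbar (sphere_at v m)].
  apply: measurableC; rewrite -[X in measurable X]setTI; apply: measurable_sphere_at => //.
  exact: measurable_cube.
(* The two descriptions of non-overlap agree when all spheres lie in [cube]; the exceptions form a
   countable union of null sets. *)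
have bad0 : P (\bigcup_m F @^-1` [set v | ~ cube rbar (sphere_at v m)]) = 0%E.
  apply/eqP; rewrite eq_le measure_ge0 andbT.
  have mbad m : measurable (F @^-1` [set v | ~ cube rbar (sphere_at v m)]) by exact: mF.
  apply: le_trans (generalized_Boole_inequality P mbad (bigcup_measurable _)) _ => //.
  rewrite eseries0// => m _ _.
  have := count_spheres_law lambda_gt0 s_law Qrho setT (mcube m).
  rewrite preimage_setT setTI probability_setT mul1e => h; apply: etrans h _.
  by rewrite (prE _ (mcube m)) (pr_not_cube Qrho rho_pos).
rewrite (@eq_pr_ae _ _ _ P _ (sample_count s @^-1` S `&`
    F @^-1` packing b u^-1 setT (iota 0 n))
    (\bigcup_m F @^-1` [set v | ~ cube rbar (sphere_at v m)])).
- rewrite /pr (count_spheres_law lambda_gt0 s_law Qrho)// fineM// fin_num_measure//.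
- by apply: measurableI => //; exact: measurable_nonoverlapping.
- by apply: measurableI => //; exact: mF.
- by apply: bigcup_measurable => m _; exact: mF.
- by rewrite /pr bad0.
- move=> w wbad; have wc m : cube rbar (sphere_at (F w) m).
    by apply: contrapT => h; apply: wbad; exists m.
  by split=> -[Sw h]; split=> //; apply/(nonoverlapping_packing n wc).
Qed.

End sample_probabilities.

(** * Sums against the Poisson law *)

Section poisson_series.
Context (R : realType).
Implicit Types (a g : nat -> R) (lambda : R).

Lemma poisson_egf_sum lambda a M : 0 < lambda ->
  \sum_(n < M) poisson_pmf lambda n * a n = expR (- lambda) * egf_sum a lambda M.
Proof.
move=> l0; rewrite /egf_sum mulr_sumr; apply: eq_bigr => n _.
by rewrite /poisson_pmf l0; ring.
Qed.

Lemma poisson_series_ge lambda g M : (forall n, 0 <= g n) ->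
  ((\sum_(n < M) poisson_pmf lambda n * g n)%:E <=
   \sum_(0 <= n <oo) (poisson_pmf lambda n * g n)%:E)%E.
Proof.
move=> g0.
apply: le_trans (nneseries_lim_ge M _); last first.
  by move=> n _ _; rewrite lee_fin mulr_ge0// poisson_pmf_ge0.
by rewrite big_mkord sumEFin.
Qed.

Lemma poisson_series_le lambda g C : (forall n, 0 <= g n) ->
  (forall M, \sum_(n < M) poisson_pmf lambda n * g n <= C) ->
  (\sum_(0 <= n <oo) (poisson_pmf lambda n * g n)%:E <= C%:E)%E.
Proof.
move=> g0 gC; apply: lime_le.
  by apply: is_cvg_nneseries => n _ _; rewrite lee_fin mulr_ge0// poisson_pmf_ge0.
by apply: nearW => M; rewrite big_mkord sumEFin lee_fin.
Qed.

Lemma poisson_series_egf lambda a : 0 < lambda -> (forall n, 0 <= a n <= 1) ->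
  (\sum_(0 <= n <oo) (poisson_pmf lambda n * a n)%:E =
   (expR (- lambda) * egf a lambda)%:E)%E.
Proof.
move=> l0 a01; have a0 n : 0 <= a n by have /andP[] := a01 n.
have a1 n : a n <= 1 by have /andP[] := a01 n.
apply/eqP; rewrite eq_le; apply/andP; split.
  apply: poisson_series_le => // M; rewrite poisson_egf_sum// ler_wpM2l ?expR_ge0//.
  exact: (egf_sum_le (ltW l0) a1).
have := poisson_series_ge lambda 0 a0; rewrite big_ord0.
case E : (\sum_(0 <= n <oo) _)%E => [v| |] //; last by move=> _; exact: leey.
move=> _; rewrite lee_fin expRN ler_pdivrMl ?expR_gt0//.
apply: egf_le => // [|M]; first exact: ltW.
rewrite -ler_pdivrMl ?expR_gt0// -expRN -poisson_egf_sum// -lee_fin -E.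
exact: poisson_series_ge.
Qed.

Lemma poisson_mass_le1 lambda M : 0 < lambda -> \sum_(n < M) poisson_pmf lambda n <= 1.
Proof.
move=> l0; under eq_bigr do rewrite -[poisson_pmf _ _]mulr1.
rewrite (poisson_egf_sum (fun=> 1))// expRN ler_pdivrMl ?expR_gt0// mulr1.
by apply: egf_sum_le_expR => //; exact: ltW.
Qed.

Lemma egf1 lambda : 0 <= lambda -> egf (fun=> 1) lambda = expR lambda.
Proof.
move=> l0; apply/eqP; rewrite eq_le egf_le_expR//=.
apply: limr_le; first exact: is_cvg_series_exp_coeff.
apply: nearW => M; apply: le_trans (egf_sum_le l0 (fun=> lexx 1) M).
rewrite /series /= big_mkord; apply: ler_sum => n _.
by rewrite mulr1.
Qed.

(* Chernoff bound at [1/2]: [1[n < n0] <= 2^n0 2^-n]. *)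
Lemma poisson_tail_ge lambda n0 : 4 <= lambda -> n0%:R <= lambda / 4 ->
  2^-1 <= expR (- lambda) * egf (fun n => (n0 <= n)%:R) lambda.
Proof.
move=> l4 n0l; have l0 : 0 <= lambda by lra.
have b1 (b : bool) : b%:R <= 1 :> R by case: b.
have H : expR lambda <= egf (fun n => (n0 <= n)%:R) lambda + 2 ^+ n0 * expR (lambda / 2).
  rewrite -egf1//; apply: egf_le => // M.
  apply: (@le_trans _ _ (egf_sum (fun n => (n0 <= n)%:R) lambda M +
      2 ^+ n0 * egf_sum (fun n => 2^-1 ^+ n * 1) lambda M)).
    rewrite /egf_sum mulr_sumr -big_split /=; apply: ler_sum => n _.
    rewrite mulrCA -mulrDr ler_wpM2l ?egf_coef_ge0// mulr1.
    case: leqP => nn0; first by rewrite lerDl mulr_ge0 ?exprn_ge0// invr_ge0.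
    rewrite add0r exprVn -(subnKC (ltnW nn0)) exprD mulrAC divff ?expf_neq0//.
    by rewrite mul1r exprn_ege1// ler1n.
  apply: lerD; first by apply: egf_sum_le => // n; exact: b1.
  rewrite ler_wpM2l ?exprn_ge0//.
  have h1 n : 2^-1 ^+ n * 1 <= 1 :> R by rewrite mulr1 exprn_ile1// invf_le1// ler1n.
  apply: le_trans (egf_sum_le l0 h1 M) _.
  by rewrite egf_scale egf1 ?divr_ge0// mulrC//; lra.
have two : 2 ^+ n0 <= expR (lambda / 4).
  apply: (@le_trans _ _ (expR 1 ^+ n0)).
    by rewrite lerXn2r ?nnegrE ?expR_ge0//; have := expR_ge1Dx (1 : R); lra.
  by rewrite -expRM_natl mulr1 ler_expR.
(* The exponent is at most -lambda + lambda/4 + lambda/2 = -lambda/4 <= -1, and e >= 2. *)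
have e1 : expR (- lambda) * (2 ^+ n0 * expR (lambda / 2)) <= 2^-1.
  apply: (@le_trans _ _ (expR (- lambda) * (expR (lambda / 4) * expR (lambda / 2)))).
    by rewrite ler_wpM2l ?expR_ge0// ler_wpM2r ?expR_ge0.
  rewrite -!expRD; apply: (@le_trans _ _ (expR (- 1))).
    by rewrite ler_expR; lra.
  rewrite expRN lef_pV2 ?posrE ?expR_gt0//; have := expR_ge1Dx (1 : R); lra.
have : 1 <= expR (- lambda) * egf (fun n => (n0 <= n)%:R) lambda +
    expR (- lambda) * (2 ^+ n0 * expR (lambda / 2)).
  by rewrite -mulrDr -ler_pdivrMl ?expR_gt0// mulr1 -expRN opprK.
lra.
Qed.

End poisson_series.

Section sample_expectations.
Context disp (T : measurableType disp) (R : realType) (P : probability T R) (d : nat).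
Local Notation spheres := (config R (nat * option 'I_d)%type).
Context (R0 : {RV P >-> R}) (eta lambda rbar : R) (s : sample P d) (b : boundary).
Hypothesis lambda_gt0 : 0 < lambda.
Hypothesis s_law : sample_law R0 eta lambda s.
Local Notation u := (lambda `^ eta).
Local Notation rho := (distribution P R0 : probability R R).
Context (Q : probability spheres R).
Hypothesis Qrho : product_law (fun k => sphere_marginal rho k.2) Q.
Hypothesis rho_pos : rho `]0, rbar]%classic = 1%E.
Local Notation q := (packing_prob Q b u^-1).
Local Notation N := (sample_count s).

Let mN (S : set nat) : measurable (N @^-1` S).
Proof. by rewrite -[X in measurable X]setTI; exact: measurable_funPT. Qed.

Let count_cover : \bigcup_n (N @^-1` [set n]) = [set: T].
Proof. by apply/seteqP; split=> // w _; exists (N w). Qed.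

Let count_triv : trivIset [set: nat] (fun n => N @^-1` [set n]).
Proof.
by apply/trivIsetP => i j _ _ ij; apply/seteqP; split=> // w [/= -> e]; rewrite e eqxx in ij.
Qed.

Let pr_count n : pr P (N @^-1` [set n]) = poisson_pmf lambda n.
Proof. by case: s_law => count_law _ _ _; rewrite /pr count_law. Qed.

Lemma nonoverlap_probE : nonoverlap_prob b s = no_overlap Q b lambda u^-1.
Proof.
rewrite /nonoverlap_prob /no_overlap.
have mno n : measurable (N @^-1` [set n] `&` nonoverlapping s b n).
  by apply: measurableI => //; exact: measurable_nonoverlapping.
rewrite (_ : mkset _ = \bigcup_n (N @^-1` [set n] `&` nonoverlapping s b n)); last first.
  apply/seteqP; split=> w /=; first by move=> h; exists (N w).
  by move=> [n _ [/= <-]].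
rewrite measure_semi_bigcup//; last 2 first.
- by apply: (@sub_trivIset _ _ setT setT) => //; exact: trivIset_setIr.
- by apply: bigcup_measurable => n _.
rewrite (eq_eseriesr (g := fun n => (poisson_pmf lambda n * q n)%:E)); last first.
  move=> n _; rewrite -pr_count -(pr_count_nonoverlapping b lambda_gt0 s_law Qrho rho_pos).
  exact: prE.
rewrite poisson_series_egf// => n; rewrite packing_prob_ge0 packing_prob_le1//.
Qed.

(** The mean number of checks when the count is [n]: sphere [m], numbered from 0, is compared with
    [m] others and is generated only if those do not overlap. *)
Definition checks n : R := \sum_(m < n) m%:R * q m.

Lemma check_countE w n : N w = n ->
  check_count b s w = \sum_(m < n) m%:R * \1_(nonoverlapping s b m) w.
Proof.
move=> Nn; rewrite /check_count Nn big_add1 /= big_mkord big_mkcond /=.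
apply: eq_bigr => m _; rewrite indicE.
(* The [m.+1]-st sphere is generated exactly when there is no overlap among the first [m]; an
   overlap that it causes itself comes after its checks. *)
have H : (m.+1%:R%:E <= first_overlap b s w)%E <-> ~ overlap_within b s w m.
  split=> [h [i [j [/andP[ij jm] ov]]]|h].
    have : (first_overlap b s w <= m%:R%:E)%E.
      by apply: ereal_inf_lbound; exists m => //; exists i, j; rewrite ij jm.
    by move=> /(le_trans h); rewrite lee_fin ler_nat ltnn.
  apply: le_ereal_inf_tmp => _ [k [i [j [/andP[ij jk] ov]]] <-].
  rewrite lee_fin ler_nat ltnNge; apply/negP => km; apply: h.
  by exists i, j; rewrite ij (leq_trans jk km).
case: ifPn => h; first by rewrite mem_set ?mulr1//; exact/H.
by rewrite memNset ?mulr0// => /H; exact/negP.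
Qed.

Lemma mean_check_countE : mean_check_count b s =
  (\sum_(0 <= n <oo) (poisson_pmf lambda n * checks n)%:E)%E.
Proof.
rewrite /mean_check_count -count_cover.
have mterm n m : measurable_fun (N @^-1` [set n])
    (fun w => (m%:R * \1_(nonoverlapping s b m) w : R)).
  apply: measurable_funTS; apply: measurable_funM => //.
  by apply: measurable_indic; exact: measurable_nonoverlapping.
rewrite ge0_integral_bigcup//; last 2 first.
- apply/measurable_fun_bigcup => // n.
  apply: (eq_measurable_fun (fun w => (\sum_(m < n) m%:R * \1_(nonoverlapping s b m) w : R)%:E)).
    by move=> w; rewrite inE /= => Nn; rewrite (check_countE Nn).
  by apply/measurable_EFinP; apply: measurable_sum => m.
- by move=> w _; rewrite lee_fin sumr_ge0.
apply: eq_eseriesr => n _.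
rewrite (eq_integral (fun w => \sum_(m < n) (m%:R * \1_(nonoverlapping s b m) w)%:E)%E); last first.
  by move=> w; rewrite inE /= => Nn; rewrite (check_countE Nn) sumEFin.
rewrite ge0_integral_sum//; last by move=> m; exact/measurable_EFinP.
rewrite /checks mulr_sumr -sumEFin; apply: eq_bigr => m _.
under eq_integral do rewrite EFinM.
rewrite ge0_integralZl//; last first.
  apply: measurable_funTS; apply/measurable_EFinP; apply: measurable_indic.
  exact: measurable_nonoverlapping.
rewrite integral_indic//; last exact: measurable_nonoverlapping.
have e : P (nonoverlapping s b m `&` N @^-1` [set n]) = (poisson_pmf lambda n * q m)%:E.
  rewrite setIC -pr_count -(pr_count_nonoverlapping b lambda_gt0 s_law Qrho rho_pos).
  by apply: prE; apply: measurableI => //; exact: measurable_nonoverlapping.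
by apply: etrans (congr1 (fun z => m%:R%:E * z)%E e) _; rewrite -EFinM mulrCA.
Qed.

Lemma checks_ge0 n : 0 <= checks n.
Proof. by apply: sumr_ge0 => m _; rewrite mulr_ge0// packing_prob_ge0. Qed.

Lemma le_checks m n : (m <= n)%N -> checks m <= checks n.
Proof.
move=> mn; rewrite /checks (big_ord_widen n (fun m => m%:R * q m) mn).
rewrite [leRHS](bigID (fun i : 'I_n => (i < m)%N))/= lerDl.
by apply: sumr_ge0 => i _; rewrite mulr_ge0// packing_prob_ge0.
Qed.

Lemma mean_check_count_le C : (forall n, checks n <= C) ->
  (mean_check_count b s <= C%:E)%E.
Proof.
move=> gC; have C0 : 0 <= C := le_trans (checks_ge0 0) (gC 0%N).
rewrite mean_check_countE; apply: poisson_series_le => // [|M]; first exact: checks_ge0.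
apply: (@le_trans _ _ (\sum_(n < M) poisson_pmf lambda n * C)).
  by apply: ler_sum => n _; rewrite ler_wpM2l// poisson_pmf_ge0.
by rewrite -mulr_suml ler_piMl// poisson_mass_le1.
Qed.

(** A count of [n] costs at most [n * (n - 1)] checks, and the second factorial moment of the
    Poisson law is [lambda ^+ 2]. *)
Lemma mean_check_count_le_sqr : (mean_check_count b s <= (lambda ^+ 2)%:E)%E.
Proof.
rewrite mean_check_countE; apply: poisson_series_le => // [|M]; first exact: checks_ge0.
have checks_le n : checks n <= n%:R * n.-1%:R.
  apply: (@le_trans _ _ (\sum_(m < n) n.-1%:R)).
    apply: ler_sum => m _; apply: (@le_trans _ _ m%:R).
      by rewrite ler_piMr// packing_prob_le1.
    by rewrite ler_nat; case: n m => [[]|n m] //=; rewrite -ltnS.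
  by rewrite sumr_const card_ord mulr_natl.
apply: (@le_trans _ _ (\sum_(n < M) poisson_pmf lambda n * (n%:R * n.-1%:R))).
  by apply: ler_sum => n _; rewrite ler_wpM2l// poisson_pmf_ge0.
have term n : poisson_pmf lambda n.+2 * (n.+2%:R * n.+2.-1%:R) =
    lambda ^+ 2 * poisson_pmf lambda n.
  rewrite /poisson_pmf lambda_gt0 !factS !natrM !exprS /=.
  field; rewrite pnatr_eq0 -lt0n fact_gt0 /=.
  by have n0 : 0 <= n%:R :> R by []; apply/andP; split; rewrite gt_eqF//; lra.
case: M => [|[|M]]; first by rewrite big_ord0 sqr_ge0.
  by rewrite big_ord1 /= mulr0n mul0r mulr0 sqr_ge0.
rewrite 2!big_ord_recl.
under [X in _ + (_ + X)]eq_bigr do rewrite !lift0 term.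
rewrite !lift0 /= mulr0n mul0r !mulr0 !add0r.
by rewrite -mulr_sumr ler_piMr ?sqr_ge0// poisson_mass_le1.
Qed.

(** [checks] is nondecreasing and the count reaches [n0] with probability at least 1/2. *)
Lemma mean_check_count_ge n0 : 4 <= lambda -> n0%:R <= lambda / 4 ->
  ((checks n0 / 2)%:E <= mean_check_count b s)%E.
Proof.
move=> l4 n0l; rewrite mean_check_countE.
have g0 := checks_ge0.
have := poisson_series_ge lambda 0 g0; rewrite big_ord0.
case E : (\sum_(0 <= n <oo) _)%E => [v| |] //; last by move=> _; exact: leey.
rewrite !lee_fin => v0.
have := g0 n0; rewrite le_eqVlt => /predU1P[<-|gn0]; first by rewrite mul0r.
apply: (@le_trans _ _ (checks n0 * (expR (- lambda) * egf (fun n => (n0 <= n)%:R) lambda))).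
  by rewrite ler_wpM2l ?poisson_tail_ge// ltW.
rewrite mulrA -ler_pdivlMl ?mulr_gt0 ?expR_gt0//.
apply: egf_le => [|n|M]; first exact: ltW.
  by case: (n0 <= n)%N.
rewrite ler_pdivlMl ?mulr_gt0 ?expR_gt0// -mulrA -poisson_egf_sum// mulr_sumr.
rewrite -lee_fin -E; apply: le_trans (poisson_series_ge lambda M g0).
rewrite lee_fin; apply: ler_sum => n _; rewrite mulrCA ler_wpM2l ?poisson_pmf_ge0//.
by case: leqP => h; rewrite ?mulr1 ?mulr0// le_checks.
Qed.

End sample_expectations.

(** * Asymptotics *)

Section growth.
Context (R : realType).
Implicit Types (f g : R -> R) (x y e : R).

Lemma is_Theta_near f g c1 c2 : 0 < c1 -> 0 < c2 ->
  (\forall x \near +oo, [/\ 0 <= g x, c1 * g x <= f x & f x <= c2 * g x]) ->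
  is_Theta f g.
Proof.
move=> c10 c20 fg; split; apply/eqO_exP.
  exists c2 => //=; near=> x; have [g0 fg1 fg2] : [/\ 0 <= g x, c1 * g x <= f x & f x <= c2 * g x].
    by near: x.
  by rewrite !ger0_norm// (le_trans _ fg1)// mulr_ge0// ltW.
exists c1^-1; first by rewrite invr_gt0.
near=> x; have [g0 fg1 fg2] : [/\ 0 <= g x, c1 * g x <= f x & f x <= c2 * g x].
  by near: x.
rewrite !ger0_norm ?(le_trans _ fg1) ?mulr_ge0 ?(ltW c10)//.
by rewrite ler_pdivlMl.
Unshelve. all: by end_near. Qed.

Lemma near_powR_ge e (A : R) : 0 < e -> \forall x \near +oo, A <= x `^ e.
Proof.
move=> e0; near=> x.
have x0 : 0 < x by near: x; exact: nbhs_pinfty_gt.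
have Ax : Num.max A 1 `^ e^-1 <= x by near: x; exact: nbhs_pinfty_ge.
apply: (@le_trans _ _ (Num.max A 1)); first by rewrite le_max lexx.
have m0 : 0 <= Num.max A 1 by rewrite le_max ler01 orbT.
apply: (@le_trans _ _ ((Num.max A 1 `^ e^-1) `^ e)).
  by rewrite -powRrM mulVf ?gt_eqF// powRr1.
by apply: ge0_ler_powR; rewrite ?nnegrE ?powR_ge0// ltW.
Unshelve. all: by end_near. Qed.

Lemma cvg_powRN e : 0 < e -> x `^ (- e) @[x --> +oo] --> (0 : R).
Proof.
move=> e0; apply/cvgrPdist_le => eps eps0; near=> x.
have x0 : 0 < x by near: x; exact: nbhs_pinfty_gt.
have ex : eps^-1 <= x `^ e by near: x; exact: near_powR_ge.
rewrite sub0r normrN ger0_norm ?powR_ge0// powRN.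
by rewrite -[leRHS]invrK lef_pV2 ?posrE ?invr_gt0 ?powR_gt0.
Unshelve. all: by end_near. Qed.

Lemma ln_le_powR e x : 0 < e -> 0 < x -> ln x <= x `^ e / e.
Proof.
move=> e0 x0; rewrite ler_pdivlMr// mulrC -ln_powR.
by apply: ltW; apply: ln_sublinear; exact: powR_gt0.
Qed.

Lemma truncn_bounds y : 1 <= y ->
  y - 1 <= (Num.truncn y)%:R /\ (Num.truncn y)%:R <= y.
Proof.
move=> y1; have /andP[h1 h2] := truncn_itv (le_trans ler01 y1).
by move: h2; rewrite -natr1; split=> //; lra.
Qed.

Lemma truncnS_bounds y : 0 <= y -> y <= (Num.truncn y).+1%:R <= y + 1.
Proof.
move=> y0; have /andP[h1 h2] := truncn_itv y0.
by rewrite (ltW h2) -natr1 lerD2r.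
Qed.

(** For [K] cells and y = x p / K the [K]-th power has exponent 2 sqrt(x p K), which is o(x) as soon
    as [K] is. *)
Lemma one_plus_le_expR_sqrt y : 0 <= y -> 1 + y <= expR (2 * Num.sqrt y).
Proof.
move=> y0; set t := Num.sqrt y.
have t0 : 0 <= t by exact: sqrtr_ge0.
have -> : y = t ^+ 2 by rewrite sqr_sqrtr.
rewrite mulrC expRM_natr; apply: (@le_trans _ _ ((1 + t) ^+ 2)); first by nra.
by rewrite lerXn2r ?nnegrE ?expR_ge0 ?expR_ge1Dx//; lra.
Qed.

End growth.

(** * Law of the radii *)

Section radius_law.
Context disp (T : measurableType disp) (R : realType) (P : probability T R).
Context (rbar : R) (R0 R0' : {RV P >-> R}) (d : nat).
Hypothesis R0_bounded : {ae P, forall w, 0 < R0 w <= rbar}.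
Local Notation rho := (distribution P R0 : probability R R).

Lemma radius_law_support : rho `]0, rbar]%classic = 1%E.
Proof.
rewrite /distribution /pushforward.
have m : measurable (R0 @^-1` `]0, rbar]%classic).
  by rewrite -[X in measurable X]setTI; exact: measurable_funPT.
have [N [mN N0 NR]] := R0_bounded.
have e : P (~` (R0 @^-1` `]0, rbar]%classic)) = 0%E.
  apply/eqP; rewrite eq_le measure_ge0 andbT -N0; apply: le_measure; rewrite ?inE//.
    exact: measurableC.
move: e; rewrite probability_setC// prE// -EFinD => -[] /eqP.
rewrite subr_eq0 => /eqP h; apply: etrans (prE _ m) _.
by rewrite -h.
Qed.

(** The intervals [[1/(n+1), rbar]] increase to the support []0, rbar]]. *)
Lemma radius_law_large (eps : R) : 0 < eps ->
  exists2 a : R, 0 < a & ((1 - eps)%:E < rho `[a, rbar]%classic)%E.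
Proof.
move=> eps0.
pose F (n : nat) : set R := `[n.+1%:R^-1, rbar]%classic.
have FE : \bigcup_n F n = `]0, rbar]%classic.
  apply/seteqP; split=> x /=.
    by move=> [n _]; rewrite /F /= !in_itv/= => /andP[h ->]; rewrite (lt_le_trans _ h)// invr_gt0.
  rewrite in_itv/= => /andP[x0 xr]; exists (Num.truncn x^-1) => //.
  rewrite /F /= in_itv/= xr andbT.
  have /andP[_ h] := truncn_itv (ltW (etrans (invr_gt0 x) x0 : 0 < x^-1)).
  by rewrite -[leRHS]invrK lef_pV2 ?posrE ?invr_gt0// ltW.
have ndF : nondecreasing_seq F.
  move=> m n mn; apply/subsetPset => x; rewrite /F /= !in_itv/= => /andP[h ->].
  by rewrite andbT (le_trans _ h)// lef_pV2 ?posrE// ler_nat ltnS.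
have cvF : (rho \o F) n @[n --> \oo] --> (1 : \bar R)%E.
  rewrite -radius_law_support -FE; apply: nondecreasing_cvg_mu => //.
  - by move=> n; exact: measurable_itv.
  - by rewrite FE; exact: measurable_itv.
apply: contrapT => H.
have : (limn (rho \o F) <= (1 - eps)%:E)%E.
  apply: lime_le; first by apply/cvg_ex; eexists; exact: cvF.
  apply: nearW => n; rewrite leNgt; apply/negP => h; apply: H.
  by exists n.+1%:R^-1; rewrite ?invr_gt0.
by rewrite (cvg_lim _ cvF)// lee_fin; lra.
Qed.

Hypothesis R0_copy : independent_copy R0 R0'.

Lemma independent_copy_law (A B : set R) : measurable A -> measurable B ->
  P (R0 @^-1` A `&` R0' @^-1` B) = (rho A * rho B)%E.
Proof.
move=> mA mB; have [law indep] := R0_copy.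
have := indep [fset true; false]%fset
  (fun b : bool => if b then R0 @^-1` A else R0' @^-1` B).
rewrite big_fsetU1 ?inE//= big_seq_fset1 /= => h.
rewrite (_ : _ `&` _ = \bigcap_(i in [set` [fset true; false]%fset])
  (if i then R0 @^-1` A else R0' @^-1` B)).
  rewrite h; first by congr (_ * _)%E; exact/esym/law.
  by move=> [] _; [exists A|exists B].
apply/seteqP; split=> w /=; first by move=> [wA wB] [].
by move=> H; split; [apply: (H true)|apply: (H false)]; rewrite /= !inE.
Qed.

Lemma mean_pair_size_copy :
  expectation P (fun w => (R0 w + R0' w) ^+ d) = mean_pair_size d rbar rho.
Proof.
have [law _] := R0_copy.
pose f (w : T) : R * R := (R0 w, R0' w).
have mR : measurable_fun setT (R0 : T -> R) by exact: measurable_funPT.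
have mR' : measurable_fun setT (R0' : T -> R) by exact: measurable_funPT.
have mf : measurable_fun setT f by exact: measurable_fun_pair.
have mg : measurable_fun setT (fun z => (pair_size d rbar z)%:E).
  by apply/measurable_EFinP; exact: measurable_pair_size.
transitivity (\int[P]_w (pair_size d rbar (f w))%:E)%E.
  rewrite unlock; apply: ae_eq_integral => //.
  - by apply/measurable_EFinP; apply: measurable_funX; exact: measurable_funD.
  - by apply: (measurableT_comp mg).
  have R0'_bounded : {ae P, forall w, 0 < R0' w <= rbar}.
    exists (~` (R0' @^-1` `]0, rbar]%classic)); split.
    - by apply: measurableC; rewrite -[X in measurable X]setTI; exact: mR'.
    - rewrite probability_setC; last by rewrite -[X in measurable X]setTI; exact: mR'.
      have e : P (R0' @^-1` `]0, rbar]%classic) = 1%E.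
        by rewrite -law//; exact: radius_law_support.
      by rewrite e subee.
    - by move=> w h h'; apply: h; move: h'; rewrite /= in_itv.
  apply: filterS2 R0_bounded R0'_bounded => w h h' _.
  by rewrite /f /pair_size /= h h'.
transitivity (\int[pushforward P f]_z (pair_size d rbar z)%:E)%E.
  rewrite (ge0_integral_pushforward mf)//.
  by move=> z _; rewrite lee_fin pair_size_ge0.
apply/esym; apply: eq_measure_integral => A mA _.
apply: (product_measure_unique (m' := image_measure P mf)) => // B C mB mC.
exact: independent_copy_law.
Qed.

(** For some [a > 0] both radii are at least [a] with positive probability, and then the size is at
    least [(2 * a) ^+ d]. *)
Lemma mean_pair_size_gt0 : (0 < mean_pair_size d rbar rho)%E.
Proof.
have [a a0 rhoa] := radius_law_large (@ltr01 R).
rewrite subrr in rhoa.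
set C := `[a, rbar]%classic in rhoa.
have mC : measurable C by exact: measurable_itv.
apply: (@lt_le_trans _ _ (\int[(rho \x rho)%E]_z (((2 * a) ^+ d)%:E * (\1_(C `*` C) z)%:E))%E).
  rewrite ge0_integralZl//; last 2 first.
  - by apply/measurable_EFinP; apply: measurable_indic; exact: measurableX.
  - by rewrite lee_fin exprn_ge0// mulr_ge0// ltW.
  rewrite integral_indic//; last exact: measurableX.
  have rC := product_measure1E rho rho mC mC.
  rewrite setIT; apply: lt_le_trans (_ : (0 < ((2 * a) ^+ d)%:E * (rho C * rho C))%E) _.
    by rewrite mule_gt0// ?lte_fin ?exprn_gt0 ?mulr_gt0// mule_gt0.
  by rewrite -rC.
apply: ge0_le_integral => //.
- by move=> z _; rewrite mule_ge0// lee_fin ?exprn_ge0// ?mulr_ge0// ltW.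
- apply: emeasurable_funM => //; apply/measurable_EFinP; apply: measurable_indic.
  exact: measurableX.
- by apply/measurable_EFinP; exact: measurable_pair_size.
- move=> [x y] _; rewrite -EFinM lee_fin indicE.
  have [|] := boolP ((x, y) \in C `*` C); last by rewrite mulr0 pair_size_ge0.
  rewrite inE /C /= !in_itv/= => -[/andP[x1 x2] /andP[y1 y2]].
  rewrite mulr1 /pair_size /= x2 y2 !andbT.
  rewrite (lt_le_trans a0 x1) (lt_le_trans a0 y1) /=.
  by rewrite lerXn2r ?nnegrE//; lra.
Qed.

End radius_law.

Lemma unit_ball_volume_gt0 (R : realType) d : 0 < unit_ball_volume R d.
Proof.
rewrite lt_neqAle unit_ball_volume_ge0 andbT eq_sym; apply/negP => /eqP v0.
have := integral_ball_volume_expR R d.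
rewrite (eq_integral (cst 0%E)) => [|t _].
  rewrite integral0 => -[] /eqP; rewrite eq_sym expf_eq0 sqrtr_eq0 leNgt pi_gt0 andbF//.
have [t0|t0] := leP t 0; first by rewrite ball_volume_le0// mul0e.
rewrite -{1}(sqr_sqrtr (ltW t0)) ball_volume_sqr ?sqrtr_gt0// ball_volume1 v0.
by rewrite mule0 mul0e.
Qed.

(** * Growth of the number of checks and of -ln P *)

Section asymptotics.
Context (R : realType) (d : nat) (rbar eta : R).
Local Notation spheres := (config R (nat * option 'I_d)%type).
Implicit Types (b : boundary) (x : R).
Context (rho : probability R R) (Q : probability spheres R).
Hypothesis Qrho : product_law (fun k => sphere_marginal rho k.2) Q.
Hypothesis rho_pos : rho `]0, rbar]%classic = 1%E.
Hypothesis rho_large : forall eps : R, 0 < eps ->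
  exists2 a : R, 0 < a & ((1 - eps)%:E < rho `[a, rbar]%classic)%E.
Hypothesis d_gt0 : (0 < d)%N.
Hypothesis eta_gt0 : 0 < eta.
Local Notation ed := (eta * d%:R).
Local Notation excluded := (excluded d rbar rho).
Local Notation V := (excluded 1).
Local Notation radius x := (x `^ eta)^-1.
Hypothesis V_gt0 : 0 < V.

Lemma excludedE r : excluded r = V * r ^+ d.
Proof. by rewrite /excluded expr1n; ring. Qed.

Lemma powR_ed x : x `^ ed = (x `^ eta) ^+ d.
Proof. by rewrite powRrM powR_mulrn ?powR_ge0. Qed.

Lemma excluded_radius x : excluded (radius x) = V / x `^ ed.
Proof. by rewrite excludedE exprVn powR_ed. Qed.

Lemma point_prob_large eps : 0 < eps ->
  exists2 a : R, 0 < a & 1 - eps < point_prob Q (large a).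
Proof.
move=> eps0; have [a a0 ha] := rho_large eps0; exists a => //.
rewrite -lte_fin; apply: lt_le_trans ha _.
have h : Q [set w | `[a, +oo[%classic (w (0%N, None))] = rho `[a, +oo[%classic.
  by apply: etrans (pr_coord Qrho (0%N, None) (measurable_itv _)) _.
rewrite /point_prob -prE; last first.
  by rewrite -[X in measurable X]setTI; apply: measurable_sphere_at => //; exact: measurable_large.
rewrite (_ : [set w : spheres | large a (sphere_at w 0)] =
  [set w | `[a, +oo[%classic (w (0%N, None))]); last first.
  by apply/seteqP; split=> w; rewrite /large /= in_itv /= andbT.
rewrite h; apply: le_measure; rewrite ?inE; try exact: measurable_itv.
by move=> x /=; rewrite !in_itv/= andbT => /andP[].
Qed.

(** The cell side is chosen just below [2 * a * radius x / d]. Rounding up costs at most 1, which is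
    absorbed into a multiple of the inverse radius since that is at least 1. *)
Lemma grid_exists (a : R) : 0 < a -> exists2 c, 0 < c & forall x, 1 <= x ->
  exists k, d%:R / k.+1%:R < 2 * a * radius x /\ (k.+1 ^ d)%:R <= c * x `^ ed.
Proof.
move=> a0; exists ((d%:R / (2 * a) + 1) ^+ d).
  by rewrite exprn_gt0// ltr_wpDl// divr_ge0// mulr_ge0// ltW.
move=> x x1; have u1 : 1 <= x `^ eta by rewrite -(powRr0 x) ler_powR// ltW.
set u := x `^ eta in u1 *.
exists (Num.truncn (d%:R / (2 * a) * u)).
set y := _ * u.
have u0 : 0 < u by rewrite (lt_le_trans _ u1).
have y0 : 0 <= y by apply: mulr_ge0; [apply: divr_ge0 => //; lra|exact: ltW].
have da0 : 0 <= d%:R / (2 * a) by apply: divr_ge0 => //; lra.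
split.
  have /andP[_ h] := truncn_itv y0.
  have h2 : d%:R < (Num.truncn y).+1%:R * (2 * a / u).
    rewrite (_ : d%:R = y * (2 * a / u)); last by rewrite /y; field; lra.
    by rewrite ltr_pM2r// divr_gt0//; lra.
  by rewrite ltr_pdivrMr// mulrC.
have /andP[_ h] := truncnS_bounds y0.
rewrite powR_ed -exprMn natrX; apply: lerXn2r; rewrite ?nnegrE//.
  by apply: mulr_ge0; [lra|exact: ltW].
by apply: (le_trans h); rewrite mulrDl mul1r lerD2l.
Qed.

Lemma checks_le : exists2 C, 0 < C & forall b x n, 1 <= x ->
  checks eta x b Q n <= C * x `^ ed.
Proof.
have [a a0 pa] := @point_prob_large 1 ltr01; rewrite subrr in pa.
have [c c0 hc] := grid_exists a0.
set p := point_prob _ _ in pa.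
(* From [(2 * K + 1) / p ^+ 2] with at most c x^ed cells, the 1 being at most x^ed. *)
exists ((2 * c + 1) / p ^+ 2).
  by rewrite divr_gt0 ?exprn_gt0//; lra.
move=> b x n x1; have [k [k1 k2]] := hc x x1.
have L1 : 1 <= x `^ ed by rewrite powR_ed exprn_ege1// -(powRr0 x) ler_powR// ltW.
have r0 : 0 < radius x by rewrite invr_gt0 powR_gt0// (lt_le_trans _ x1).
apply: (@le_trans _ _ (\sum_(m < n) m%:R * packing_prob Q Euclidean (radius x) m)).
  apply: ler_sum => m _; rewrite ler_wpM2l//; case: (b) => //.
  exact: packing_probET.
apply: le_trans (sum_packing_prob_le Qrho rho_pos r0 k1 _ pa) _.
rewrite mulrAC ler_pM2r ?invr_gt0 ?exprn_gt0//.
by nra.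
Qed.

Lemma sum_ord_natr n : \sum_(m < n) m%:R = n%:R * (n%:R - 1) / 2 :> R.
Proof.
elim: n => [|n IHn]; first by rewrite big_ord0 !mul0r.
by rewrite big_ord_recr /= IHn -natr1; field.
Qed.

(** With [n] of order x^(min(ed, 2) / 2), fewer than [n] spheres do not overlap with probability at
    least 1/2, so the sum is of order n^2. *)
Lemma checks_ge b : exists2 c, 0 < c & \forall x \near +oo, exists n : nat,
  n%:R <= x / 4 /\ c * x `^ Num.min ed 2 <= checks eta x b Q n.
Proof.
(* [K <= 1/4] gives [n <= x / 4], and [K ^+ 2 * (2 * V) <= 1] keeps i^2 V / x^ed at most 1/2 for
   [i < n]. *)
pose K := Num.min 4^-1 (1 + 2 * V)^-1.
have K0 : 0 < K by rewrite lt_min !invr_gt0 ltr0n ltr_wpDr// mulr_ge0// ltW.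
have K4 : K <= 4^-1 by rewrite ge_min lexx.
have KV : K ^+ 2 * (2 * V) <= 1.
  have KV : K <= (1 + 2 * V)^-1 by rewrite ge_min lexx orbT.
  have : K * (1 + 2 * V) <= 1 by rewrite -ler_pdivlMr ?mul1r// ltr_wpDr// mulr_ge0// ltW.
  by nra.
pose m := Num.min ed 2 / 2.
have ed0 : 0 < ed by rewrite mulr_gt0// ltr0n.
have m0 : 0 < m by rewrite divr_gt0// lt_min ed0/=.
have m1 : m <= 1 by rewrite ler_pdivrMr// mul1r ge_min lexx orbT.
exists (K ^+ 2 / 11); first by rewrite divr_gt0// exprn_gt0.
near=> x.
have x1 : 1 <= x by near: x; exact: nbhs_pinfty_ge.
have t4 : 4 / K <= x `^ m by near: x; exact: near_powR_ge.
pose t := K * x `^ m; exists (Num.truncn t).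
have tt : t ^+ 2 = K ^+ 2 * x `^ Num.min ed 2.
  by rewrite exprMn -(powR_mulrn 2 (powR_ge0 x m)) -powRrM divfK.
have {}t4 : 4 <= t by rewrite /t mulrC -ler_pdivrMr.
have [n1 n2] : t - 1 <= (Num.truncn t)%:R /\ (Num.truncn t)%:R <= t.
  by apply: truncn_bounds; lra.
set n := Num.truncn t in n1 n2 *.
have x0 : 0 < x by lra.
split.
  apply: (le_trans n2); have xm : x `^ m <= x by exact: ler1_powR.
  by rewrite /t mulrC; apply: ler_pM => //; [exact: powR_ge0|lra].
have r0 : 0 < radius x by rewrite invr_gt0 powR_gt0.
have L0 : 0 < x `^ ed by exact: powR_gt0.
apply: (@le_trans _ _ (\sum_(i < n) i%:R / 2)); last first.
  apply: ler_sum => i _; rewrite ler_wpM2l//.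
  apply: (@le_trans _ _ (packing_prob Q Torus (radius x) i)); last first.
    by case: (b) => //; exact: packing_probET.
  apply: le_trans (packing_prob_ge_sqr Qrho rho_pos i r0); rewrite excluded_radius.
  have iLt : i%:R ^+ 2 <= t ^+ 2.
    have it : i%:R <= t by rewrite (le_trans _ n2)// ler_nat ltnW.
    by apply: lerXn2r; rewrite ?nnegrE//; lra.
  have Lm : x `^ Num.min ed 2 <= x `^ ed by rewrite ler_powR// ge_min lexx.
  suff : i%:R ^+ 2 * (V / x `^ ed) <= 2^-1 by lra.
  rewrite mulrA ler_pdivrMr//.
  have h1 : i%:R ^+ 2 * V <= t ^+ 2 * V by rewrite ler_wpM2r// ltW.
  have h2 : K ^+ 2 * (2 * V) * x `^ Num.min ed 2 <= x `^ Num.min ed 2.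
    by rewrite ler_piMl// powR_ge0.
  rewrite tt in h1; nra.
(* Since [n >= t - 1] and [t >= 4], n (n - 1) / 4 >= (t - 1) (t - 2) / 4 >= t^2 / 11, whence the
   constant 11. *)
rewrite -mulr_suml sum_ord_natr.
have -> : K ^+ 2 / 11 * x `^ Num.min ed 2 = t ^+ 2 / 11 by rewrite tt; ring.
by nra.
Unshelve. all: by end_near. Qed.

Definition decay b x : R := - ln (no_overlap Q b x (radius x)).

Lemma decayE b x : 0 <= x -> no_overlap Q b x (radius x) = expR (- decay b x).
Proof. by move=> x0; rewrite opprK lnK// posrE no_overlap_gt0. Qed.

Lemma decay_ge b x y : 0 <= x -> no_overlap Q b x (radius x) <= expR (- y) ->
  y <= decay b x.
Proof. by move=> x0; rewrite decayE// ler_expR lerN2. Qed.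

Lemma decay_le b x y : 0 <= x -> expR (- y) <= no_overlap Q b x (radius x) ->
  decay b x <= y.
Proof. by move=> x0; rewrite decayE// ler_expR lerN2. Qed.

Lemma decay_ge0 b x : 0 <= x -> 0 <= decay b x.
Proof. by move=> x0; apply: decay_ge => //; rewrite oppr0 expR0 no_overlap_le1. Qed.

Lemma decay_le_id b x : 0 <= x -> decay b x <= x.
Proof. by move=> x0; apply: decay_le => //; exact: no_overlap_ge. Qed.

Lemma decayET x : 0 <= x -> decay Euclidean x <= decay Torus x.
Proof. by move=> x0; apply: decay_ge => //; rewrite -decayE// no_overlapET. Qed.

Lemma decay_le_Torus b x : 0 <= x -> decay b x <= decay Torus x.
Proof. by case: b => // /decayET. Qed.

Lemma decay_ge_Euclidean b x : 0 <= x -> decay Euclidean x <= decay b x.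
Proof. by case: b => // /decayET. Qed.

Let ed_gt0 : 0 < ed. Proof. by rewrite mulr_gt0// ltr0n. Qed.

Lemma decay_quadratic b : \forall x \near +oo, decay b x <= x ^+ 2 / (2 * (x `^ ed / V - 1)).
Proof.
have V0 := V_gt0.
near=> x.
have x0 : 0 < x by near: x; exact: nbhs_pinfty_gt.
have LV : 2 * V <= x `^ ed by near: x; exact: near_powR_ge.
have LV2 : 2 <= x `^ ed / V by rewrite ler_pdivlMr.
have [K1 K2] : x `^ ed / V - 1 <= (Num.truncn (x `^ ed / V))%:R /\
    (Num.truncn (x `^ ed / V))%:R <= x `^ ed / V by apply: truncn_bounds; lra.
set K := Num.truncn _ in K1 K2.
have L0 : 0 < x `^ ed by exact: powR_gt0.
have KR : 0 < K%:R :> R by lra.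
apply: le_trans (decay_le_Torus b (ltW x0)) _.
apply: (@le_trans _ _ (x ^+ 2 / (2 * K%:R))).
  apply: decay_le; first exact: ltW.
  apply: (no_overlap_Torus_quadratic Qrho rho_pos); rewrite ?invr_gt0 ?powR_gt0 ?(ltW x0)//.
    by rewrite -(ltr0n R).
  by rewrite excluded_radius mulrA ler_pdivrMr// mul1r -ler_pdivlMr.
rewrite ler_wpM2l ?sqr_ge0// lef_pV2 ?posrE; lra.
Unshelve. all: by end_near. Qed.

Lemma decay_le_const b : 2 <= ed -> \forall x \near +oo, decay b x <= V.
Proof.
have V0 := V_gt0 => ed2; near=> x.
have x1 : 1 <= x by near: x; exact: nbhs_pinfty_ge.
have x0 : 0 < x by lra.
have LV : 2 * V <= x `^ ed by near: x; exact: near_powR_ge.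
have LV2 : 2 <= x `^ ed / V by rewrite ler_pdivlMr.
have h : decay b x <= x ^+ 2 / (2 * (x `^ ed / V - 1)) by near: x; exact: decay_quadratic.
apply: (le_trans h).
have xL : x ^+ 2 <= x `^ ed by rewrite -powR_mulrn ?ler_powR// ltW.
rewrite ler_pdivrMr; last by lra.
have -> : V * (2 * (x `^ ed / V - 1)) = 2 * x `^ ed - 2 * V by field; lra.
by lra.
Unshelve. all: by end_near. Qed.

Lemma powR_gt0D x y z : 0 < x -> x `^ (y + z) = x `^ y * x `^ z.
Proof. by move=> x0; rewrite powRD// (gt_eqF x0) implybT. Qed.

Lemma powR2B x : 0 < x -> x `^ (2 - ed) = x ^+ 2 / x `^ ed.
Proof. by move=> x0; rewrite (powR_gt0D _ _ x0) powRN -powR_mulrn// ltW. Qed.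

(** The two-sphere bound in each box, with 1 - w <= exp (-w). Writing K for [k.+1], the powers of K
    cancel in K^d (x / K^d)^2 (r K)^d = x^2 r^d, so [k] survives only in the correction factors. *)
Lemma decay_subdivide k x : 0 < x -> 2 * (2 * rbar * (radius x * k.+1%:R)) < 1 ->
  V / 2 * (expR (- (x / k.+1%:R ^+ d)) * (1 - 2 * (2 * rbar * (radius x * k.+1%:R))) ^+ d)
    * (x ^+ 2 / x `^ ed) <= decay Euclidean x.
Proof.
move=> x0 kr; apply: decay_ge; first exact: ltW.
have r0 : 0 < radius x * k.+1%:R by rewrite mulr_gt0// invr_gt0 powR_gt0.
apply: le_trans (no_overlap_subdivide Qrho rho_pos k _ (ltW x0)) _.
have y0 : 0 <= x / k.+1%:R ^+ d by rewrite divr_ge0 ?exprn_ge0// ltW.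
set w := expR (- (x / k.+1%:R ^+ d)) * ((x / k.+1%:R ^+ d) ^+ 2 / 2) *
  (excluded (radius x * k.+1%:R) * (1 - 2 * (2 * rbar * (radius x * k.+1%:R))) ^+ d).
apply: (@le_trans _ _ (expR (- w) ^+ (k.+1 ^ d))).
  apply: lerXn2r; rewrite ?nnegrE ?expR_ge0 ?(ltW (no_overlap_gt0 _ _ _ _))//.
  apply: le_trans (no_overlap_pair Qrho rho_pos y0 r0 kr) _.
  exact: expR_ge1Dx.
rewrite -expRM_natr ler_expR natrX /w excludedE (exprMn _ (radius x)) (exprVn (x `^ eta))
  -powR_ed le_eqVlt.
apply/orP; left; apply/eqP; field.
by rewrite expf_neq0 ?pnatr_eq0//= gt_eqF// powR_gt0.
Qed.

Lemma cvg_decay_intermediate b : 1 < ed < 2 ->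
  decay b x / x `^ (2 - ed) @[x --> +oo] --> V / 2.
Proof.
have V0 := V_gt0 => /andP[ed1 ed2].
(* The midpoint of 1/d and eta: with x^a boxes per axis, both the mean number of spheres in a box
   and the radius relative to the box tend to 0. *)
pose a := (d%:R^-1 + eta) / 2.
have dR : 0 < d%:R :> R by rewrite ltr0n.
have ad : 0 < a * d%:R - 1.
  by rewrite (_ : a * d%:R = (1 + ed) / 2); [lra|rewrite /a; field; lra].
have a0 : 0 < a by rewrite divr_gt0// addr_gt0// invr_gt0.
have ae : 0 < eta - a.
  by have : d%:R^-1 < eta; [rewrite -[ltLHS]mul1r ltr_pdivrMr|rewrite /a; lra].
(* The 8 comes from [2 * (2 * rbar * (radius x * k.+1))] with [k.+1] at most twice x^a. *)
pose lo x := V / 2 * (expR (- x `^ (- (a * d%:R - 1))) * (1 - 8 * rbar * x `^ (- (eta - a))) ^+ d).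
pose up x := V / 2 * (1 - V * x `^ (- ed))^-1.
have c1 := cvg_powRN ad. have c2 := cvg_powRN ae. have c3 := cvg_powRN ed_gt0.
have clo : lo x @[x --> +oo] --> V / 2.
  rewrite -[X in _ --> X]mulr1; apply: cvgMr.
  rewrite -[X in _ --> X]mulr1; apply: cvgM.
    rewrite [X in _ --> X](_ : _ = expR (- 0)); last by rewrite oppr0 expR0.
    apply: (@continuous_cvg _ _ _ _ _ _ (@expR R)); first exact: continuous_expR.
    exact: (cvgN c1).
  rewrite [X in _ --> X](_ : _ = (1 - 8 * rbar * 0) ^+ d); last by rewrite mulr0 subr0 expr1n.
  apply: (@continuous_cvg _ _ _ _ _ _ (fun y : R => y ^+ d)); first exact: exprn_continuous.
  apply: cvgB; first exact: cvg_cst.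
  exact: cvgMr.
have cup : up x @[x --> +oo] --> V / 2.
  rewrite -[X in _ --> X]mulr1; apply: cvgMr.
  rewrite -[X in _ --> X]invr1; apply: cvgV; first exact: oner_neq0.
  rewrite -[X in _ --> X]subr0 -(mulr0 V); apply: cvgB; first exact: cvg_cst.
  exact: cvgMr.
apply: squeeze_cvgr clo cup; near=> x.
have x1 : 1 <= x by near: x; exact: nbhs_pinfty_ge.
have x0 : 0 < x by lra.
have LV : 2 * V <= x `^ ed by near: x; exact: near_powR_ge.
have u0 : 0 < x `^ eta by exact: powR_gt0.
have L0 : 0 < x `^ ed by exact: powR_gt0.
have X0 : 0 < x `^ (2 - ed) by exact: powR_gt0.
have rb := radius_bound_gt0 rho_pos.
apply/andP; split; last first.
  have h : decay b x <= x ^+ 2 / (2 * (x `^ ed / V - 1)) by near: x; exact: decay_quadratic.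
  rewrite ler_pdivrMr//; apply: (le_trans h); rewrite /up powRN powR2B//.
  rewrite le_eqVlt; apply/orP; left; apply/eqP; field; lra.
rewrite ler_pdivlMr//; apply: le_trans (decay_ge_Euclidean b (ltW x0)).
pose k := Num.truncn (x `^ a).
have xa1 : 1 <= x `^ a by rewrite -(powRr0 x) ler_powR// ltW.
have /andP[k1 k2] := truncnS_bounds (le_trans ler01 xa1).
have rk : radius x * k.+1%:R <= 2 * x `^ (- (eta - a)).
  rewrite opprB (powR_gt0D _ _ x0) powRN.
  rewrite (_ : 2 * (_ * _) = radius x * (2 * x `^ a)); last by ring.
  by rewrite ler_wpM2l ?invr_ge0 ?powR_ge0// /k; lra.
have hs : 8 * rbar * x `^ (- (eta - a)) <= 2^-1.
  have h : 16 * rbar <= x `^ (eta - a) by near: x; exact: near_powR_ge.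
  by rewrite powRN ler_pdivrMr ?powR_gt0//; lra.
have kr : 2 * (2 * rbar * (radius x * k.+1%:R)) <= 8 * rbar * x `^ (- (eta - a)).
  by nra.
apply: le_trans (decay_subdivide x0 (le_lt_trans kr _)); last by lra.
rewrite powR2B// ler_wpM2r ?divr_ge0 ?sqr_ge0 ?(ltW L0)// ler_wpM2l//; first by lra.
apply: ler_pM; rewrite ?expR_ge0 ?exprn_ge0//; first by lra.
  rewrite ler_expR lerN2 opprB (powR_gt0D _ _ x0) powRr1 ?(ltW x0)//.
  rewrite powRN ler_wpM2l ?(ltW x0)// lef_pV2 ?posrE ?exprn_gt0 ?powR_gt0//.
  by rewrite powRrM powR_mulrn ?powR_ge0// lerXn2r ?nnegrE ?powR_ge0.
by apply: lerXn2r; rewrite ?nnegrE//; lra.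
Unshelve. all: by end_near. Qed.

Lemma cvg_decay_small b : ed < 1 -> decay b x / x @[x --> +oo] --> (1 : R).
Proof.
move=> ed1; apply/cvgrPdist_le => eps eps0.
have e20 : 0 < eps / 2 by rewrite divr_gt0.
have [a a0 pa] := point_prob_large e20.
set p := point_prob _ _ in pa.
have [c c0 hc] := grid_exists a0.
have p0 : 0 <= p by exact: point_prob_ge0.
have p1 : p <= 1.
  apply: pr_le1; rewrite -[X in measurable X]setTI.
  by apply: measurable_sphere_at => //; exact: measurable_large.
have e1 : 0 < 1 - ed by lra.
near=> x.
have x1 : 1 <= x by near: x; exact: nbhs_pinfty_ge.
have x0 : 0 < x by lra.
have [k [k1 k2]] := hc x x1.
have r0 : 0 < radius x by rewrite invr_gt0 powR_gt0.
have h := no_overlap_birthday Qrho rho_pos (ltW x0) r0 k1.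
rewrite -/p in h; set K : R := (k.+1 ^ d)%:R in h k2.
have K0 : 0 < K by rewrite ltr0n expn_gt0.
have y0 : 0 <= x * p / K by rewrite divr_ge0 ?mulr_ge0// ltW.
have dE : p * x - 2 * Num.sqrt (x * p / K) * K <= decay b x.
  apply: le_trans (decay_ge_Euclidean b (ltW x0)); apply: decay_ge; first exact: ltW.
  apply: (le_trans h); rewrite opprB [X in _ <= expR X]addrC expRD ler_wpM2l ?expR_ge0//.
  rewrite expRM_natr; apply: lerXn2r; rewrite ?nnegrE ?expR_ge0 ?addr_ge0//.
  exact: one_plus_le_expR_sqrt.
(* The left side is sqrt(x p K) with [K] at most c x^ed and ed < 1. Half of [eps] pays for [1 - p],
   the other half for twice this term. *)
have sq : Num.sqrt (x * p / K) * K <= eps / 4 * x.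
  have ex : c / (eps / 4) ^+ 2 <= x `^ (1 - ed) by near: x; exact: near_powR_ge.
  rewrite (powR_gt0D _ _ x0) powRN powRr1 ?(ltW x0)// in ex.
  have L0 : 0 < x `^ ed by exact: powR_gt0.
  rewrite ler_pdivrMr ?exprn_gt0 ?divr_gt0// in ex.
  rewrite -(@ler_pXn2r _ 2) ?nnegrE ?mulr_ge0 ?sqrtr_ge0 ?(ltW K0) ?(ltW x0)//; last by lra.
  rewrite exprMn sqr_sqrtr//.
  have -> : x * p / K * K ^+ 2 = p * K * x by field; lra.
  have pK : p * K <= c * x `^ ed by nra.
  have cx : c * x `^ ed <= x * (eps / 4) ^+ 2.
    rewrite -ler_pdivlMr//; apply: (le_trans ex); rewrite le_eqVlt; apply/orP; left.
    by apply/eqP; ring.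
  apply: le_trans (ler_wpM2r (ltW x0) (le_trans pK cx)) _.
  by rewrite le_eqVlt; apply/orP; left; apply/eqP; ring.
have dle := decay_le_id b (ltW x0).
have d1 : decay b x / x <= 1 by rewrite ler_pdivrMr// mul1r.
rewrite ger0_norm; last by lra.
rewrite lerBlDr -lerBlDl ler_pdivlMr//; nra.
Unshelve. all: by end_near. Qed.

(** * The critical case eta d = 1 *)

Section critical.
Hypothesis ed1 : ed = 1.

(** For eta d = 1 the model at intensity [s ^+ d * x] is the model at [x] seen in a box of side [s]:
    intensity plays the role of volume. *)
Let radius_scale (s : R) x : 0 < s -> 0 < x -> radius (s ^+ d * x) = radius x / s.
Proof.
move=> s0 x0; have -> : s ^+ d = s `^ d%:R by rewrite powR_mulrn// ltW.
rewrite powRM ?powR_ge0 ?(ltW x0)// -powRrM [_ * eta]mulrC ed1 powRr1 ?(ltW s0)//.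
by rewrite invfM mulrC.
Qed.

Lemma decay_Euclidean_subdivide k x : 0 < x ->
  k.+1%:R ^+ d * decay Euclidean x <= decay Euclidean (k.+1%:R ^+ d * x).
Proof.
move=> x0; have k0 : 0 < k.+1%:R :> R by [].
have kx : 0 <= k.+1%:R ^+ d * x by rewrite mulr_ge0 ?exprn_ge0// ltW.
apply: decay_ge => //; apply: le_trans (no_overlap_subdivide Qrho rho_pos k _ kx) _.
rewrite radius_scale// divfK// mulrAC mulfV ?mul1r ?expf_neq0//.
by rewrite decayE ?(ltW x0)// -expRM_natr natrX mulNr mulrC.
Qed.

(** Intensity [x] is intensity [y] seen in the sub-box with [s ^+ d = x / y], where fewer
    constraints apply. *)
Lemma le_decay_Euclidean x y : 0 < x -> x <= y -> decay Euclidean x <= decay Euclidean y.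
Proof.
move=> x0 xy; have y0 : 0 < y by exact: lt_le_trans xy.
have xy0 : 0 < x / y by rewrite divr_gt0.
pose s := (x / y) `^ eta.
have s0 : 0 < s by exact: powR_gt0.
have sd : s ^+ d = x / y by rewrite -powR_mulrn ?powR_ge0// -powRrM ed1 powRr1// ltW.
have s1 : s <= 1.
  have xy1 : x / y <= 1 by rewrite ler_pdivrMr// mul1r.
  rewrite leNgt; apply/negP => s1.
  have : 1 < s ^+ d by rewrite exprn_egt1 ?lt0n_neq0.
  by rewrite sd ltNge xy1.
apply: decay_ge; first exact: ltW.
have := @no_overlap_subbox _ _ _ _ Qrho y (radius y) s.
rewrite s0 s1 => /(_ isT (ltW y0)) h; apply: (le_trans h).
by rewrite -radius_scale// sd divfK ?gt_eqF// decayE// ltW.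
Qed.

(** The exponential of [- (1 - s ^+ d) * x] is the probability that the boundary layer is empty; the
    rest behaves as a Euclidean box. *)
Lemma decay_Torus_le s x : 0 < x -> s = 1 - 2 * rbar * radius x -> 0 < s ->
  decay Torus x <= (1 - s ^+ d) * x + decay Euclidean (s ^+ d * x).
Proof.
move=> x0 sE s0; have r0 : 0 < radius x by rewrite invr_gt0 powR_gt0.
apply: decay_le; first exact: ltW.
apply: le_trans (no_overlap_Torus_ge Qrho rho_pos (ltW r0) (ltW x0) sE s0).
rewrite opprD expRD ler_wpM2l ?expR_ge0//.
by rewrite -radius_scale// decayE// mulr_ge0 ?exprn_ge0// ltW.
Qed.

(** The two-sphere bound with a single box, [k = 0], is positive once the radii are small. *)
Lemma decay_Euclidean_gt0 : exists2 x, 0 < x & 0 < decay Euclidean x.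
Proof.
have V0 := V_gt0; have rb := radius_bound_gt0 rho_pos.
suff : \forall x \near +oo, 0 < x /\ 0 < decay Euclidean x.
  by move=> /filter_ex [x []]; exists x.
near=> x; have x0 : 0 < x by near: x; exact: nbhs_pinfty_gt.
have u0 : 0 < x `^ eta by exact: powR_gt0.
have ru : 8 * rbar <= x `^ eta by near: x; exact: near_powR_ge.
split=> //; apply: (@lt_le_trans _ _ (V / 2 * (expR (- (x / 1%:R ^+ d)) *
  (1 - 2 * (2 * rbar * (radius x * 1%:R))) ^+ d) * (x ^+ 2 / x `^ ed))).
  have h : rbar * radius x <= 8^-1 by rewrite ler_pdivrMr//; lra.
  have L0 : 0 < x `^ ed by exact: powR_gt0.
  have B0 : 0 < 1 - 2 * (2 * rbar * (radius x * 1%:R)) by lra.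
  apply: mulr_gt0; last by rewrite divr_gt0// exprn_gt0.
  apply: mulr_gt0; first by rewrite divr_gt0.
  by apply: mulr_gt0; [exact: expR_gt0|exact: exprn_gt0].
apply: (@decay_subdivide 0) => //.
have h : rbar * radius x <= 8^-1 by rewrite ler_pdivrMr//; lra.
lra.
Unshelve. all: by end_near. Qed.

(** Superadditivity reaches the intensities K^d x0 and monotonicity fills the gaps: with t = (x /
    x0)^eta and K its integer part, rounding costs (K / t)^d >= (1 - 1 / t)^d. *)
Lemma decay_Euclidean_ratio x0 x : 0 < x0 -> x0 <= x ->
  (1 - x0 `^ eta * radius x) ^+ d * (decay Euclidean x0 / x0) <= decay Euclidean x / x.
Proof.
move=> x00 xx0; have x_gt0 : 0 < x by exact: lt_le_trans xx0.
have u0 : 0 < x0 `^ eta by exact: powR_gt0.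
have u : 0 < x `^ eta by exact: powR_gt0.
have D0 := decay_ge0 Euclidean (ltW x00).
have t1 : 1 <= x `^ eta / x0 `^ eta.
  by rewrite ler_pdivlMr// mul1r; apply: ge0_ler_powR; rewrite ?nnegrE ?(ltW eta_gt0) ?(ltW x00)
    ?(ltW x_gt0).
set t := _ / _ in t1.
have td : t ^+ d * x0 = x.
  by rewrite /t exprMn exprVn -!powR_ed ed1 !powRr1 ?(ltW x00) ?(ltW x_gt0)// divfK// gt_eqF.
have [k1 k2] := truncn_bounds t1.
case: (Num.truncn t) (truncn_gt0 t) k1 k2 => [|k _ k1 k2]; first by rewrite t1.
have kx : k.+1%:R ^+ d * x0 <= x.
  by rewrite -[leRHS]td ler_wpM2r ?(ltW x00)// lerXn2r ?nnegrE//; lra.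
have kx0 : 0 < k.+1%:R ^+ d * x0 by apply: mulr_gt0 => //; exact: exprn_gt0.
have dk := le_trans (decay_Euclidean_subdivide k x00) (le_decay_Euclidean kx0 kx).
rewrite (ler_pdivlMr _ _ x_gt0); apply: le_trans dk.
have -> : (1 - x0 `^ eta / x `^ eta) ^+ d * (decay Euclidean x0 / x0) * x =
    (t - 1) ^+ d * decay Euclidean x0.
  rewrite [X in _ = X ^+ d * _](_ : _ = (1 - x0 `^ eta / x `^ eta) * t); last first.
    by rewrite /t; field; lra.
  by rewrite (exprMn _ _ t) -[X in _ * X = _]td; field; lra.
by rewrite ler_wpM2r// lerXn2r ?nnegrE//; lra.
Qed.

Lemma decay_Euclidean_slope : exists delta : R, [/\ 0 < delta <= 1,
  forall x, 0 < x -> decay Euclidean x <= delta * x &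
  forall eps, 0 < eps -> exists2 x, 0 < x & delta - eps < decay Euclidean x / x].
Proof.
pose S := [set decay Euclidean x / x | x in [set x : R | 0 < x]].
have S1 y : S y -> y <= 1.
  by move=> [x /= x0 <-]; rewrite ler_pdivrMr// mul1r decay_le_id// ltW.
have [x1 x10 dx1] := decay_Euclidean_gt0.
have hS : has_sup S.
  by split; [exists (decay Euclidean x1 / x1), x1|exists 1 => y /S1].
have Sdelta x : 0 < x -> decay Euclidean x <= sup S * x.
  move=> x0; rewrite -ler_pdivrMr//; apply: ub_le_sup; first by case: hS.
  by exists x.
exists (sup S); split=> //.
  apply/andP; split; last by apply: ge_sup => //; case: hS.
  apply: (@lt_le_trans _ _ (decay Euclidean x1 / x1)); first by rewrite divr_gt0.
  by rewrite ler_pdivrMr// Sdelta.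
by move=> eps eps0; have [_ [x /= x0 <-] ?] := sup_adherent eps0 hS; exists x.
Qed.

Lemma cvg_decay_critical b : exists2 delta : R, 0 < delta <= 1 &
  decay b x / x @[x --> +oo] --> delta.
Proof.
have rb := radius_bound_gt0 rho_pos.
have [delta [delta01 Sdelta adherent]] := decay_Euclidean_slope.
exists delta => //; have [delta0 delta1] := andP delta01.
have c1 := cvg_powRN eta_gt0.
have near1 (c y eps : R) : 0 < eps -> \forall x \near +oo,
    `|y - (1 - c * radius x) ^+ d * y| <= eps.
  move=> eps0; suff /cvgrPdist_le/(_ _ eps0) :
    (1 - c * radius x) ^+ d * y @[x --> +oo] --> y by [].
  rewrite -[X in _ --> X]mul1r; apply: cvgMl.
  rewrite [X in _ --> X](_ : _ = (1 - c * 0) ^+ d); last by rewrite mulr0 subr0 expr1n.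
  apply: (@continuous_cvg _ _ _ _ _ _ (fun y : R => y ^+ d)); first exact: exprn_continuous.
  apply: cvgB; first exact: cvg_cst.
  by apply: cvgMr; under eq_fun do rewrite -powRN.
apply/cvgrPdist_le => eps eps0.
have e20 : 0 < eps / 2 by rewrite divr_gt0.
have [x0 x00 dx0] := adherent _ e20.
(* Half of [eps] pays for the choice of [x0] near the supremum, half for the correction factor of
   [decay_Euclidean_ratio]. *)
have below (q e x y : R) : delta - eps / 2 < q -> q - e <= eps / 2 -> e <= x -> x <= y ->
  delta - y <= eps by lra.
have above (t x : R) : 1 - t <= eps -> x <= (1 - t) + delta -> - eps <= delta - x by lra.
have scale (h t : R) : t = 1 - 2 * h -> 0 <= h -> h <= 4^-1 -> 0 < t /\ t <= 1.
  by move=> -> ? ?; split; lra.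
near=> x.
have xx0 : x0 <= x by near: x; apply: nbhs_pinfty_ge; exact: num_real.
have x_gt0 : 0 < x by exact: lt_le_trans xx0.
have ru : 4 * rbar <= x `^ eta by near: x; exact: near_powR_ge.
have u0 : 0 < x `^ eta by exact: powR_gt0.
have near_lo : `|decay Euclidean x0 / x0 -
    (1 - x0 `^ eta * radius x) ^+ d * (decay Euclidean x0 / x0)| <= eps / 2.
  by near: x; exact: near1.
have near_up : `|1 - (1 - (2 * rbar) * radius x) ^+ d * 1| <= eps by near: x; exact: near1.
move: near_lo near_up; rewrite mulr1 => /ler_normlW lo /ler_normlW up.
have lo2 := decay_Euclidean_ratio x00 xx0.
set s := 1 - 2 * rbar * radius x in up.
have h : rbar * radius x <= 4^-1.
  by rewrite (ler_pdivrMr _ _ u0) ler_pdivlMl.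
have h0 : 0 <= rbar * radius x by rewrite mulr_ge0 ?invr_ge0 ?(ltW u0) ?(ltW rb).
have sE : s = 1 - 2 * (rbar * radius x) by rewrite mulrA.
have [s0 s_le1] := scale _ _ sE h0 h.
have s1 : s ^+ d <= 1 by rewrite exprn_ile1// ltW.
have sd0 : 0 < s ^+ d by rewrite exprn_gt0.
have lo3 : decay Euclidean x / x <= decay b x / x.
  by rewrite ler_pM2r ?invr_gt0// decay_ge_Euclidean// ltW.
have up3 : decay b x / x <= (1 - s ^+ d) + delta.
  rewrite ler_pdivrMr//; apply: le_trans (decay_le_Torus b (ltW x_gt0)) _.
  apply: le_trans (decay_Torus_le x_gt0 (erefl s) s0) _.
  have := Sdelta (s ^+ d * x); rewrite mulr_gt0// => /(_ isT) h2.
  rewrite [leRHS]mulrDl lerD2l; apply: (le_trans h2).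
  by rewrite ler_pM2l// ler_piMl// ltW.
by rewrite ler_norml (above _ _ up up3) (below _ _ _ _ dx0 lo lo2 lo3).
Unshelve. all: by end_near. Qed.

End critical.

End asymptotics.

(** * Running time of the algorithm *)

Section algorithm.
Context disp (T : measurableType disp) (R : realType) (P : probability T R).
Context (d : nat) (eta rbar : R) (R0 : {RV P >-> R}).
Context (b : boundary) (s : R -> sample P d) (Citr : R -> R).
Hypothesis d_gt0 : (0 < d)%N.
Hypothesis eta_gt0 : 0 < eta.
Hypothesis R0_bounded : {ae P, forall w, 0 < R0 w <= rbar}.
Hypothesis s_law : forall lambda : R, 0 < lambda -> 2 * rbar / lambda `^ eta < 1 ->
  sample_law R0 eta lambda (s lambda).
Hypothesis cost : iteration_cost_model b s Citr.
Local Notation rho := (distribution P R0 : probability R R).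
Local Notation spheres := (config R (nat * option 'I_d)%type).
Context (Q : probability spheres R).
Hypothesis Qrho : product_law (fun k => sphere_marginal rho k.2) Q.
Local Notation ed := (eta * d%:R).
Local Notation TNAR := (total_cost b s Citr).
Local Notation decay := (decay eta Q b).
Let rho_pos := radius_law_support R0_bounded.

Lemma near_sample_law : \forall x \near +oo, 0 < x /\ sample_law R0 eta x (s x).
Proof.
near=> x; have x0 : 0 < x by near: x; exact: nbhs_pinfty_gt.
split=> //; apply: s_law => //.
have rb := radius_bound_gt0 rho_pos.
have h : 4 * rbar <= x `^ eta by near: x; exact: near_powR_ge.
by rewrite ltr_pdivrMr ?powR_gt0// mul1r; lra.
Unshelve. all: by end_near. Qed.

Lemma excluded1_gt0 : 0 < excluded d rbar rho 1.
Proof.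
rewrite /excluded expr1n mulr1 mulr_gt0 ?unit_ball_volume_gt0//.
by rewrite fine_gt0// mean_pair_size_gt0//= mean_pair_size_lty.
Qed.

Lemma Citr_bounds : exists c1 c2, [/\ 0 < c1, 0 < c2 &
  \forall x \near +oo, c1 * x `^ Num.min ed 2 <= Citr x /\
    Citr x <= c2 * x `^ Num.min ed 2].
Proof.
have V0 := excluded1_gt0.
have rho_large := radius_law_large R0_bounded.
have [C C0 hC] := checks_le Qrho rho_pos rho_large eta_gt0.
have [c c0 hc] := checks_ge Qrho rho_pos d_gt0 eta_gt0 V0 b.
have [k [k' [k0 k'0 hk]]] := cost.
have ed0 : 0 < ed by rewrite mulr_gt0// ltr0n.
pose m := Num.min ed 2; have m0 : 0 < m by rewrite lt_min ed0/=.
(* [m^-1] pays for [ln x] by [ln_le_powR]; [C + 1] covers both values of the minimum, [C] for ed and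
   1 for 2; [c / 2] is the loss from the Poisson tail. *)
exists (k * (c / 2)), (k' * (m^-1 + (C + 1))); split.
- by rewrite !mulr_gt0.
- by rewrite mulr_gt0// !addr_gt0// invr_gt0.
near=> x.
have x4 : 4 <= x by near: x; exact: nbhs_pinfty_ge.
have x0 : 0 < x by lra.
have x1 : 1 <= x by lra.
have [_ law] : 0 < x /\ sample_law R0 eta x (s x) by near: x; exact: near_sample_law.
have [n [n1 n2]] : exists n : nat, n%:R <= x / 4 /\
    c * x `^ Num.min ed 2 <= checks eta x b Q n by near: x; exact: hc.
have [cost1 cost2] : ((k%:E * mean_check_count b (s x) <= (Citr x)%:E) /\
   ((Citr x)%:E <= k'%:E * ((ln x)%:E + mean_check_count b (s x))))%E by near: x; exact: hk.
have lower := mean_check_count_ge b x0 law Qrho rho_pos x4 n1.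
have upper : (mean_check_count b (s x) <= ((C + 1) * x `^ m)%:E)%E.
  rewrite /m minEle; case: ifP => _.
    apply: le_trans (mean_check_count_le x0 law Qrho rho_pos (fun n => hC b x n x1)) _.
    by rewrite lee_fin ler_wpM2r ?powR_ge0//; lra.
  apply: le_trans (mean_check_count_le_sqr b x0 law Qrho rho_pos) _.
  rewrite lee_fin powR_mulrn ?(ltW x0)//; have := sqr_ge0 x; nra.
move: lower upper cost1 cost2.
case: (mean_check_count b (s x)) => [v| |] //; rewrite !lee_fin => lower upper cost1 cost2.
have xm0 : 0 <= x `^ m by exact: powR_ge0.
split; first by apply: le_trans cost1; rewrite -mulrA ler_pM2l//; rewrite -/m in n2 *; lra.
apply: (le_trans cost2); rewrite -mulrA ler_pM2l// mulrDl lerD//.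
by have := ln_le_powR m0 x0; rewrite mulrC.
Unshelve. all: by end_near. Qed.

Lemma total_costE : \forall x \near +oo, TNAR x = Citr x * expR (decay x).
Proof.
near=> x; have [x0 law] : 0 < x /\ sample_law R0 eta x (s x) by near: x; exact: near_sample_law.
rewrite /total_cost (nonoverlap_probE b x0 law Qrho rho_pos) decayE ?(ltW x0)//.
by rewrite expRN invrK.
Unshelve. all: by end_near. Qed.

Lemma is_Theta_iteration_cost : is_Theta Citr (fun x => x `^ Num.min ed 2).
Proof.
have [c1 [c2 [c10 c20 h]]] := Citr_bounds.
apply: (is_Theta_near c10 c20); apply: filterS h => x [h1 h2].
by split=> //; exact: powR_ge0.
Qed.

(** The total cost is [Citr] times [expR (decay x)], so an exponent that eventually equals [decay]
    leaves only the bounds on [Citr]. *)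
Lemma is_Theta_total_cost (g : R -> R) : ed <= 2 ->
  (\forall x \near +oo, g x = decay x) -> is_Theta TNAR (fun x => x `^ ed * expR (g x)).
Proof.
move=> ed2 hg; have [c1 [c2 [c10 c20 h]]] := Citr_bounds.
move: h; rewrite min_l// => h.
apply: (is_Theta_near c10 c20).
apply: filterS3 h hg total_costE => x [h1 h2] -> ->; split.
- by rewrite mulr_ge0 ?powR_ge0 ?expR_ge0.
- by rewrite mulrA ler_wpM2r ?expR_ge0.
- by rewrite mulrA ler_wpM2r ?expR_ge0.
Qed.

Lemma is_Theta_total_cost_sqr : 2 <= ed -> is_Theta TNAR (fun x => x ^+ 2).
Proof.
move=> ed2; have [c1 [c2 [c10 c20 h]]] := Citr_bounds.
move: h; rewrite min_r// => h.
have V0 := excluded1_gt0.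
have hV := decay_le_const Qrho rho_pos d_gt0 eta_gt0 V0 b ed2.
have c2V : 0 < c2 * expR (excluded d rbar rho 1) by rewrite mulr_gt0 ?expR_gt0.
apply: (is_Theta_near c10 c2V).
near=> x.
have x0 : 0 < x by near: x; exact: nbhs_pinfty_gt.
have -> : TNAR x = Citr x * expR (decay x) by near: x; exact: total_costE.
have dV : decay x <= excluded d rbar rho 1 by near: x; exact: hV.
have [] : c1 * x `^ 2 <= Citr x /\ Citr x <= c2 * x `^ 2 by near: x; exact: h.
rewrite powR_mulrn ?(ltW x0)// => h1 h2.
have C0 : 0 <= Citr x by apply: le_trans h1; rewrite mulr_ge0 ?sqr_ge0// ltW.
have d0 := decay_ge0 eta Q b (ltW x0).
split; first exact: sqr_ge0.
  by apply: (le_trans h1); rewrite ler_peMr// -expR0 ler_expR.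
by rewrite mulrAC ler_pM ?expR_ge0 ?ler_expR.
Unshelve. all: by end_near. Qed.

End algorithm.

Theorem proposition2 (R : realType) (disp : measure_display)
    (T : measurableType disp) (P : probability T R)
    (d : nat) (eta rbar : R) (R0 R0' : {RV P >-> R})
    (b : boundary) (s : R -> sample P d) (Citr : R -> R)
    (d_ge1 : (1 <= d)%N) (eta_gt0 : 0 < eta)
    (R0_bounded : {ae P, forall w, 0 < R0 w <= rbar})
    (R0_copy : independent_copy R0 R0')
    (s_law : forall lambda : R, 0 < lambda -> 2 * rbar / lambda `^ eta < 1 ->
       sample_law R0 eta lambda (s lambda))
    (cost : iteration_cost_model b s Citr) :
  let ed := eta * d%:R in
  let gamma := unit_ball_volume R d in
  let m1 := fine 'E_P[fun w => (R0 w + R0' w) ^+ d] in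
  let TNAR := total_cost b s Citr in
  is_Theta Citr (fun lambda => lambda `^ Num.min ed 2) /\
  [/\ 2 <= ed -> is_Theta TNAR (fun lambda => lambda ^+ 2),
      1 < ed < 2 ->
        exists eps : R -> R, eps x @[x --> +oo] --> 0 /\
          is_Theta TNAR (fun lambda =>
            lambda `^ ed *
              expR ((gamma * m1 / 2 + eps lambda) * lambda `^ (2 - ed))),
      (* delta * lambda is meant up to o(lambda): on the Euclidean cube -ln P has
         a surface term of order lambda `^ (1 - 1 / d). *)
      ed = 1 ->
        exists (delta : R) (deltal : R -> R),
          [/\ 0 < delta <= 1, forall lambda, 0 < deltal lambda <= 1,
              deltal x @[x --> +oo] --> delta &
              is_Theta TNAR (fun lambda =>
                lambda `^ ed * expR (deltal lambda * lambda))]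
    & 0 < ed < 1 ->
        exists eps : R -> R, eps x @[x --> +oo] --> 0 /\
          is_Theta TNAR (fun lambda =>
            lambda `^ ed * expR ((1 + eps lambda) * lambda))].
Proof.
move=> ed gamma m1 TNAR.
have rho_pos := radius_law_support R0_bounded.
have rho_large := radius_law_large R0_bounded.
(* A single intensity supplies [Q]: the law of the spheres with unscaled radii does not depend on
   lambda. *)
have [l [l0 law]] := filter_ex (near_sample_law eta_gt0 R0_bounded s_law).
have [Q Qrho] := exists_spheres_law l0 law.
have V0 := excluded1_gt0 d R0_bounded.
have VE : excluded d rbar (distribution P R0 : probability R R) 1 = gamma * m1.
  by rewrite /excluded expr1n mulr1 /m1 (mean_pair_size_copy d R0_bounded R0_copy).
have Theta := is_Theta_total_cost d_ge1 eta_gt0 R0_bounded s_law cost Qrho.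
split.
  exact: (is_Theta_iteration_cost d_ge1 eta_gt0 R0_bounded s_law cost Qrho).
split.
- exact: (is_Theta_total_cost_sqr d_ge1 eta_gt0 R0_bounded s_law cost Qrho).
- move=> ed12; have [ed1 ed2] := andP ed12.
  (* Chosen so that the exponent is exactly [decay] for positive lambda; that it vanishes in the
     limit is the content of [cvg_decay_intermediate]. *)
  exists (fun x => decay eta Q b x / x `^ (2 - ed) - gamma * m1 / 2); split.
    rewrite -(subrr (gamma * m1 / 2)); apply: cvgB; last exact: cvg_cst.
    by rewrite -VE; exact: (cvg_decay_intermediate Qrho rho_pos d_ge1 eta_gt0 V0 b).
  apply: Theta; first exact: ltW.
  near=> x; have x0 : 0 < x by near: x; exact: nbhs_pinfty_gt.
  by rewrite addrC subrK divfK// gt_eqF// powR_gt0.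
- move=> ed1.
  have [delta d01 cvg_delta] := cvg_decay_critical Qrho rho_pos d_ge1 eta_gt0 V0 ed1 b.
  pose f x := decay eta Q b x / x.
  have near_f : \forall x \near +oo, 0 < f x <= 1.
    near=> x; have x0 : 0 < x by near: x; exact: nbhs_pinfty_gt.
    apply/andP; split; last by rewrite ler_pdivrMr// mul1r decay_le_id// ltW.
    near: x; apply: (cvgr_gt delta) cvg_delta _ _; by case/andP: d01.
  have near_fE : \forall x \near +oo, f x = if 0 < f x <= 1 then f x else 1.
    by apply: filterS near_f => x ->.
  (* The bounds on [deltal] are demanded for every lambda, while the ratio is known to obey them
     only for large ones; elsewhere 1 is a harmless default. *)
  exists delta, (fun x => if 0 < f x <= 1 then f x else 1); split=> //.
  + by move=> x; case: ifPn => // _; rewrite ltr01 lexx.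
  + by apply: cvg_trans cvg_delta; apply: near_eq_cvg.
  apply: Theta; first by rewrite -/ed ed1 ler1n.
  near=> x; have x0 : 0 < x by near: x; exact: nbhs_pinfty_gt.
  have -> : 0 < f x <= 1 by near: x; exact: near_f.
  by rewrite divfK// gt_eqF.
- move=> /andP[_ ed1].
  exists (fun x => decay eta Q b x / x - 1); split.
    rewrite -(subrr 1); apply: cvgB; last exact: cvg_cst.
    exact: (cvg_decay_small Qrho rho_pos rho_large eta_gt0).
  apply: Theta; first by rewrite (le_trans (ltW ed1))// ler1n.
  near=> x; have x0 : 0 < x by near: x; exact: nbhs_pinfty_gt.
  by rewrite addrC subrK divfK// gt_eqF.
Unshelve. all: by end_near. Qed.
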